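(* Let $EP \in e\mathcal{MPGN}4$. Suppose $EP$ contains three pairwise adjacent vertices $a,b,c$, each of degree $5$, together with six further distinct vertices $d,v_1,v_2,v_3,v_4,v_5$ such that the neighbourhoods are $N(a)=\{b,c,d,v_1,v_2\}$, $N(b)=\{a,c,d,v_4,v_5\}$, $N(c)=\{a,b,v_2,v_3,v_4\}$ (so that $d$-$v_1$-$v_2$-$v_3$-$v_4$-$v_5$-$d$ is the cycle of neighbours surrounding the triangle $abc$). Then it is impossible that $\deg(v_1)=5$ and $\deg(d)=6$; that is, $EP$ contains no such configuration with $\deg(a)=\deg(b)=\deg(c)=\deg(v_1)=5$ and $\deg(d)=6$.
   Context: All graphs are simple and connected. A maximal planar graph (MPG) is a planar graph to which no edge joining two nonadjacent vertices can be added while keeping it planar (equivalently, for at least 3 vertices, a plane graph all of whose faces are triangles). Let $\mathcal{N}4$ be the set of all simple connected planar graphs that are not 4-colorable (in the usual proper vertex-coloring sense). Then $e\mathcal{MPGN}4$ denotes the set of graphs $EP\in\mathcal{N}4$ that are maximal planar graphs and have the minimum possible number of vertices among graphs in $\mathcal{N}4$ (i.e., minimal counterexamples to the Four Color Theorem that are MPGs). $\deg(x)$ denotes the degree of vertex $x$ and $N(x)$ its set of neighbours. *)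

(* Defs.v *)
From HB Require Import structures.
From mathcomp Require Import all_boot all_order all_algebra.
From mathcomp Require Import all_classical all_reals all_analysis.
From mathcomp Require Import Rstruct Rstruct_topology.
Set Implicit Arguments. Unset Strict Implicit. Unset Printing Implicit Defensive.
Import Order.TTheory GRing.Theory Num.Theory.

Local Open Scope classical_set_scope.
Local Open Scope ring_scope.

Definition Real := Rdefinitions.R.
Definition plane := (Real * Real)%type.

Definition simple_graph (T : finType) (e : rel T) : Prop :=
  symmetric e /\ irreflexive e.

Definition connected_graph (T : finType) (e : rel T) : Prop :=
  forall x y : T, connect e x y.

Definition neighbours (T : finType) (e : rel T) (x : T) : {set T} :=
  [set y | e x y].

Definition deg (T : finType) (e : rel T) (x : T) : nat := #|neighbours e x|.

Definition colorable (k : nat) (T : finType) (e : rel T) : Prop :=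
  exists c : T -> 'I_k, forall x y, e x y -> c x != c y.

(* Planarity (topological): vertices are sent injectively to points of the
   plane, every edge xy (given for each ordered pair) is a simple arc
   [0,1] -> R^2 from the image of x to the image of y, whose interior
   contains no vertex image, and arcs of two different (unordered) edges
   meet only at images of common endpoints. *)
Definition planar (T : finType) (e : rel T) : Prop :=
  exists (f : T -> plane) (P : T -> T -> Real -> plane),
    injective f /\
    (forall x y, e x y ->
       [/\ {within `[0, 1]%classic, continuous (P x y)},
           P x y 0 = f x, P x y 1 = f y,
           {in `[0, 1]%classic &, injective (P x y)} &
           forall t z, 0 < t < 1 -> P x y t != f z]) /\
    (forall x y u w, e x y -> e u w -> [set x; y] != [set u; w] ->
       forall s t, 0 <= s <= 1 -> 0 <= t <= 1 -> P x y s = P u w t ->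
       exists2 z, z \in [set x; y] :&: [set u; w] & P x y s = f z).

Definition add_edge (T : finType) (e : rel T) (x y : T) : rel T :=
  fun u v => e u v || ([set u; v] == [set x; y]).

Definition maximal_planar (T : finType) (e : rel T) : Prop :=
  planar e /\
  forall x y, x != y -> ~~ e x y -> ~ planar (add_edge e x y).

Definition inN4 (T : finType) (e : rel T) : Prop :=
  [/\ simple_graph e, connected_graph e, planar e & ~ colorable 4 e].

Definition in_eMPGN4 (T : finType) (e : rel T) : Prop :=
  [/\ inN4 e, maximal_planar e &
      forall (T' : finType) (e' : rel T'), inN4 e' -> #|T| <= #|T'| ]%N.

(* Main.v *)
(* The configuration is reducible.  Delete the hub a, b, c, d, v1; around it the
   other vertices form a closed walk of length 7, the ring v2, p, q, y, v5, v4, v3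
   (possibly with repetitions), where p, q are the unnamed neighbors of v1 and
   q, y those of d.  By minimality the rest of the graph has a 4-coloring.  With
   colors in (Z/2)^2, for every nonzero g the chains of vertices joined by edges
   of color difference g induce a noncrossing partition of the ring, and g may be
   added on any union of chains.  A finite computation shows that, whatever these
   partitions are, at most 5 such changes make every coloring of the ring extend
   to the hub.

   Noncrossing is derived from the topological definition of planarity as
   follows.  By uniform continuity the drawing can be rounded to a fine square
   grid, where vertices and edges become disjoint connected sets of cells; every
   cell is then given the label of some vertex, with connected fibers.  In the
   triangular lattice obtained by adding one diagonal to each square, call two
   labels adjacent if some lattice edge joins them.  Conversely, squeezing the
   unit segments of spanning forests of the fibers one after the other draws all
   these adjacencies in the plane, so a maximal planar graph is exactly this
   quotient of the lattice.  In the lattice the two sides of a closed walk are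
   given by the parity of its crossings with rays, and in the absence of
   separating vertices and edges (which minimality provides) they descend,
   together with the rotations around vertices, to the quotient. *)
Require Import Defs.
From mathcomp Require Import all_boot all_order.
From mathcomp Require all_algebra all_fingroup.
From mathcomp Require boolp all_classical all_reals all_analysis.
From mathcomp Require Rstruct Rstruct_topology.
From mathcomp Require zify ring lra.

Set Implicit Arguments. Unset Strict Implicit. Unset Printing Implicit Defensive.

(** * Cells, lattice adjacency and discrete drawings *)

Module Lattice.
Import all_algebra zify.
Import Order.TTheory GRing.Theory Num.Theory.
Local Open Scope ring_scope.

(** The obstacle is the Jordan curve theorem: a topological drawing gives neither sides of a closed
    curve nor rotations at vertices. On the lattice, separation is a count of parities. Maximality
    enters because labels that touch without being adjacent in [e] could be joined by a further
    edge.

    Writing the colors as (Z/2)^2 treats both pairs of colors of difference g at once: the chains of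
    the two pairs are noncrossing together, and one switch may involve chains of both. Since the
    partition realized by the graph is unknown, the computation has the form of a game: an adversary
    chooses a noncrossing partition of the ring, then a union of its blocks is switched.

    Because ring vertices may repeat, positions on the ring are tracked by the darts from the hub to
    the ring, which are distinct. *)

Definition cell := (int * int)%type.
Definition adj4 (p q : cell) : bool :=
  q - p \in [:: (1, 0); (0, 1); (-1, 0); (0, -1)].
Definition adj6 (p q : cell) : bool :=
  q - p \in [:: (1, 0); (1, 1); (0, 1); (-1, 0); (-1, -1); (0, -1)].
Definition in_box (M : int) (p : cell) : bool := (`|p.1| <= M) && (`|p.2| <= M).

(** Fibers are connected by [adj4], although labels are compared along [adj6]: the trees to be
    squeezed must consist of axis-parallel unit segments. One label [x0] fills the outside, so only
    finitely many cells matter. *)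
Record labelling (T : eqType) (M : int) (x0 : T) (lam : cell -> T) : Prop :=
  Labelling {
    lab_out : forall p, (M <= `|p.1|) || (M <= `|p.2|) -> lam p = x0;
    lab_conn : forall p q, in_box M p -> in_box M q -> lam p = lam q ->
      exists s, [/\ path adj4 p s, last p s = q &
                  all (fun r => in_box M r && (lam r == lam p)) s] }.

Definition qedge (T : eqType) (lam : cell -> T) (x y : T) : Prop :=
  x <> y /\ exists p q, [/\ adj6 p q, lam p = x & lam q = y].

Lemma adj4_sym p q : adj4 p q = adj4 q p.
Proof.
case: p q => [a b] [c d]; rewrite /adj4 !inE -!pair_eqE /pair_eq /=.
by apply/idP/idP; lia.
Qed.

Lemma adj6C p q : adj6 p q = adj6 q p.
Proof.
case: p q => [a b] [c d]; rewrite /adj6 !inE -!pair_eqE /pair_eq /=.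
by apply/idP/idP; lia.
Qed.

Lemma adj4_adj6 p q : adj4 p q -> adj6 p q.
Proof. by rewrite /adj4 /adj6 !inE => /or4P[] ->; rewrite ?orbT. Qed.

(** A cell outside the box has only neighbors with a coordinate of absolute value at least [M], so
    both cells get the label [x0]; this is why [lab_out] includes the border of the box. *)
Lemma edge_in_box (T : eqType) M (x0 : T) lam p q : labelling M x0 lam ->
  adj6 p q -> lam p <> lam q -> in_box M p.
Proof.
move=> lamP A N; apply/negPn/negP => B; apply: N.
have Bp : (M <= `|p.1|) || (M <= `|p.2|) by move: B; rewrite /in_box; lia.
have Bq : (M <= `|q.1|) || (M <= `|q.2|).
  case: p q A B {Bp} => [a b] [c d]; rewrite /adj6 /in_box !inE -!pair_eqE /pair_eq /=; lia.
by rewrite (lab_out lamP Bp) (lab_out lamP Bq).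
Qed.

Section Orient.
Context (T : finType) (e : rel T).

(** In a drawing the arcs of [x y] and [y x] may be unrelated curves; one of them is kept for each
    edge. *)
Definition oriented (x y : T) : bool := e x y && (enum_rank x < enum_rank y)%N.

Definition third_end (x y : T) (k : nat) := if k == 0 then x else y.

(* Thirds [k] of the edge [x y] and [k'] of the edge [x' y'] that are disjoint:
   the middle thirds (k = 1) belong to their edges, the outer ones to a vertex. *)
Definition apart (x y : T) (k : nat) (x' y' : T) (k' : nat) : bool :=
  if k == 1 then
    if k' == 1 then (x, y) != (x', y') else third_end x' y' k' \notin [:: x; y]
  else
    if k' == 1 then third_end x y k \notin [:: x'; y']
    else third_end x y k != third_end x' y' k'.

(** Arcs with a common end cannot be kept apart near it, hence the thirds of [L] steps: nothing is
    demanded of two outer thirds at the same vertex, nor of a middle third and an outer third at one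
    of its ends. *)
Record discrete_drawing (L : nat) (v : T -> cell) (w : T -> T -> nat -> cell) : Prop :=
  DiscreteDrawing {
    dd_pos : (0 < L)%N;
    dd_src : forall x y, oriented x y -> w x y 0 = v x;
    dd_tgt : forall x y, oriented x y -> w x y (3 * L)%N = v y;
    dd_step : forall x y j, oriented x y ->
      w x y j.+1 = w x y j \/ adj4 (w x y j) (w x y j.+1);
    dd_apart : forall x y x' y' k k' j j', oriented x y -> oriented x' y' ->
      (k < 3)%N -> (k' < 3)%N -> (k * L <= j <= k.+1 * L)%N -> (k' * L <= j' <= k'.+1 * L)%N ->
      apart x y k x' y' k' -> w x y j <> w x' y' j' }.
End Orient.

End Lattice.

(** * Drawing a quotient of the lattice in the plane *)

Module Realization.
Import all_algebra all_classical all_reals all_analysis Rstruct Rstruct_topology.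
Import Defs.
Import zify ring lra.
Import Order.TTheory GRing.Theory Num.Theory numFieldNormedType.Exports.
Local Open Scope classical_set_scope.
Local Open Scope ring_scope.
Import Lattice.

(** For fixed [t] this is the identity of the line outside [0, 2]. If [|t| < 1], it starts at 0 with
    slope [|t|] and catches up with slope 2; at [t = 0] the interval [0, 1] shrinks to the point
    0. *)
Definition squeeze (R : realFieldType) (s t : R) : R :=
  Num.max (Num.min s (Num.min 1 `|t| * s)) (Num.min s (2 * s - 2)).

Lemma squeeze_id (R : realFieldType) (s t : R) : [|| s <= 0, 2 <= s | 1 <= `|t|] -> squeeze s t = s.
Proof.
have k1 : Num.min 1 `|t| <= 1 by rewrite ge_min lexx.
have k0 : 0 <= Num.min 1 `|t| by rewrite le_min ler01 normr_ge0.
rewrite /squeeze => H; have [h|h] := leP s 0.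
  rewrite (min_idPl _); last by nra.
  by rewrite (min_idPr _) ?(max_idPl _) //; lra.
have [h2|h2] := leP 2 s.
  rewrite [X in Num.max _ X](min_idPl _); last by lra.
  by rewrite (max_idPr _) // ge_min lexx.
move: H; rewrite (lt_geF h) (lt_geF h2) /= => H.
by rewrite (min_idPl H) mul1r minxx (max_idPl _) // ge_min lexx.
Qed.

Lemma squeeze_axis (R : realFieldType) (s : R) : squeeze s 0 =
  if s <= 0 then s else if s <= 1 then 0 else if s <= 2 then 2 * s - 2 else s.
Proof.
have [h|h] := leP s 0; first by apply: squeeze_id; rewrite h.
have [h2|h2] := leP s 2; last by rewrite squeeze_id ?(ltW h2) ?orbT // ifF //; lra.
rewrite /squeeze normr0 [Num.min 1 0](min_idPr _) ?ler01 // mul0r (min_idPr _) ?(ltW h) //.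
rewrite (min_idPr _); last by lra.
by case: leP => h1; [rewrite (max_idPl _)|rewrite (max_idPr _)] => //; lra.
Qed.

(** For nonzero [t], minima and maxima of strictly increasing functions of [s] are strictly
    increasing; only the axis [t = 0] loses an interval. *)
Lemma squeeze_inj (R : realFieldType) (s s' t : R) : squeeze s t = squeeze s' t ->
  s = s' \/ [/\ t = 0, 0 <= s <= 1 & 0 <= s' <= 1].
Proof.
wlog lss : s s' / s < s'.
  move=> W; case: (ltgtP s s') => [l|l|->]; [exact: W| |by left].
  by move=> /esym /(W _ _ l) [->|[-> ? ?]]; [left|right].
move=> E; right.
have k0 := normr_ge0 t; have t0 := @normr0_eq0 _ _ t.
have [k00|kp] : `|t| = 0 \/ 0 < `|t| by lra.
  move: E; rewrite (t0 k00) !squeeze_axis => {k0 t0 k00} E.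
  have H : 0 <= s /\ s' <= 1.
  {
    move: E; case: (leP s 0) => h1; [|case: (leP s 1) => h2; [|case: (leP s 2) => h3]].
    all: case: (leP s' 0) => h4; [|case: (leP s' 1) => h5; [|case: (leP s' 2) => h6]] => E.
    all: by split; lra. }
  by case: H => h1 h2; split=> //; apply/andP; split=> //; lra.
exfalso; have km : 0 < Num.min 1 `|t| by rewrite lt_min ltr01.
have : squeeze s t < squeeze s' t; last by rewrite E ltxx.
have M (x y x' y' : R) : x < x' -> y < y' -> Num.min x y < Num.min x' y'.
  by move=> xx yy; rewrite lt_min !gt_min xx yy orbT.
have MM (x y x' y' : R) : x < x' -> y < y' -> Num.max x y < Num.max x' y'.
  by move=> xx yy; rewrite gt_max !lt_max xx yy orbT.
by apply: MM; apply: M => //; rewrite ?ltr_pM2l //; lra.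
Qed.

Section Cont.
Context (R : realType) (T : topologicalType).
Implicit Types f g : T -> R.

Lemma contD f g : continuous f -> continuous g -> continuous (fun z => f z + g z).
Proof. by move=> cf cg z; apply: (@continuousD _ _ _ f g); [exact: cf|exact: cg]. Qed.

Lemma contB f g : continuous f -> continuous g -> continuous (fun z => f z - g z).
Proof. by move=> cf cg z; apply: (@continuousB _ _ _ f g); [exact: cf|exact: cg]. Qed.

Lemma contM f g : continuous f -> continuous g -> continuous (fun z => f z * g z).
Proof. by move=> cf cg z; apply: (@continuousM _ _ f g); [exact: cf|exact: cg]. Qed.

Lemma cont_pair (U V : topologicalType) (f : T -> U) (g : T -> V) :
  continuous f -> continuous g -> continuous (fun z => (f z, g z)).
Proof.
move=> cf cg z; apply: cvg_pair; [exact: cf|exact: cg].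
Qed.

Lemma continuous_squeeze f g :
  continuous f -> continuous g -> continuous (fun z => squeeze (f z) (g z)).
Proof.
move=> cf cg z; rewrite /squeeze.
apply: (@continuous_max _ _ (fun z => Num.min (f z) (Num.min 1 `|g z| * f z)) (fun z => Num.min (f z) (2 * f z - 2))).
  apply: (@continuous_min _ _ f (fun z => Num.min 1 `|g z| * f z)); first exact: cf.
  apply: (@continuousM _ _ (fun z => Num.min 1 `|g z|) f); last exact: cf.
  apply: (@continuous_min _ _ (cst 1) (fun z => `|g z|)); first exact: cst_continuous.
  by apply: (cvg_norm (cg z)).
apply: (@continuous_min _ _ f (fun z => 2 * f z - 2)); first exact: cf.
by apply: contB; [apply: contM => //|]; exact: cst_continuous.
Qed.

End Cont.

(* Collapses the unit segment from [v] in direction [d] to the point [v]. *)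
Definition collapse (R : realType) (v d : cell) (z : R * R) : R * R :=
  let s := d.1%:~R * (z.1 - v.1%:~R) + d.2%:~R * (z.2 - v.2%:~R) in
  let t := d.1%:~R * (z.2 - v.2%:~R) - d.2%:~R * (z.1 - v.1%:~R) in
  (z.1 + d.1%:~R * (squeeze s t - s), z.2 + d.2%:~R * (squeeze s t - s)).

Lemma continuous_collapse (R : realType) v d : continuous (@collapse R v d).
Proof.
have c1 : continuous (fst : R * R -> R) by move=> z; exact: cvg_fst.
have c2 : continuous (snd : R * R -> R) by move=> z; exact: cvg_snd.
have cc (k : R) : continuous (fun _ : R * R => k) by exact: cst_continuous.
have L (a b c e : R) : continuous (fun z : R * R => a * (z.1 - c) + b * (z.2 - e)).
  by apply: contD; apply: contM => //; apply: contB.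
have L' (a b c e : R) : continuous (fun z : R * R => a * (z.2 - c) - b * (z.1 - e)).
  by apply: contB; apply: contM => //; apply: contB.
have S (a b c e a' b' c' e' : R) : continuous (fun z : R * R =>
   squeeze (a * (z.1 - c) + b * (z.2 - e)) (a' * (z.2 - c') - b' * (z.1 - e'))).
  by apply: continuous_squeeze.
by rewrite /collapse; apply: cont_pair; apply: contD => //; apply: contM => //; apply: contB.
Qed.

Section Plane.
Context (R : realType).
Implicit Types (p q u v d : cell) (z : R * R) (s t : R).

Definition emb p : R * R := (p.1%:~R, p.2%:~R).

Definition seg p q t : R * R :=
  (p.1%:~R + t * (q - p).1%:~R, p.2%:~R + t * (q - p).2%:~R).

Definition along v d z := d.1%:~R * (z.1 - v.1%:~R) + d.2%:~R * (z.2 - v.2%:~R).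
Definition across v d z := d.1%:~R * (z.2 - v.2%:~R) - d.2%:~R * (z.1 - v.1%:~R).

Definition dirs4 : seq cell := [:: (1, 0); (0, 1); (-1, 0); (0, -1)].

Lemma dirs4P d : d \in dirs4 ->
  (d.1%:~R : R, d.2%:~R : R) \in [:: (1, 0); (0, 1); (-1, 0); (0, -1)].
Proof. by rewrite !inE => /or4P[] /eqP -> /=; rewrite ?mulrN1z ?mulr0z eqxx ?orbT. Qed.

Lemma frame_inj v d z z' : d \in dirs4 ->
  along v d z = along v d z' -> across v d z = across v d z' -> z = z'.
Proof.
case: z z' => [a b] [a' b'] /dirs4P; rewrite /along /across /=.
rewrite !inE !xpair_eqE => /or4P[] /andP[/eqP-> /eqP->] H1 H2; congr pair; lra.
Qed.

Lemma along_collapse v d z : d \in dirs4 ->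
  along v d (collapse v d z) = squeeze (along v d z) (across v d z).
Proof.
case: z => [a b] /dirs4P; rewrite /along /across /collapse /=.
by rewrite !inE !xpair_eqE => /or4P[] /andP[/eqP-> /eqP->]; ring.
Qed.

Lemma across_collapse v d z : d \in dirs4 ->
  across v d (collapse v d z) = across v d z.
Proof.
case: z => [a b] /dirs4P; rewrite /along /across /collapse /=.
by rewrite !inE !xpair_eqE => /or4P[] /andP[/eqP-> /eqP->]; ring.
Qed.

Definition on_seg v u z := exists2 t, 0 <= t <= 1 & z = seg v u t.

Lemma on_segP v u z : u - v \in dirs4 ->
  on_seg v u z <-> 0 <= along v (u - v) z <= 1 /\ across v (u - v) z = 0.
Proof.
rewrite /on_seg /seg /along /across; case: z => a b; move: (u - v) => d /dirs4P /= D.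
split.
  move=> [t tb [-> ->]]; move: D; rewrite !inE !xpair_eqE.
  move=> /or4P[] /andP[/eqP-> /eqP->]; split; lra.
move=> [h1 h2]; exists (d.1%:~R * (a - v.1%:~R) + d.2%:~R * (b - v.2%:~R)) => //.
move: D h2; rewrite !inE !xpair_eqE.
move=> /or4P[] /andP[/eqP-> /eqP->] h2; congr pair; lra.
Qed.

Lemma collapse_inj v u z z' : u - v \in dirs4 ->
  collapse v (u - v) z = collapse v (u - v) z' ->
  z = z' \/ on_seg v u z /\ on_seg v u z'.
Proof.
move=> D E; have E1 := congr1 (along v (u - v)) E; have E2 := congr1 (across v (u - v)) E.
move: E1 E2; rewrite !along_collapse // !across_collapse // => E1 E2.
move: E1; rewrite E2 => /squeeze_inj[E1|[h1 h2 h3]].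
  by left; exact: frame_inj E1 E2.
by right; rewrite !on_segP // E2.
Qed.

Lemma collapse_id v d z :
  [|| along v d z <= 0, 2 <= along v d z | 1 <= `|across v d z|] ->
  collapse v d z = z.
Proof.
move=> /squeeze_id H; case: z H => a b; rewrite /collapse /along /across /= => ->.
by rewrite subrr !mulr0 !addr0.
Qed.

Lemma collapse_seg v u z : u - v \in dirs4 -> on_seg v u z ->
  collapse v (u - v) z = emb v.
Proof.
have A : along v (u - v) (emb v) = 0 /\ across v (u - v) (emb v) = 0.
  by rewrite /along /across /emb /= !subrr !mulr0 subrr addr0.
move=> D /(on_segP _ D)[/andP[h1 h3] h2]; apply: (@frame_inj v (u - v)) => //.
  rewrite along_collapse // h2 squeeze_axis h3 A.1.
  by case: leP => h4 //; apply/eqP; rewrite eq_le h4 h1.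
by rewrite across_collapse // h2 A.2.
Qed.

Lemma emb_on_seg v u : on_seg v u (emb v) /\ on_seg v u (emb u).
Proof.
split; [exists 0|exists 1]; rewrite ?lexx ?ler01 // /emb /seg.
  by rewrite !mul0r !addr0.
by rewrite !mul1r -!intrD /= !(addrC _ (_ - _)) !subrK.
Qed.

Lemma along_emb v d p :
  along v d (emb p) = (d.1 * (p.1 - v.1) + d.2 * (p.2 - v.2))%:~R.
Proof. by rewrite /along /emb !(intrD, intrM) !intrN. Qed.

Lemma across_emb v d p :
  across v d (emb p) = (d.1 * (p.2 - v.2) - d.2 * (p.1 - v.1))%:~R.
Proof. by rewrite /across /emb intrB !intrM !intrB. Qed.

Lemma along_seg v d p q t : along v d (seg p q t) =
  along v d (emb p) + t * (d.1 * (q - p).1 + d.2 * (q - p).2)%:~R.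
Proof. by rewrite /along /seg /emb /= !(intrD, intrM, intrN); ring. Qed.

Lemma across_seg v d p q t : across v d (seg p q t) =
  across v d (emb p) + t * (d.1 * (q - p).2 - d.2 * (q - p).1)%:~R.
Proof. by rewrite /across /seg /emb /= !(intrD, intrM, intrN); ring. Qed.

(* A lattice segment avoiding [u] stays outside the support of the collapse. *)
Lemma collapse_fix v u p q z : u - v \in dirs4 -> q - p \in dirs4 ->
  p != u -> q != u -> on_seg p q z -> collapse v (u - v) z = z.
Proof.
move=> D D' pu qu [t /andP[t0 t1] ->]; apply: collapse_id.
rewrite along_seg across_seg along_emb across_emb.
have : v + (u - v) != p by rewrite addrC subrK eq_sym.
have : v + (u - v) != p + (q - p) by rewrite !(addrC _ (_ - _)) !subrK eq_sym.
move: D D' {pu qu}; move: (u - v) (q - p) => d d' D D' N1 N2.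
have [m em] : exists m, m = d.1 * (p.1 - v.1) + d.2 * (p.2 - v.2) by eexists.
have [n en] : exists n, n = d.1 * (p.2 - v.2) - d.2 * (p.1 - v.1) by eexists.
have [m' em'] : exists m, m = d.1 * d'.1 + d.2 * d'.2 by eexists.
have [n' en'] : exists n, n = d.1 * d'.2 - d.2 * d'.1 by eexists.
rewrite -em -en -em' -en'.
(* In the frame at [v] the segment runs from (m, n) to (m + m', n + n'), and [u] is (1, 0), the only
   lattice point where 0 < along < 2 and |across| < 1. An axis-parallel unit segment avoiding it
   lies in one of the four closed half-planes beyond the sides of this region. *)
have [M1 M2 M3] : [/\ (m != 1) || (n != 0), (m + m' != 1) || (n + n' != 0) &
   [\/ m' = 1 /\ n' = 0, m' = -1 /\ n' = 0, m' = 0 /\ n' = 1 | m' = 0 /\ n' = -1]].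
  move: D D' N1 N2; rewrite -!pair_eqE /pair_eq /= !inE -!pair_eqE /pair_eq /=.
  move: em en em' en'; case: v d p d' => [v1 v2] [d1 d2] [p1 p2] [e1 e2] /=.
  move=> em en em' en'.
  by move=> /or4P[] /andP[/eqP ? /eqP ?] /or4P[] /andP[/eqP ? /eqP ?]; subst; split; try lia; first [by constructor 1|by constructor 2|by constructor 3|by constructor 4].
have NB (x : R) : 1 <= x \/ x <= -1 -> 1 <= `|x|.
  by move=> H; rewrite ler_normr; apply/orP; case: H => H; [left|right]; lra.
have toR (i j : int) : i <= j -> (i%:~R : R) <= j%:~R by rewrite ler_int.
have {M1 M2 M3} : [\/ m + m' <= 0 /\ m <= 0, 2 <= m + m' /\ 2 <= m,
    1 <= n + n' /\ 1 <= n | n + n' <= -1 /\ n <= -1].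
  have [M|] := boolP [|| (m + m' <= 0) && (m <= 0), (2 <= m + m') && (2 <= m),
    (1 <= n + n') && (1 <= n) | (n + n' <= -1) && (n <= -1)]; last by case: M3 => -[]; lia.
  by case/or4P: M => /andP[? ?]; [constructor 1|constructor 2|constructor 3|constructor 4].
case=> -[/toR]; rewrite intrD => E1 /toR E2.
- apply/or3P; constructor 1; nra.
- apply/or3P; constructor 2; nra.
- apply/or3P; constructor 3; apply: NB; left; nra.
- apply/or3P; constructor 3; apply: NB; right; rewrite mulrN1z in E1 E2; nra.
Qed.
End Plane.

Section Plane.
Context (R : realType).
Implicit Types (p q u v d : cell) (z : R * R) (s t : R).

Lemma emb_inj : injective (@emb R).
Proof. by case=> [a b] [a' b'] [/intr_inj -> /intr_inj ->]. Qed.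

Lemma seg_sym p q t : seg p q t = seg q p (1 - t) :> R * R.
Proof. by rewrite /seg /= !intrB; congr pair; ring. Qed.

Definition at_end p q t (r : cell) := (r = p /\ t = 0) \/ (r = q /\ t = 1).

Definition meeting p q t p' q' t' := [\/ p = p' /\ q = q', p = q' /\ q = p' |
  exists r, [/\ at_end p q t r, at_end p' q' t' r & seg p q t = emb R r]].

Lemma seg0 p q : seg p q 0 = emb R p.
Proof. by rewrite /seg !mul0r !addr0. Qed.

Lemma seg1 p q : seg p q 1 = emb R q.
Proof. by rewrite seg_sym subrr seg0. Qed.

Lemma at_end_sym p q t r : at_end q p (1 - t) r -> at_end p q t r.
Proof. by case=> -[-> h]; [right|left]; split=> //; lra. Qed.

Lemma meeting_sym p q t p' q' t' : meeting q p (1 - t) p' q' t' -> meeting p q t p' q' t'.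
Proof.
case=> [[-> ->]|[-> ->]|[r [/at_end_sym h1 h2 h3]]]; [by constructor 2|by constructor 1|].
by constructor 3; exists r; split=> //; rewrite seg_sym.
Qed.

Lemma meetingC p q t p' q' t' : seg p q t = seg p' q' t' ->
  meeting p' q' t' p q t -> meeting p q t p' q' t'.
Proof.
move=> E [[-> ->]|[-> ->]|[r [h1 h2 h3]]]; [by constructor 1|by constructor 2|].
by constructor 3; exists r; split=> //; rewrite E.
Qed.

Definition dirs3 : seq cell := [:: (1, 0); (1, 1); (0, 1)].

Definition isint (x : R) := exists k : int, x = k%:~R.

Lemma isint_itv t : 0 <= t <= 1 -> isint t -> t = 0 \/ t = 1.
Proof.
move=> /andP[t0 t1] [k kt]; move: t0 t1; rewrite {}kt ler0z lerz1 => k0 k1.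
have K : k = 0 \/ k = 1 by lia.
by case: K => ->; [left|right].
Qed.

(** Integral on the lattice and constant in direction [d]: for [d] in [dirs3] its integral level
    lines are the lattice lines of that direction. *)
Definition form d z : R := d.2%:~R * z.1 - d.1%:~R * z.2.

Definition cross (d d' : cell) : int := d'.2 * d.1 - d'.1 * d.2.

Lemma form_seg d p q t :
  exists k : int, form d (seg p q t) = k%:~R + t * (cross (q - p) d)%:~R.
Proof.
exists (d.2 * p.1 - d.1 * p.2).
by rewrite /form /seg /cross; move: (q - p) => e /=; rewrite !(intrB, intrM); ring.
Qed.

Lemma cross3 d d' : d \in dirs3 -> d' \in dirs3 ->
  [\/ d = d', cross d d' = 1 | cross d d' = -1].
Proof.
by rewrite !inE => /or3P[] /eqP -> /or3P[] /eqP ->;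
  first [by constructor 1|by constructor 2; apply/eqP|by constructor 3; apply/eqP].
Qed.

(* [z] lies in the interior of a lattice edge iff exactly one of the three
   forms is integral at [z]; the form tells the direction of the edge. *)
Lemma isint_param p q t d : q - p \in dirs3 -> d \in dirs3 -> d <> q - p ->
  isint (form d (seg p q t)) <-> isint t.
Proof.
move=> D D' N; have [k ->] := form_seg d p q t.
have [E|->|->] := cross3 D D'; first by rewrite E in N.
  rewrite mulr1; split=> -[m M]; first by exists (m - k); rewrite intrB -M; ring.
  by exists (k + m); rewrite M intrD.
rewrite mulrN1z mulrN1; split=> -[m M]; first by exists (k - m); rewrite intrB -M; ring.
by exists (k - m); rewrite M intrB.
Qed.

Lemma isint_form p q t : isint (form (q - p) (seg p q t)).
Proof.
have [k ->] := form_seg (q - p) p q t; exists k.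
by rewrite /cross (mulrC (q - p).2) subrr mulr0 addr0.
Qed.

Lemma isint_form_all p q t d : q - p \in dirs3 -> d \in dirs3 -> isint t ->
  isint (form d (seg p q t)).
Proof.
move=> D D' I; have [->|/eqP N] := eqVneq d (q - p); first exact: isint_form.
by apply/(isint_param _ D D' N).
Qed.

Lemma dirs3_other d : exists2 d', d' \in dirs3 & d' <> d.
Proof.
by have [->|/eqP N] := eqVneq d (1, 0); [exists (0, 1)|exists (1, 0) => // /esym].
Qed.

(** Integrality of the three forms tells whether the common point is a lattice point and, if it is
    not, the direction of both edges; parallel edges with a common interior point coincide. *)
Lemma seg_meet3 p q t p' q' t' : q - p \in dirs3 -> q' - p' \in dirs3 ->
  0 <= t <= 1 -> 0 <= t' <= 1 -> seg p q t = seg p' q' t' ->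
  meeting p q t p' q' t'.
Proof.
move=> D D' tb tb' E.
have T : isint t -> isint t'.
  move=> I; have [d Dd N] := dirs3_other (q' - p').
  by apply/(isint_param _ D' Dd N); rewrite -E; exact: isint_form_all.
have T' : isint t' -> isint t.
  move=> I; have [d Dd N] := dirs3_other (q - p).
  by apply/(isint_param _ D Dd N); rewrite E; exact: isint_form_all.
have [I|I] := pselect (isint t).
  constructor 3; have := isint_itv tb' (T I); have := isint_itv tb I.
  move=> [] e [] e'; move: E; rewrite e e' ?seg0 ?seg1 => /emb_inj E.
  - by exists p; rewrite ?seg0; split=> //; left.
  - by exists p; rewrite ?seg0; split=> //; [left|right].
  - by exists q; rewrite ?seg1; split=> //; [right|left].
  - by exists q; rewrite ?seg1; split=> //; right.
have F : q' - p' = q - p.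
  apply/eqP/negPn/negP => /eqP N; apply: I.
  by apply/(isint_param _ D D' N); rewrite E; exact: isint_form.
constructor 1.
suff pp : p = p'.
  by split=> //; rewrite -[q](subrK p) -F pp subrK.
have E1 : p.1%:~R + t * (q - p).1%:~R = p'.1%:~R + t' * (q - p).1%:~R.
  by rewrite -[in RHS]F; exact: (congr1 fst E).
have E2 : p.2%:~R + t * (q - p).2%:~R = p'.2%:~R + t' * (q - p).2%:~R.
  by rewrite -[in RHS]F; exact: (congr1 snd E).
(* In a common direction the parameters differ by an integer, and both lie strictly between 0 and
   1. *)
have e0 : t = t'.
  have : isint (t - t').
    move: D E1 E2; move: (q - p) => d; rewrite !inE => /or3P[] /eqP -> /= E1 E2.
    - by exists (p'.1 - p.1); rewrite intrB; lra.
    - by exists (p'.1 - p.1); rewrite intrB; lra.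
    - by exists (p'.2 - p.2); rewrite intrB; lra.
  have J0 : isint 0 by exists 0.
  have J1 : isint 1 by exists 1.
  move=> [k K]; have N0 : t != 0 by apply: contra_notN I => /eqP ->.
  have N1 : t != 1 by apply: contra_notN I => /eqP ->.
  have N0' : t' != 0 by apply: contra_notN I => /eqP e; apply: T'; rewrite e.
  have N1' : t' != 1 by apply: contra_notN I => /eqP e; apply: T'; rewrite e.
  have k01 : (-1 < k) && (k < 1).
    rewrite -!(ltr_int R) -K; move: N0 N1 N0' N1' tb tb'; clear; lra.
  have k0 : k = 0 by clear -k01; lia.
  by move: K; rewrite k0; lra.
move: E1 E2; rewrite e0 => /addIr /intr_inj E1 /addIr /intr_inj E2.
by case: p p' E1 E2 {D D' E T T' I F} => a b [a' b'] /= -> ->.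
Qed.
End Plane.

Section Forest.
Context (R : realType).
Implicit Types (p q u v d : cell) (z : R * R) (s t : R).

Lemma adj6_dirs3 p q : adj6 p q -> (q - p \in dirs3) || (p - q \in dirs3).
Proof.
rewrite -[p - q]opprB /adj6; move: (q - p) => d.
by rewrite !inE => /or4P[/eqP->|/eqP->|/eqP->|/or3P[]/eqP->].
Qed.

Lemma seg_meet p q t p' q' t' : adj6 p q -> adj6 p' q' ->
  0 <= t <= 1 -> 0 <= t' <= 1 -> seg p q t = seg p' q' t' :> R * R ->
  meeting p q t p' q' t'.
Proof.
have B (x : R) : 0 <= x <= 1 -> 0 <= 1 - x <= 1 by lra.
move=> /adj6_dirs3 /orP[] D /adj6_dirs3 /orP[] D' tb tb' E.
- exact: seg_meet3.
- by apply: meetingC => //; apply: meeting_sym; apply: seg_meet3 (B _ tb') tb _ => //; rewrite -seg_sym.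
- by apply: meeting_sym; apply: seg_meet3 (B _ tb) tb' _ => //; rewrite -seg_sym.
- apply: meeting_sym; apply: meetingC; rewrite -?seg_sym //.
  by apply: meeting_sym; apply: seg_meet3 (B _ tb') (B _ tb) _ => //; rewrite -!seg_sym.
Qed.

Lemma on_seg_emb p q r : adj6 p q -> on_seg p q (emb R r) -> r = p \/ r = q.
Proof.
move=> A [t tb E]; have Ar : adj6 r (r + (1, 0)) by rewrite /adj6 addrAC subrr.
have := @seg_meet p q t r (r + (1, 0)) 0 A Ar tb.
rewrite seg0 lexx ler01 -E => /(_ isT erefl) [[<- _]|[_ <-]|[r' [h1 h2 h3]]].
- by left.
- by right.
- by rewrite (emb_inj (etrans E h3)); case: h1 => -[-> _]; [left|right].
Qed.

Context (T : eqType) (lam : cell -> T) (roots : seq cell).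

(** The leaf grafted last is collapsed first: no other segment of the forest ends there, so all of
    them stay fixed. *)
Fixpoint collapses (f : seq (cell * cell)) : R * R -> R * R :=
  if f is (v, u) :: f' then collapses f' \o collapse v (u - v) else id.

Definition nodes (f : seq (cell * cell)) := roots ++ [seq e.2 | e <- f].

(* Edges [(parent, leaf)], the last grafted leaf coming first. *)
Fixpoint growth (f : seq (cell * cell)) : bool :=
  if f is (v, u) :: f' then
    [&& growth f', v \in nodes f', u \notin nodes f', adj4 v u & lam u == lam v]
  else true.

Definition tree (f : seq (cell * cell)) x z :=
  (exists p : cell, [/\ p \in roots, lam p = x & z = emb R p]) \/
  (exists e, [/\ e \in f, lam e.2 = x & on_seg e.1 e.2 z]).

Lemma continuous_collapses f : continuous (collapses f).
Proof.
elim: f => [|[v u] f IH] /= z; first exact: cvg_id.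
by apply: continuous_comp; [exact: continuous_collapse|exact: IH].
Qed.

Lemma growthP f e : growth f -> e \in f ->
  [/\ e.1 \in nodes f, e.2 \in nodes f, adj4 e.1 e.2 & lam e.2 = lam e.1].
Proof.
elim: f => [|[v u] f IH] //= /and5P[gf vf uf A /eqP L]; rewrite inE.
have S p : p \in nodes f -> p \in nodes ((v, u) :: f).
  by rewrite /nodes !mem_cat /= inE => /orP[]->; rewrite ?orbT.
case/orP => [/eqP -> /=|/(IH gf)[h1 h2 h3 h4]]; split=> //; try exact: S.
by rewrite /nodes mem_cat /= inE eqxx orbT.
Qed.

Lemma nodes_tree f p : growth f -> p \in nodes f -> tree f (lam p) (emb R p).
Proof.
move=> gf; rewrite mem_cat => /orP[pr|/mapP[e ef ->]]; first by left; exists p.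
right; exists e; split=> //; exact: (emb_on_seg _ _ _).2.
Qed.

Lemma tree_emb f x p : growth f -> tree f x (emb R p) -> lam p = x.
Proof.
move=> gf [[q [_ <- h]]|[e [ef <-]]]; first by rewrite (emb_inj h).
have [_ _ A L] := growthP gf ef.
by move=> /(on_seg_emb (adj4_adj6 A)) [->|->].
Qed.

Lemma collapse_fix_emb v u p : adj4 v u -> p != u ->
  collapse v (u - v) (emb R p) = emb R p.
Proof.
move=> A pu; have [d Dd du] : exists2 d, d \in dirs4 & p + d != u.
  have [e|ne] := eqVneq (p + (1, 0)) u; last by exists (1, 0).
  by exists (0, 1) => //; rewrite -e (inj_eq (addrI p)).
apply: (collapse_fix (p := p) (q := p + d)) => //; first by rewrite addrAC subrr add0r.
exact: (emb_on_seg _ _ _).1.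
Qed.

Lemma collapse_tree v u f x z : growth ((v, u) :: f) -> tree f x z ->
  collapse v (u - v) z = z.
Proof.
case/and5P=> gf vf uf A _ [[p [pr _ ->]]|[e [ef _ ez]]].
  by apply: collapse_fix_emb => //; apply: contraNneq uf => <-; rewrite mem_cat pr.
have [h1 h2 h3 _] := growthP gf ef.
by apply: collapse_fix ez => //; apply: contraNneq uf => <-.
Qed.

(** The last segment goes to its parent node, a point of the smaller forest, on which [collapse] is
    the identity; so each tree shrinks to a root. *)
Lemma collapses_tree f x z : growth f -> tree f x z ->
  exists p, [/\ p \in roots, lam p = x & collapses f z = emb R p].
Proof.
elim: f z => [|[v u] f IH] z gf; first by case=> [[p [? ? ->]]|[e []]] //; exists p.
have /and5P[gf' vf uf A /eqP L] := gf => tz /=.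
suff : tree f x (collapse v (u - v) z) by move=> /(IH _ gf').
have [[e [ef]]|H] : (exists e, [/\ e \in [:: (v, u)], lam e.2 = x & on_seg e.1 e.2 z]) \/ tree f x z.
- case: tz => [H|[e []]]; first by right; left.
  rewrite inE => /orP[/eqP ->|ef] h1 h2; first by left; exists (v, u); rewrite inE.
  by right; right; exists e.
- move: ef; rewrite inE => /eqP -> /= <- h; rewrite collapse_seg // L.
  exact: nodes_tree.
- by rewrite (collapse_tree gf H).
Qed.

Lemma collapses_inj f z z' : growth f -> collapses f z = collapses f z' ->
  z = z' \/ exists x, tree f x z /\ tree f x z'.
Proof.
elim: f z z' => [|[v u] f IH] z z' gf; first by left.
have /and5P[gf' vf uf A /eqP L] := gf => /= E.
have S y w : tree f y w -> tree ((v, u) :: f) y w.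
  by case=> [|[e [ef h1 h2]]]; [left|right; exists e; rewrite inE ef orbT].
have H y w : on_seg v u w -> y = lam u -> tree ((v, u) :: f) y w.
  by move=> h ->; right; exists (v, u); rewrite inE eqxx.
have [/collapse_inj [] //|[x [t1 t2]]] := IH _ _ gf' E; first by left.
  by move=> [h1 h2]; right; exists (lam u); split; apply: H.
have K w : tree f x (collapse v (u - v) w) -> tree ((v, u) :: f) x w.
  (* The image of [w] is on the smaller forest, hence a fixed point: [w] and its image have the same
     image. *)
  move=> tw; have /(collapse_inj A) := collapse_tree gf tw.
  case=> [<-|[h1 h2]]; first exact: S.
  apply: H => //; have := tw; rewrite collapse_seg // => /(tree_emb gf') <-.
  by [].
by right; exists x; split; exact: K.
Qed.

End Forest.

Lemma seg_inj (R : realType) p q (t t' : R) : adj6 p q -> seg p q t = seg p q t' -> t = t'.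
Proof.
move=> A E; have E1 : p.1%:~R + t * (q - p).1%:~R = p.1%:~R + t' * (q - p).1%:~R.
  exact: (congr1 fst E).
have {E} E2 : p.2%:~R + t * (q - p).2%:~R = p.2%:~R + t' * (q - p).2%:~R.
  exact: (congr1 snd E).
move: A E1 E2; rewrite /adj6; move: (q - p) => d; rewrite !inE.
by case/or4P=> [/eqP->|/eqP->|/eqP->|/or3P[]/eqP->] /=; rewrite ?mulrN1z ?mulr0z; lra.
Qed.

Lemma continuous_seg (R : realType) p q : continuous (fun t : R => seg p q t).
Proof.
have cc (k : R) : continuous (fun _ : R => k) by exact: cst_continuous.
have ci : continuous (fun t : R => t) by move=> t; exact: cvg_id.
by apply: (@cont_pair R); apply: (@contD R) => //; apply: (@contM R).
Qed.

Section Graft.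
Context (T : eqType) (lam : cell -> T) (roots : seq cell).

Lemma graft_path f v s : growth lam roots f -> v \in nodes roots f ->
  path adj4 v s -> all (fun r => lam r == lam v) s ->
  exists f', [/\ growth lam roots f', {subset nodes roots f <= nodes roots f'} &
    {subset s <= nodes roots f'}].
Proof.
elim: s f v => [|w s IH] f v gf vf /=.
  by exists f; split=> // r; rewrite in_nil.
case/andP=> vw ps /andP[/eqP lw als].
have als' : all (fun r => lam r == lam w) s by rewrite lw.
have [wf|wf] := boolP (w \in nodes roots f).
  have [f' [h1 h2 h3]] := IH _ _ gf wf ps als'.
  by exists f'; split=> // r; rewrite inE => /orP[/eqP ->|/h3//]; exact: h2.
have N r : (r \in nodes roots ((v, w) :: f)) = (r == w) || (r \in nodes roots f).
  by rewrite !mem_cat /= inE orbCA.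
have gf' : growth lam roots ((v, w) :: f) by rewrite /= gf vf wf vw lw eqxx.
have [|f' [h1 h2 h3]] := IH ((v, w) :: f) w gf' _ ps als'; first by rewrite N eqxx.
exists f'; split=> // r; first by move=> rf; apply: h2; rewrite N rf orbT.
by rewrite inE => /orP[/eqP ->|/h3//]; apply: h2; rewrite N eqxx.
Qed.

Lemma graft_all (ps : seq cell) :
  (forall p, p \in ps -> exists r s, [/\ r \in roots, path adj4 r s, last r s = p &
     all (fun r' => lam r' == lam r) s]) ->
  exists f, growth lam roots f /\ {subset ps <= nodes roots f}.
Proof.
elim: ps => [|p ps IH] H; first by exists [::].
have [|f [gf sf]] := IH; first by move=> q qs; apply: H; rewrite inE qs orbT.
have [|r [s [rr pp lp al]]] := H p; first by rewrite inE eqxx.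
have rf : r \in nodes roots f by rewrite mem_cat rr.
have [f' [h1 h2 h3]] := graft_path gf rf pp al.
exists f'; split=> // q; rewrite inE => /orP[/eqP ->|/sf/h2//].
by have := mem_last r s; rewrite lp inE => /orP[/eqP ->|/h3//]; exact: h2.
Qed.

End Graft.

Section Realize.
Context (T : finType) (M : int) (x0 : T) (lam : cell -> T).
Hypothesis lamP : labelling M x0 lam.

(** One lattice segment is chosen for each adjacency. It meets the trees of the fibers only at its
    ends, so once every tree is collapsed to its root, the segments are simple arcs that meet only
    at common vertices. *)
Lemma realize (e : rel T) : (forall x y, e x y -> qedge lam x y) ->
  (forall x, exists2 p, in_box M p & lam p = x) -> planar e.
Proof.
move=> eQ surj.
have [root rootP] := choice (fun x => let: ex_intro2 p h1 h2 := surj x in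
   ex_intro (fun p => in_box M p /\ lam p = x) p (conj h1 h2)).
have : forall xy : T * T, exists pq : cell * cell, e xy.1 xy.2 ->
   [/\ adj6 pq.1 pq.2, lam pq.1 = xy.1 & lam pq.2 = xy.2].
  move=> [x y]; have [exy|] := boolP (e x y); last by exists (0, 0).
  by have [_ [p [q H]]] := eQ _ _ exy; exists (p, q).
move=> /choice [ed edP].
have exy_neq x y : e x y -> x <> y by move=> /eQ [].
pose roots := codom root.
pose es := [seq xy <- enum {: T * T} | e xy.1 xy.2].
have inE2 x y : e x y -> (x, y) \in es by move=> exy; rewrite mem_filter exy mem_enum.
(* The trees need only reach the ends of the chosen segments. *)
pose ps := [seq (ed xy).1 | xy <- es] ++ [seq (ed xy).2 | xy <- es].
have [f [gf psf]] : exists f, growth lam roots f /\ {subset ps <= nodes roots f}.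
  apply: graft_all => p pps.
  have Bp : in_box M p.
    move: pps; rewrite mem_cat => /orP[] /mapP[[x y]]; rewrite mem_filter => /andP[/= exy _] ->;
    have [/= A h1 h2] := edP (x, y) exy; have N := exy_neq _ _ exy.
      by apply: (edge_in_box lamP A); rewrite h1 h2.
    by rewrite adj6C in A; apply: (edge_in_box lamP A); rewrite h1 h2 => E; apply: N.
  have [Br Lr] := rootP (lam p).
  have [s [h1 h2 h3]] := lab_conn lamP Br Bp Lr.
  exists (root (lam p)), s; split=> //; first exact: codom_f.
  by apply: sub_all h3 => r /andP[].
have rootE p : p \in roots -> p = root (lam p).
  by case/codomP=> x ->; rewrite (rootP x).2.
pose Phi := @collapses Real f.
have PhiE x z : tree lam roots f x z -> Phi z = Phi (emb Real (root x)).
  have tr : tree lam roots f x (emb Real (root x)).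
    by left; exists (root x); rewrite codom_f ?(rootP x).2.
  have [p' [pr' px' E']] := collapses_tree gf tr.
  move=> /(collapses_tree gf) [p [pr px E]].
  by rewrite /Phi E E' (rootE _ pr) (rootE _ pr') px px'.
have nodeP x y : e x y -> let pq := ed (x, y) in
    [/\ pq.1 \in nodes roots f & pq.2 \in nodes roots f].
  move=> exy; split; apply: psf; rewrite mem_cat; apply/orP; [left|right];
  by apply/mapP; exists (x, y) => //; exact: inE2.
have nodePhi p : p \in nodes roots f -> Phi (emb Real p) = Phi (emb Real (root (lam p))).
  by move=> pn; apply: PhiE; apply: nodes_tree.
(* A chosen segment joins different labels, so it is not a segment of a tree. *)
have key x y t w : e x y -> 0 <= t <= 1 ->
    tree lam roots f w (seg (ed (x, y)).1 (ed (x, y)).2 t : Real * Real) ->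
    (t = 0 /\ w = x) \/ (t = 1 /\ w = y).
  move=> exy tb; have [/= A L1 L2] := edP (x, y) exy.
  move: A L1 L2; move: (ed (x, y)) => [p q] /= A L1 L2 [[r [_ <- E]]|[g [gfe <- [t' tb' E]]]].
    have [] := @on_seg_emb Real p q r A; first by exists t.
      by move=> rp; left; split; [apply: (seg_inj A); rewrite seg0 E rp|rewrite rp].
    by move=> rq; right; split; [apply: (seg_inj A); rewrite seg1 E rq|rewrite rq].
  have [_ _ A' L'] := growthP gf gfe.
  have N := exy_neq _ _ exy.
  have [[e1 e2]|[e1 e2]|[r [[[-> ->]|[-> ->]] h2 _]]] := seg_meet A (adj4_adj6 A') tb tb' E.
  - by case: N; rewrite -L1 -L2 e1 e2.
  - by case: N; rewrite -L1 -L2 e1 e2.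
  - left; split=> //; rewrite -L1.
    by case: h2 => -[-> _].
  - right; split=> //; rewrite -L2.
    by case: h2 => -[-> _].
exists (fun x => Phi (emb Real (root x))).
exists (fun x y t => Phi (seg (ed (x, y)).1 (ed (x, y)).2 t)).
have troot x : tree lam roots f x (emb Real (root x)).
  by left; exists (root x); rewrite codom_f ?(rootP x).2.
have I01 : 0 <= (0 : Real) <= 1 by rewrite lexx ler01.
have I11 : 0 <= (1 : Real) <= 1 by rewrite lexx ler01.
split; [|split].
- move=> x y /(collapses_inj gf) [/emb_inj E|[z [t1 t2]]].
    by rewrite -(rootP x).2 E (rootP y).2.
  by rewrite -(rootP x).2 -(rootP y).2 (tree_emb gf t1) (tree_emb gf t2).
- move=> x y exy; have [/= A L1 L2] := edP (x, y) exy; have [n1 n2] := nodeP _ _ exy.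
  split.
  + apply: continuous_subspaceT => t.
    apply: (@continuous_comp _ _ _ (fun t => seg (ed (x, y)).1 (ed (x, y)).2 t) Phi);
      last exact: continuous_collapses.
    exact: continuous_seg.
  + by rewrite seg0 nodePhi // L1.
  + by rewrite seg1 nodePhi // L2.
  + move=> t t'; rewrite !inE /= !in_itv /= => tb tb' /(collapses_inj gf) [/(seg_inj A)//|[w [t1 t2]]].
    have N := exy_neq _ _ exy.
    have := key _ _ _ _ exy tb t1; have := key _ _ _ _ exy tb' t2.
    by move=> [[-> ->]|[-> ->]] [[-> E]|[-> E]]; rewrite // E in N.
  + move=> t z /andP[t0 t1]; apply/eqP => /(collapses_inj gf) H.
    have tb : 0 <= t <= 1 by rewrite !ltW.
    have : tree lam roots f z (seg (ed (x, y)).1 (ed (x, y)).2 t).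
      case: H => [->|[w [h1 h2]]]; first exact: troot.
      by rewrite -(rootP z).2 (tree_emb gf h2).
    by move=> /(key _ _ _ _ exy tb) [[e0 _]|[e0 _]]; move: t0 t1; rewrite e0 ltxx.
- move=> x y u w exy euw N s t sb tb E.
  have [/= A L1 L2] := edP (x, y) exy; have [n1 n2] := nodeP _ _ exy.
  have [/= A' L1' L2'] := edP (u, w) euw; have [n1' n2'] := nodeP _ _ euw.
  have [E'|[c [h1 h2]]] := collapses_inj gf E.
    have [[e1 e2]|[e1 e2]|[r [h1 h2 h3]]] := seg_meet A A' sb tb E'.
    + have ex : x = u by rewrite -[LHS]L1 e1 L1'.
      have ey : y = w by rewrite -[LHS]L2 e2 L2'.
      by case/eqP: N; rewrite ex ey.
    + have ex : x = w by rewrite -[LHS]L1 e1 L2'.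
      have ey : y = u by rewrite -[LHS]L2 e2 L1'.
      by case/eqP: N; rewrite ex ey classical_sets.setUC.
    + exists (lam r).
        rewrite inE; apply/andP; split; rewrite !inE.
          by case: h1 => -[-> _]; rewrite ?L1 ?L2 eqxx ?orbT.
        by case: h2 => -[-> _]; rewrite ?L1' ?L2' eqxx ?orbT.
      rewrite h3; apply: nodePhi; by case: h1 => -[-> _].
  exists c; last by exact: PhiE.
  rewrite inE; apply/andP; split; rewrite !inE.
    by have [[_ ->]|[_ ->]] := key _ _ _ _ exy sb h1; rewrite eqxx ?orbT.
  by have [[_ ->]|[_ ->]] := key _ _ _ _ euw tb h2; rewrite eqxx ?orbT.
Qed.
End Realize.

End Realization.

(** * Rounding a planar drawing to lattice paths *)

Module Discretization.
Import all_algebra all_classical all_reals all_analysis Rstruct Rstruct_topology.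
Import Defs.
Import zify ring lra.
Import Order.TTheory GRing.Theory Num.Theory numFieldNormedType.Exports.
Local Open Scope classical_set_scope.
Local Open Scope ring_scope.
Import Lattice Realization.

Section Real.
Context (R : realType).

Lemma pos_min (T : topologicalType) (f : T -> R) (A : set T) :
  compact A -> continuous f -> (forall z, A z -> 0 < f z) ->
  exists2 eps, 0 < eps & forall z, A z -> eps <= f z.
Proof.
move=> cA cf f0; have [A0|/set0P/negP/negPn/eqP A0] := pselect (A !=set0); last first.
  by exists 1 => // z; rewrite A0.
have [c cA' cmin] := compact_EVT_min A0 cA (continuous_subspaceT cf).
exists (f c); first by apply: f0; rewrite inE in cA'.
by move=> z Az; apply: cmin; rewrite inE.
Qed.

(** Arcs are continuous only within the unit interval; precomposed with [clamp] they are continuous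
    on the whole line. *)
Definition clamp (t : R) : R := Num.max 0 (Num.min 1 t).

Lemma clamp_itv t : 0 <= clamp t <= 1.
Proof. by rewrite /clamp le_max lexx ge_max ler01 ge_min lexx. Qed.

Lemma clampE t : 0 <= t <= 1 -> clamp t = t.
Proof. by case/andP=> t0 t1; rewrite /clamp (min_idPr t1) (max_idPr t0). Qed.

Lemma continuous_clamp : continuous clamp.
Proof.
have ci : continuous (fun t : R => t) by move=> t; exact: cvg_id.
have cc (k : R) : continuous (fun _ : R => k) by exact: cst_continuous.
move=> t; have := @continuous_max R R (fun _ => 0) (fun t => Num.min 1 t) t.
apply; first exact: cc.
by have := @continuous_min R R (fun _ => 1) (fun t => t) t; apply; [exact: cc|exact: ci].
Qed.

Lemma continuous_clamped (U : topologicalType) (g : R -> U) :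
  {within `[0, 1]%classic, continuous g} -> continuous (g \o clamp).
Proof.
move=> /subspace_continuousP cg t.
have ct s : `[0, 1]%classic (clamp s) by rewrite /= in_itv /= clamp_itv.
have := cg _ (ct t) => cgt.
apply: cvg_comp cgt => B; rewrite /within /= => nB.
have H : nbhs t (fun s => `[0, 1]%classic (clamp s) -> B (clamp s)) := continuous_clamp nB.
by apply: filterS H => s; apply; exact: ct.
Qed.

Definition dist (z w : R * R) : R := `|z.1 - w.1| + `|z.2 - w.2|.

Lemma dist_gt0 z w : z <> w -> 0 < dist z w.
Proof.
move=> N; rewrite lt0r addr_ge0 ?normr_ge0 // andbT; apply/eqP => /eqP.
rewrite paddr_eq0 ?normr_ge0 // !normr_eq0 !subr_eq0 => /andP[/eqP h1 /eqP h2].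
by apply: N; case: z w h1 h2 => a b [c d] /= -> ->.
Qed.

Lemma continuous_dist (T : topologicalType) (g h : T -> R * R) :
  continuous g -> continuous h -> continuous (fun z => dist (g z) (h z)).
Proof.
have c1 : continuous (fst : R * R -> R) by move=> z; exact: cvg_fst.
have c2 : continuous (snd : R * R -> R) by move=> z; exact: cvg_snd.
move=> cg ch; have F (k : R * R -> R) : continuous k ->
    continuous (fun z => `|k (g z) - k (h z)|).
  move=> ck z; apply: (@cvg_norm _ _ _ (nbhs z)); move: z.
  apply: contB => z; apply: continuous_comp; by [exact: cg|exact: ch|exact: ck].
by apply: contD; [exact: F c1|exact: F c2].
Qed.

Lemma separation (g h : R -> R * R) (a b c d : R) :
  continuous g -> continuous h ->
  (forall s t, a <= s <= b -> c <= t <= d -> g s <> h t) ->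
  exists2 eps, 0 < eps & forall s t, a <= s <= b -> c <= t <= d -> eps <= dist (g s) (h t).
Proof.
move=> cg ch N.
have cA : compact (`[a, b]%classic `*` `[c, d]%classic).
  by apply: compact_setX; exact: segment_compact.
have cf : continuous (fun z : R * R => dist (g z.1) (h z.2)).
  apply: (@continuous_dist _ (fun z : R * R => g z.1) (fun z => h z.2)) => z.
    by apply: (@continuous_comp _ _ _ fst g); [exact: cvg_fst|exact: cg].
  by apply: (@continuous_comp _ _ _ snd h); [exact: cvg_snd|exact: ch].
have [|eps e0 H] := pos_min cA cf.
  by move=> [s t] /= [] /=; rewrite !in_itv /= => h1 h2; apply: dist_gt0; exact: N.
by exists eps => // s t h1 h2; apply: (H (s, t)); split; rewrite /= in_itv.
Qed.

(** The pairs of parameters whose images are at distance at least [eps] form a compact set, on which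
    [|s - t|] has a positive lower bound. *)
Lemma unif (g : R -> R * R) (eps : R) : 0 < eps -> continuous g ->
  exists2 del, 0 < del & forall s t, 0 <= s <= 1 -> 0 <= t <= 1 -> `|s - t| < del ->
    dist (g s) (g t) < eps.
Proof.
move=> e0 cg.
have cS : compact (`[0, 1]%classic `*` `[0, 1]%classic : set (R * R)).
  by apply: compact_setX; exact: segment_compact.
have cf : continuous (fun z : R * R => dist (g z.1) (g z.2)).
  apply: (@continuous_dist _ (fun z : R * R => g z.1) (fun z => g z.2)) => z.
    by apply: (@continuous_comp _ _ _ fst g); [exact: cvg_fst|exact: cg].
  by apply: (@continuous_comp _ _ _ snd g); [exact: cvg_snd|exact: cg].
have cC : closed [set z : R * R | eps <= dist (g z.1) (g z.2)].
  have := @closed_comp _ _ _ _ (fun z _ => cf z) (@closed_ge _ eps); exact.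
have cA := compact_closedI cS cC.
have cd : continuous (fun z : R * R => `|z.1 - z.2|).
  move=> z; apply: (@cvg_norm _ _ _ (nbhs z)); move: z.
  by apply: contB => z; [exact: cvg_fst|exact: cvg_snd].
have [|del d0 H] := pos_min cA cd.
  move=> [s t] /= [_ /=]; rewrite normr_gt0 subr_eq0 => h; apply/eqP => st.
  by move: h; rewrite st /dist !subrr normr0 addr0 leNgt e0.
exists del => // s t h1 h2 h3; rewrite ltNge; apply/negP => h4.
have := H (s, t); rewrite leNgt h3 => H'; suff: false by [].
by apply: H'; split => //=; split; rewrite /= in_itv.
Qed.

Lemma finite_eps (I : eqType) (r : seq I) (Q : I -> R -> Prop) :
  (forall i x y, x <= y -> Q i y -> Q i x) ->
  (forall i, exists2 x, 0 < x & Q i x) -> exists2 x, 0 < x & forall i, i \in r -> Q i x.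
Proof.
move=> mono ex; elim: r => [|i r [x x0 H]]; first by exists 1.
have [y y0 H'] := ex i; exists (Num.min x y); first by rewrite lt_min x0.
move=> j; rewrite inE => /orP[/eqP ->|/H h].
  by apply: mono H'; rewrite ge_min lexx orbT.
by apply: mono h; rewrite ge_min lexx.
Qed.

End Real.

Section Rounding.
Context (R : realType).
Implicit Types (N : R) (z : R * R).

Definition round N z : cell := (Num.floor (N * z.1), Num.floor (N * z.2)).

Lemma floor_near (x y : R) : `|x - y| < 1 ->
  [\/ Num.floor y = Num.floor x, Num.floor y = Num.floor x + 1 | Num.floor y = Num.floor x - 1].
Proof.
have := floor_itv x; have := floor_itv y.
move: (Num.floor x) (Num.floor y) => a b; rewrite !intrD => /andP[b1 b2] /andP[a1 a2].
rewrite ltr_norml => /andP[h1 h2].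
have : b < a + 2 by rewrite -(ltr_int R) intrD; lra.
have : a < b + 2 by rewrite -(ltr_int R) intrD; lra.
move=> k1 k2; have [->|/eqP n1] := eqVneq b a; first by constructor 1.
have [->|/eqP n2] := eqVneq b (a + 1); first by constructor 2.
by constructor 3; lia.
Qed.

Lemma floor_dist (x : R) : `|x - (Num.floor x)%:~R| <= 1.
Proof.
have := floor_itv x; rewrite intrD => /andP[h1 h2].
by rewrite ler_norml; lra.
Qed.

(* Row moves first, so that consecutive cells are 4-adjacent or equal. *)
Definition zigzag N (g : R -> R * R) (m j : nat) : cell :=
  let c i := round N (g (i%:R / (3 * m)%:R)) in
  if odd j then ((c j./2.+1).1, (c j./2).2) else c j./2.

Lemma zigzag_step N g m j :
  (forall i, let z := g (i%:R / (3 * m)%:R) in let z' := g (i.+1%:R / (3 * m)%:R) in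
     `|N * z.1 - N * z'.1| < 1 /\ `|N * z.2 - N * z'.2| < 1) ->
  zigzag N g m j.+1 = zigzag N g m j \/ adj4 (zigzag N g m j) (zigzag N g m j.+1).
Proof.
move=> H; have [/floor_near h1 /floor_near h2] := H j./2.
rewrite /zigzag /= uphalf_half; case: (odd j); rewrite /= ?add0n ?add1n.
  case: h2 => h; rewrite /round /= h; [by left| |]; right;
  by rewrite /adj4 !inE -!pair_eqE /pair_eq /= subrr addrAC subrr ?orbT.
case: h1 => h; rewrite /round /= h; [by left| |]; right;
by rewrite /adj4 !inE -!pair_eqE /pair_eq /= subrr addrAC subrr ?orbT.
Qed.

(** Rounding costs at most 1 in each coordinate; an odd index takes its first coordinate from the
    next sample, which costs one more. With two steps per sample, [m] samples make a third of
    [2 * m] steps. *)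
Lemma zigzag_near N g m k j : (0 < m)%N ->
  (forall i, let z := g (i%:R / (3 * m)%:R) in let z' := g (i.+1%:R / (3 * m)%:R) in
     `|N * z.1 - N * z'.1| < 1 /\ `|N * z.2 - N * z'.2| < 1) ->
  (k * (2 * m) <= j <= k.+1 * (2 * m))%N ->
  exists t, [/\ k%:R / 3 <= t <= k.+1%:R / 3, `|N * (g t).1 - (zigzag N g m j).1%:~R| <= 2 &
    `|N * (g t).2 - (zigzag N g m j).2%:~R| <= 2].
Proof.
move=> m0 H /andP[j1 j2].
have m3 : (0 : R) < (3 * m)%:R by rewrite ltr0n; lia.
exists (j./2%:R / (3 * m)%:R); split.
- rewrite ler_pdivlMr // ler_pdivrMr // natrM.
  have -> : k%:R / 3 * (3 * m%:R) = (k * m)%:R :> R by rewrite natrM; field.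
  have -> : k.+1%:R / 3 * (3 * m%:R) = (k.+1 * m)%:R :> R by rewrite natrM; field.
  by rewrite !ler_nat; lia.
- rewrite /zigzag; case: ifP => _; last by apply: le_trans (floor_dist _) _; rewrite ler1n.
  have [h _] := H j./2; rewrite /round /=.
  have := floor_dist (N * (g (j./2.+1%:R / (3 * m)%:R)).1); move: h => /= .
  move: (Num.floor _)%:~R => f; rewrite ltr_norml !ler_norml; lra.
- rewrite /zigzag; case: ifP => _; apply: le_trans (floor_dist _) _; by rewrite ler1n.
Qed.
End Rounding.

Section Discretize.
Context (T : finType) (e : rel T).
Hypothesis eirr : irreflexive e.
Variables (f : T -> plane) (P : T -> T -> Real -> plane).
Hypothesis finj : injective f.
Hypothesis arcP : forall x y, e x y ->
       [/\ {within `[0, 1]%classic, continuous (P x y)},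
           P x y 0 = f x, P x y 1 = f y,
           {in `[0, 1]%classic &, injective (P x y)} &
           forall t z, 0 < t < 1 -> P x y t != f z].
Hypothesis crossP : forall x y u w, e x y -> e u w -> [set x; y] != [set u; w] ->
       forall s t, 0 <= s <= 1 -> 0 <= t <= 1 -> P x y s = P u w t ->
       exists2 z, z \in [set x; y] :&: [set u; w] & P x y s = f z.

Let g x y := P x y \o @clamp Real.

Lemma arc_vertex x y t z : e x y -> 0 <= t <= 1 -> P x y t = f z ->
  (t = 0 /\ z = x) \/ (t = 1 /\ z = y).
Proof.
move=> exy /andP[t0 t1] E; have [_ E0 E1 _ N] := arcP exy.
have [e0|n0] := eqVneq t 0; first by left; split=> //; apply: finj; rewrite -E e0.
have [e1|n1] := eqVneq t 1; first by right; split=> //; apply: finj; rewrite -E e1.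
have := N t z; rewrite E eqxx !lt_neqAle t0 t1 n1 eq_sym n0.
by move=> /(_ isT).
Qed.

(** Arcs of different edges meet only at a common vertex, reached by each at parameter 0 or 1, hence
    in outer thirds at that vertex. On a single arc the thirds that are apart are the first and the
    last, separated by injectivity. *)
Lemma thirds_apart x y x' y' k k' s t : oriented e x y -> oriented e x' y' ->
  (k < 3)%N -> (k' < 3)%N -> apart x y k x' y' k' ->
  k%:R / 3 <= s <= k.+1%:R / 3 -> k'%:R / 3 <= t <= k'.+1%:R / 3 ->
  P x y s <> P x' y' t.
Proof.
move=> /andP[exy lxy] /andP[exy' lxy'] k3 k3' ap ks kt E.
have kk (i : nat) : (i < 3)%N -> 0 <= i%:R / 3 :> Real /\ i.+1%:R / 3 <= 1 :> Real.
  move=> i3; split; first by rewrite divr_ge0.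
  by rewrite ler_pdivrMr // mul1r ler_nat.
have sb : 0 <= s <= 1 by have := kk _ k3; case/andP: ks; lra.
have tb : 0 <= t <= 1 by have := kk _ k3'; case/andP: kt; lra.
have third i (r : Real) : (i < 3)%N -> i%:R / 3 <= r <= i.+1%:R / 3 ->
   (r = 0 -> i = 0%N) /\ (r = 1 -> i = 2).
  by case: i => [|[|[|]]] // _ /andP[h1 h2]; split=> e0 //; exfalso; lra.
have [s0 s1] := third _ _ k3 ks; have [t0 t1] := third _ _ k3' kt.
have [/eqP S|S] := boolP ([set x; y] == [set x'; y'] :> classical_sets.set T); last first.
  have [z _ Ez] := crossP exy exy' S sb tb E.
  have := arc_vertex exy sb Ez; have := arc_vertex exy' tb (etrans (esym E) Ez).
  move=> [[/t0 k0 ->]|[/t1 k0 ->]] [[/s0 k0' zz]|[/s1 k0' zz]]; move: ap;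
  by rewrite /apart k0 k0' /third_end /= zz eqxx.
have [ex ey] : x = x' /\ y = y'.
  have : [set x; y]%classic x by left.
  rewrite S => -[] /= ex.
    have : [set x; y]%classic y by right.
    rewrite S => -[] /= ey //.
    by move: exy; rewrite ey ex eirr.
  have : [set x; y]%classic y by right.
  rewrite S => -[] /= ey; last by move: exy; rewrite ey ex eirr.
  by move: lxy; rewrite ex ey ltnNge ltnW.
subst x' y'; have [_ _ _ inj _] := arcP exy.
have st : s = t by apply: inj E; rewrite inE /= in_itv.
subst t; move: ap ks kt {E}; rewrite /apart /third_end.
move: k k' k3 k3' {s0 s1 t0 t1} => [|[|[|]]] // [|[|[|]]] // _ _;
rewrite /= ?inE ?eqxx ?orbT // => _ /andP[? ?] /andP[? ?]; lra.
Qed.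

Lemma continuous_g x y : e x y -> continuous (g x y).
Proof. by move=> /arcP [c _ _ _ _]; exact: continuous_clamped. Qed.

Lemma discretize : exists L v w, @discrete_drawing T e L v w.
Proof.
pose I := (T * T)%type.
have I01 (k : nat) (t : Real) : (k < 3)%N -> k%:R / 3 <= t <= k.+1%:R / 3 -> 0 <= t <= 1.
  move=> k3 /andP[h1 h2]; apply/andP; split.
    by apply: le_trans h1; rewrite divr_ge0.
  by apply: (le_trans h2); rewrite ler_pdivrMr // mul1r ler_nat.
have [eps e0 epsP] : exists2 eps : Real, 0 < eps & forall i : I * I * ('I_3 * 'I_3),
    i \in enum {: I * I * ('I_3 * 'I_3)} ->
    let: ((xy, xy'), (k, k')) := i in
    oriented e xy.1 xy.2 -> oriented e xy'.1 xy'.2 -> apart xy.1 xy.2 k xy'.1 xy'.2 k' ->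
    forall s t, k%:R / 3 <= s <= k.+1%:R / 3 -> k'%:R / 3 <= t <= k'.+1%:R / 3 ->
    eps <= dist (g xy.1 xy.2 s) (g xy'.1 xy'.2 t).
  apply: finite_eps.
    move=> [[xy xy'] [k k']] a b ab H o o' ap s t h1 h2.
    by apply: le_trans ab _; exact: H.
  move=> [[xy xy'] [k k']]; case: xy xy' => x y [x' y'] /=.
  have [/andP[ho /andP[ho' ap]]|N] := boolP [&& oriented e x y, oriented e x' y' & apart x y k x' y' k']; last first.
    exists 1 => // o o' ap; by rewrite o o' ap in N.
  have exy : e x y by case/andP: ho.
  have exy' : e x' y' by case/andP: ho'.
  have [|eps e0 H] := @separation _ (g x y) (g x' y') (k%:R / 3) (k.+1%:R / 3) (k'%:R / 3) (k'.+1%:R / 3)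
     (continuous_g exy) (continuous_g exy').
    move=> s t h1 h2; rewrite /g /= !clampE ?(I01 _ _ _ h1) ?(I01 _ _ _ h2) //.
    exact: thirds_apart h1 h2.
  by exists eps => // _ _ _.
(* After scaling by [N], points rounded to the same cell differ by at most 4 in each coordinate,
   hence by at most 8 in [dist]. *)
have [N N0 Ne] : exists2 N : Real, 0 < N & 8 < N * eps.
  exists (9 / eps); first by rewrite divr_gt0.
  by rewrite divfK ?gt_eqF //; lra.
have [del d0 delP] : exists2 del : Real, 0 < del & forall i : I, i \in enum {: I} ->
    oriented e i.1 i.2 -> forall s t, 0 <= s <= 1 -> 0 <= t <= 1 -> `|s - t| < del ->
    dist (g i.1 i.2 s) (g i.1 i.2 t) < N^-1.
  apply: finite_eps => [i a b ab H o s t h1 h2 h3|[x y] /=].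
    by apply: H => //; exact: lt_le_trans ab.
  have [ho|N1] := boolP (oriented e x y); last by exists 1.
  have exy : e x y by case/andP: ho.
  have [|del d0 H] := @unif _ (g x y) N^-1 _ (continuous_g exy); first by rewrite invr_gt0.
  by exists del.
have [m m0 md] : exists2 m : nat, (0 < m)%N & (3 * m)%:R^-1 < del.
  pose M := Num.bound del^-1.
  have hM : del^-1 < M%:R.
    by apply: archi_boundP; rewrite invr_ge0 ltW.
  exists M.+1 => //; rewrite -[del]invrK ltf_pV2 ?posrE ?invr_gt0 // ?ltr0n //.
  by apply: (lt_le_trans hM); rewrite ler_nat; lia.
have m3 : (0 : Real) < (3 * m)%:R by rewrite ltr0n; lia.
have stepP x y : oriented e x y -> forall i, let z := g x y (i%:R / (3 * m)%:R) in
    let z' := g x y (i.+1%:R / (3 * m)%:R) in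
    `|N * z.1 - N * z'.1| < 1 /\ `|N * z.2 - N * z'.2| < 1.
  move=> o i z z'.
  suff : dist z z' < N^-1.
    rewrite /dist => h; have h1 : `|z.1 - z'.1| < N^-1 by apply: le_lt_trans h; rewrite lerDl.
    have h2 : `|z.2 - z'.2| < N^-1 by apply: le_lt_trans h; rewrite lerDr.
    by rewrite -!mulrBr !normrM (gtr0_norm N0) !(mulrC N) -!ltr_pdivlMr // div1r.
  have [i3|i3] := ltnP i (3 * m).
    apply: (delP (x, y)) => //; rewrite ?mem_enum //.
    - by rewrite divr_ge0 //= ler_pdivrMr // mul1r ler_nat ltnW.
    - by rewrite divr_ge0 //= ler_pdivrMr // mul1r ler_nat.
    - by rewrite -mulrBl -natr1 opprD addNKr mulN1r normrN gtr0_norm ?invr_gt0.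
  (* Past the last sample the clamped arc stands still. *)
  have c1 (j : nat) : (3 * m <= j)%N -> clamp (j%:R / (3 * m)%:R) = 1 :> Real.
    move=> h; rewrite /clamp (min_idPl _) ?(max_idPr _) ?ler01 //.
    by rewrite ler_pdivlMr // mul1r ler_nat.
  by rewrite /z /z' /g /= !c1 ?(leq_trans i3) // /dist !subrr normr0 addr0 invr_gt0.
exists (2 * m)%N, (fun x => round N (f x)), (fun x y => zigzag N (g x y) m).
split.
- by rewrite muln_gt0.
- move=> x y /andP[/arcP [_ h _ _ _] _].
  by rewrite /zigzag /= mul0r /g /= clampE ?lexx ?ler01 // h.
- move=> x y /andP[/arcP [_ _ h _ _] _].
  rewrite /zigzag mulnCA oddM /= -divn2 mulKn // divff ?gt_eqF //.
  by rewrite /g /= clampE ?lexx ?ler01 // h.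
- by move=> x y j o; apply: zigzag_step; exact: stepP.
- move=> x y x' y' k k' j j' o o' k3 k3' hj hj' ap E.
  have [t [tb t1 t2]] := zigzag_near m0 (stepP _ _ o) hj.
  have [t' [tb' t1' t2']] := zigzag_near m0 (stepP _ _ o') hj'.
  have := epsP (((x, y), (x', y')), (Ordinal k3, Ordinal k3')) (mem_enum _ _) o o' ap _ _ tb tb'.
  rewrite /= /dist leNgt => /negP; apply.
  rewrite -(ltr_pM2l N0); apply: le_lt_trans Ne; rewrite mulrDr.
  move: t1 t2 t1' t2'; rewrite -E {E}.
  move: (g x y t) (g x' y' t') (zigzag _ _ _ _) => [a1 a2] [b1 b2] [c1 c2] /=.
  have AB (a b : Real) : N * `|a - b| = `|N * a - N * b|.
    by rewrite -mulrBr normrM gtr0_norm.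
  rewrite !AB; move: (N * a1) (N * a2) (N * b1) (N * b2) => u1 u2 w1 w2.
  rewrite !ler_norml => /andP[? ?] /andP[? ?] /andP[? ?] /andP[? ?].
  have h1 : `|u1 - w1| <= 4 by rewrite ler_norml; lra.
  have h2 : `|u2 - w2| <= 4 by rewrite ler_norml; lra.
  lra.
Qed.
End Discretize.

End Discretization.

(** * From disjoint regions to a labelling of all cells *)

Module Regions.
Import all_algebra boolp zify.
Import Order.TTheory GRing.Theory Num.Theory.
Local Open Scope ring_scope.
Import Lattice.

Definition linked (S : cell -> Prop) (p q : cell) : Prop :=
  exists s, [/\ path adj4 p s, last p s = q & forall r, r \in p :: s -> S r].

Section Linked.
Implicit Types (S : cell -> Prop) (p q r : cell).

Lemma linked_refl S p : S p -> linked S p p.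
Proof. by exists [::]; split=> // r; rewrite inE => /eqP->. Qed.

Lemma linked_trans S p q r : linked S p q -> linked S q r -> linked S p r.
Proof.
move=> [s [s1 <- s3]] [t [t1 <- t3]]; exists (s ++ t); split.
- by rewrite cat_path s1.
- by rewrite last_cat.
- move=> c; rewrite -cat_cons mem_cat => /orP[/s3//|ct]; apply: t3.
  by rewrite inE ct orbT.
Qed.

Lemma linked_sym S p q : linked S p q -> linked S q p.
Proof.
move=> [s [s1 <- s3]]; exists (rev (belast p s)); split.
- by rewrite rev_path; apply: sub_path s1 => a b; rewrite /= adj4_sym.
- by case: s {s1 s3} => //= a s; rewrite rev_cons last_rcons.
- move=> r; rewrite inE mem_rev => /orP[/eqP->|/mem_belast]; last exact: s3.
  by apply: s3; exact: mem_last.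
Qed.

Lemma linked_step S p q : S p -> S q -> adj4 p q -> linked S p q.
Proof.
by move=> Sp Sq A; exists [:: q]; split=> /=; rewrite ?A // => r; rewrite !inE => /orP[]/eqP->.
Qed.

Lemma linked_mono S S' p q : (forall r, S r -> S' r) -> linked S p q -> linked S' p q.
Proof. by move=> SS' [s [s1 s2 s3]]; exists s; split=> // r /s3 /SS'. Qed.

Lemma linked_seq S (f : nat -> cell) (m n : nat) : (m <= n)%N ->
  (forall j, (m <= j <= n)%N -> S (f j)) ->
  (forall j, (m <= j < n)%N -> f j.+1 = f j \/ adj4 (f j) (f j.+1)) -> linked S (f m) (f n).
Proof.
elim: n => [|n IH] mn Sf st.
  have m0 : m = 0%N by lia.
  by rewrite m0; apply: linked_refl; apply: Sf; lia.
move: mn; rewrite leq_eqVlt => /orP[/eqP mE|mn].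
  by rewrite mE; apply: linked_refl; apply: Sf; lia.
have L : linked S (f m) (f n).
  by apply: IH => // j jb; [apply: Sf|apply: st]; lia.
apply: linked_trans L _; have [->|A] := st n ltac:(lia).
  by apply: linked_refl; apply: Sf; lia.
by apply: linked_step => //; apply: Sf; lia.
Qed.

Lemma linked_hor S (a b j : int) : a <= b ->
  (forall i, a <= i <= b -> S (i, j)) -> linked S (a, j) (b, j).
Proof.
move=> ab H; have := @linked_seq S (fun n => (a + n%:Z, j)) 0 `|b - a|%N (leq0n _).
rewrite addr0; have -> : a + `|b - a|%N%:Z = b by lia.
apply; first by move=> k kb; apply: H; lia.
by move=> k kb; right; rewrite /adj4 !inE -!pair_eqE /pair_eq /=; lia.
Qed.

Lemma linked_ver S (a b i : int) : a <= b ->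
  (forall j, a <= j <= b -> S (i, j)) -> linked S (i, a) (i, b).
Proof.
move=> ab H; have := @linked_seq S (fun n => (i, a + n%:Z)) 0 `|b - a|%N (leq0n _).
rewrite addr0; have -> : a + `|b - a|%N%:Z = b by lia.
apply; first by move=> k kb; apply: H; lia.
by move=> k kb; right; rewrite /adj4 !inE -!pair_eqE /pair_eq /=; lia.
Qed.

Lemma linked_ring S (M : int) p : 0 <= M -> in_box M p -> (M <= `|p.1|) || (M <= `|p.2|) ->
  (forall q, in_box M q -> (M <= `|q.1|) || (M <= `|q.2|) -> S q) -> linked S p (M, M).
Proof.
case: p => i j M0; rewrite /in_box /= => B O H.
have R k : -M <= k <= M -> linked S (M, k) (M, M).
  by move=> kb; apply: linked_ver => [|l lb]; last apply: H; rewrite /in_box /=; lia.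
have U k : -M <= k <= M -> linked S (k, M) (M, M).
  by move=> kb; apply: linked_hor => [|l lb]; last apply: H; rewrite /in_box /=; lia.
have [->|[->|[->|->]]] : i = M \/ j = M \/ i = -M \/ j = -M by lia.
- by apply: R; lia.
- by apply: U; lia.
- apply: (linked_trans (q := (-M, M))); last by apply: U; lia.
  by apply: linked_ver => [|l lb]; last apply: H; rewrite /in_box /=; lia.
- apply: (linked_trans (q := (M, -M))); last by apply: R; lia.
  by apply: linked_hor => [|l lb]; last apply: H; rewrite /in_box /=; lia.
Qed.
End Linked.

Section Regions.
Context (T : finType) (e : rel T) (L : nat) (v : T -> cell) (w : T -> T -> nat -> cell).
Hypothesis dd : discrete_drawing e L v w.
Hypothesis esym : symmetric e.
Hypothesis eirr : irreflexive e.
Hypothesis edge_at : forall x, exists y, e x y.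

Let o := oriented e.

Lemma oriented_neq x y : o x y -> x != y.
Proof. by move=> /andP[exy _]; apply: contraTneq exy => ->; rewrite eirr. Qed.

Lemma orientedVoriented x y : e x y -> o x y \/ o y x.
Proof.
move=> exy; have N : x != y by apply: contraTneq exy => ->; rewrite eirr.
have eyx : e y x by rewrite esym.
rewrite /o /oriented exy eyx /=; case: (ltngtP (enum_rank x) (enum_rank y)) => h; [by left|by right|].
by move: N; rewrite -(inj_eq enum_rank_inj) -val_eqE /= h eqxx.
Qed.

Definition body x c := exists u u' k j,
  [/\ o u u', (k == 0%N) || (k == 2), third_end u u' k = x, (k * L <= j <= k.+1 * L)%N & w u u' j = c].

(** The scan may stop at [2 * L]: there the last third begins, which lies in the body of [y]. *)
Definition entry x y := find (fun j => `[< body y (w x y j) >]) (iota 0 (2 * L).+1).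

(** The middle third of an oriented edge goes to its tail [x] up to the first cell in the body of
    [y]. The regions of adjacent vertices then touch at the entry. *)
Definition region x c := body x c \/ exists y j, [/\ o x y, (j < entry x y)%N & w x y j = c].

Lemma body_disjoint x x' c : body x c -> body x' c -> x = x'.
Proof.
move=> [u [u' [k [j [h1 h2 <- h4 <-]]]]] [z [z' [l [i [g1 g2 <- g4 E]]]]].
apply/eqP/negPn/negP => N; have := dd_apart dd h1 g1 _ _ h4 g4.
move: h2 g2 N; rewrite /apart E.
by case/orP=> /eqP-> /orP[]/eqP-> /= N /(_ isT isT N).
Qed.

Lemma body_mid x u u' j : o u u' -> (L <= j <= 2 * L)%N -> body x (w u u' j) -> x = u \/ x = u'.
Proof.
move=> h hj [z [z' [l [i [g1 g2 E1 g4 E]]]]].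
have : x \in [:: u; u'].
  apply/negPn/negP => N; have := @dd_apart _ _ _ _ _ dd u u' z z' 1 l j i h g1 isT _ _ g4.
  rewrite mul1n; move: g2 N; rewrite /apart E -E1.
  by case/orP=> /eqP-> /= N /(_ isT hj N).
by rewrite !inE => /orP[]/eqP->; [left|right].
Qed.

Lemma body_src x y j : o x y -> (j <= L)%N -> body x (w x y j).
Proof. by move=> h jL; exists x, y, 0%N, j; rewrite mul0n mul1n. Qed.

Lemma body_tgt x y j : o x y -> (2 * L <= j <= 3 * L)%N -> body y (w x y j).
Proof. by move=> h jL; exists x, y, 2, j. Qed.

Lemma entryP x y : o x y -> [/\ (L < entry x y <= 2 * L)%N, body y (w x y (entry x y)) &
  forall j, (j < entry x y)%N -> ~ body y (w x y j)].
Proof.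
move=> h; have L0 := dd_pos dd.
have H : has (fun j => `[< body y (w x y j) >]) (iota 0 (2 * L).+1).
  apply/hasP; exists (2 * L)%N; first by rewrite mem_iota; lia.
  by apply/asboolP; apply: body_tgt => //; lia.
have lt2 : (entry x y <= 2 * L)%N by move: H; rewrite has_find size_iota.
have B : body y (w x y (entry x y)).
  by have := nth_find 0%N H; rewrite -/(entry x y) nth_iota // add0n => /asboolP.
split=> //.
  rewrite lt2 andbT ltnNge; apply/negP => le.
  by have := oriented_neq h; rewrite (body_disjoint (body_src h le) B) eqxx.
move=> j je; have := before_find 0%N je; rewrite nth_iota ?add0n; last by lia.
by move=> /asboolP.
Qed.

Lemma region_cases x c : region x c -> body x c \/
  exists y j, [/\ o x y, (L <= j <= 2 * L)%N, w x y j = c & ~ body y c].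
Proof.
case=> [|[y [j [h je <-]]]]; first by left.
have [eb _ B] := entryP h; have [jL|jL] := leqP j L; first by left; exact: body_src.
by right; exists y, j; split=> //; [lia|exact: B].
Qed.

(** A middle third meets no other middle third and no body except those of its ends, and the part
    that is kept stops before the body of the head. *)
Lemma region_disjoint x x' c : region x c -> region x' c -> x = x'.
Proof.
move=> /region_cases[B|[y [j [h hj wc nB]]]] /region_cases[B'|[y' [j' [h' hj' wc' nB']]]].
- exact: body_disjoint B B'.
- by rewrite -wc' in B nB' *; case: (body_mid h' hj' B) => // xy; rewrite xy in B.
- by rewrite -wc in B' nB *; case: (body_mid h hj B') => // xy; rewrite xy in B'.
- apply/eqP/negPn/negP => N; have := @dd_apart _ _ _ _ _ dd x y x' y' 1 1 j j' h h' isT isT.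
  rewrite /apart /= xpair_eqE (negPf N) mul1n => /(_ hj hj' isT); apply.
  by rewrite wc.
Qed.

Lemma linked_arc (S : cell -> Prop) x y m n : o x y -> (m <= n)%N ->
  (forall j, (m <= j <= n)%N -> S (w x y j)) -> linked S (w x y m) (w x y n).
Proof.
by move=> h mn H; apply: linked_seq => // j jb; apply: (dd_step dd).
Qed.

Lemma region_linked x c : region x c -> linked (region x) (v x) c.
Proof.
case=> [[u [u' [k [j [h /orP[]/eqP-> <- jb <-]]]]]|[y [j [h je <-]]]]; rewrite /third_end /=.
- rewrite -(dd_src dd h); apply: linked_arc => // i ib; left; apply: body_src => //; lia.
- rewrite -(dd_tgt dd h); apply: linked_sym; apply: linked_arc => [||i ib] //; first lia.
  by left; apply: body_tgt => //; lia.
- rewrite -(dd_src dd h); apply: linked_arc => // i ib; right.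
  by exists y, i; split=> //; lia.
Qed.

Lemma region_v x : region x (v x).
Proof.
have [y /orientedVoriented[h|h]] := edge_at x; left.
  by rewrite -(dd_src dd h); exact: body_src.
by rewrite -(dd_tgt dd h); apply: body_tgt => //; lia.
Qed.

Lemma region_touch x y : o x y -> exists p q, [/\ adj4 p q, region x p & region y q].
Proof.
move=> h; have [eb B nB] := entryP h.
have E : (entry x y).-1.+1 = entry x y by rewrite prednK //; lia.
exists (w x y (entry x y).-1), (w x y (entry x y)); split.
- have := dd_step dd (entry x y).-1 h; rewrite E => -[E'|//].
  by have := nB (entry x y).-1 ltac:(lia); rewrite -E'.
- by right; exists y, (entry x y).-1; split=> //; lia.
- by left.
Qed.

Lemma region_bounded : exists2 M : int, 0 < M & forall x c, region x c -> `|c.1| < M /\ `|c.2| < M.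
Proof.
have [M HM] : exists M : nat, forall x y j, (j <= 3 * L)%N ->
    (`|(w x y j).1| <= M)%N /\ (`|(w x y j).2| <= M)%N.
  exists (\max_(i : T * T * 'I_(3 * L).+1) (`|(w i.1.1 i.1.2 i.2).1| + `|(w i.1.1 i.1.2 i.2).2|))%N.
  move=> x y j jL; have := leq_bigmax (F := fun i : T * T * 'I_(3 * L).+1 =>
    (`|(w i.1.1 i.1.2 i.2).1| + `|(w i.1.1 i.1.2 i.2).2|)%N) (x, y, Ordinal (jL : (j < (3 * L).+1)%N)).
  by move=> /=; lia.
exists M.+1%:Z => // x c H.
have [u [u' [j [jL <-]]]] : exists u u' j, (j <= 3 * L)%N /\ w u u' j = c.
  case: H => [[u [u' [k [j [_ kk _ jb <-]]]]]|[y [j [h je <-]]]].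
    by exists u, u', j; split=> //; case/orP: kk jb => /eqP->; lia.
  by exists x, y, j; split=> //; have [+ _ _] := entryP h; lia.
by have := HM u u' j jL; lia.
Qed.
End Regions.

Section Fill.
Context (T : finType) (reg : T -> cell -> Prop) (v : T -> cell) (M : int).
Hypothesis reg_disj : forall x x' c, reg x c -> reg x' c -> x = x'.
Hypothesis reg_link : forall x c, reg x c -> linked (reg x) (v x) c.
Hypothesis reg_v : forall x, reg x (v x).
Hypothesis M0 : 0 < M.
Hypothesis reg_bound : forall x c, reg x c -> `|c.1| < M /\ `|c.2| < M.
Variables (x0 : T) (c0 : cell).
Hypothesis reg_c0 : reg x0 c0.
Hypothesis c0_max : forall x c, reg x c -> c.1 <= c0.1.

Definition outside (c : cell) := (M <= `|c.1|) || (M <= `|c.2|).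
Definition assigned (c : cell) := outside c || `[< exists x, reg x c >].
Definition label (c : cell) : T := if [pick x | `[< reg x c >]] is Some x then x else x0.
Definition right (c : cell) (k : nat) : cell := (c.1 + k%:Z, c.2).
Definition gap (c : cell) : nat := find (fun k => assigned (right c k)) (iota 0 (absz (M + M)%R).+1).
(* Unassigned cells take the label of the nearest assigned cell to their right. *)
Definition fill (c : cell) : T := label (right c (gap c)).

Lemma right0 c : right c 0 = c.
Proof. by rewrite /right addr0 -surjective_pairing. Qed.

Lemma label_reg x c : reg x c -> label c = x.
Proof.
rewrite /label => H; case: pickP => [y /asboolP Hy|/(_ x)]; first exact: reg_disj Hy H.
by move=> /asboolP.
Qed.

Lemma label_out c : outside c -> label c = x0.
Proof.
rewrite /label => H; case: pickP => [y /asboolP Hy|//].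
by have := reg_bound Hy; move: H; rewrite /outside; lia.
Qed.

Lemma gapP c : in_box M c -> assigned (right c (gap c)) /\
  forall k, (k < gap c)%N -> ~~ assigned (right c k).
Proof.
move=> B.
have H : has (fun k => assigned (right c k)) (iota 0 (absz (M + M)%R).+1).
  apply/hasP; exists (absz (M - c.1)%R); first by move: B; rewrite mem_iota /in_box; lia.
  by rewrite /assigned /outside /right /=; apply/orP; left; move: B; rewrite /in_box; lia.
have lt : (gap c < (absz (M + M)%R).+1)%N by move: H; rewrite has_find size_iota.
split; first by have := nth_find 0%N H; rewrite nth_iota.
move=> k kg; have := before_find 0%N kg; rewrite nth_iota ?add0n; last by lia.
by move=> ->.
Qed.

Lemma gap0 c : assigned c -> gap c = 0%N.
Proof. by move=> A; rewrite /gap /= /right addr0 -surjective_pairing A. Qed.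

Lemma gap_right c k : in_box M c -> (k <= gap c)%N -> in_box M (right c k).
Proof.
move=> B kg; have [_ H] := gapP B; move: B; rewrite /in_box /right /= => /andP[B1 B2].
rewrite B2 andbT; apply/negPn/negP => N.
have lt : (absz (M - c.1)%R < gap c)%N by lia.
by have := H _ lt; rewrite /assigned /outside /right /=; lia.
Qed.

Lemma gapS c k : in_box M c -> (k <= gap c)%N -> gap (right c k) = (gap c - k)%N.
Proof.
move=> B kg; have [A N] := gapP B; have [A' N'] := gapP (gap_right B kg).
have rr i j : right (right c i) j = right c (i + j) by rewrite /right /= -addrA PoszD.
case: (ltngtP (gap (right c k)) (gap c - k)) => // h.
  have := N (k + gap (right c k))%N ltac:(lia).
  by rewrite -rr A'.
have := N' _ h; rewrite rr subnKC // A //.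
Qed.

Lemma fill_right c k : in_box M c -> (k <= gap c)%N -> fill (right c k) = fill c.
Proof.
move=> B kg; rewrite /fill gapS //; congr label.
by rewrite /right /= -addrA -PoszD subnKC.
Qed.

Lemma fill_assigned c : assigned c -> fill c = label c.
Proof. by move=> A; rewrite /fill gap0 // /right addr0 -surjective_pairing. Qed.

Lemma fill_reg x c : reg x c -> fill c = x.
Proof.
move=> H; rewrite fill_assigned ?(label_reg H) // /assigned.
by apply/orP; right; apply/asboolP; exists x.
Qed.

Lemma fill_out c : outside c -> fill c = x0.
Proof. by move=> H; rewrite fill_assigned ?label_out // /assigned H. Qed.

Let S x c := in_box M c && (fill c == x).

Lemma linked_base c : in_box M c -> linked (S (fill c)) c (right c (gap c)).
Proof.
move=> B; have := @linked_seq (S (fill c)) (right c) 0 (gap c) (leq0n _).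
rewrite right0; apply.
  by move=> k kg; rewrite /S gap_right ?fill_right ?eqxx //; lia.
by move=> k _; right; rewrite /adj4 !inE -!pair_eqE /pair_eq /=; lia.
Qed.

Lemma reg_S x c : reg x c -> S x c.
Proof.
move=> H; rewrite /S (fill_reg H) eqxx andbT /in_box.
by have := reg_bound H; lia.
Qed.

Lemma linked_reg x c : reg x c -> linked (S x) (v x) c.
Proof. by move=> /reg_link; apply: linked_mono => r; exact: reg_S. Qed.

Lemma out_S c : in_box M c -> outside c -> S x0 c.
Proof. by move=> B O; rewrite /S B fill_out ?eqxx. Qed.

(** [c0] is a rightmost cell of all regions, so the ray to its right meets only unassigned cells
    before the outside. They all get the label [x0], which ties the outside to the region of
    [x0]. *)
Lemma linked_corner : linked (S x0) (v x0) (M, M).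
Proof.
apply: linked_trans (linked_reg reg_c0) _.
pose c1 := right c0 1.
have B1 : in_box M c1 by have := reg_bound reg_c0; rewrite /in_box /c1 /right /=; lia.
have [A _] := gapP B1; have Bb := gap_right B1 (leqnn _).
have Ob : outside (right c1 (gap c1)).
  case/orP: A => // /asboolP [x /c0_max]; rewrite /c1 /right /=; lia.
have E1 : fill c1 = x0 by rewrite /fill label_out.
have L1 := linked_base B1; rewrite E1 in L1.
have S1 : S x0 c1 by rewrite /S B1 E1 eqxx.
apply: (linked_trans (q := c1)).
  apply: linked_step => //; first exact: reg_S.
  by rewrite /adj4 !inE -!pair_eqE /pair_eq /=; lia.
apply: linked_trans L1 _; apply: linked_ring => //; first exact: ltW.
exact: out_S.
Qed.

Lemma linked_home c : in_box M c -> linked (S (fill c)) (v (fill c)) c.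
Proof.
move=> B; apply: linked_trans (linked_sym (linked_base B)).
have [/orP[O|/asboolP[x H]] _] := gapP B; have Bb := gap_right B (leqnn _).
  have E : fill c = x0 by rewrite /fill label_out.
  rewrite E; apply: linked_trans linked_corner _; apply: linked_sym.
  by apply: linked_ring => //; [exact: ltW|exact: out_S].
have E : fill c = x by rewrite /fill (label_reg H).
by rewrite E; exact: linked_reg.
Qed.

Lemma fill_labelling : labelling M x0 fill.
Proof.
split; first by move=> p /fill_out.
move=> p q Bp Bq E; have Lq := linked_home Bq; rewrite -E in Lq.
have [s [s1 s2 s3]] := linked_trans (linked_sym (linked_home Bp)) Lq.
exists s; split=> //; apply/allP => r rs; apply: s3.
by rewrite inE rs orbT.
Qed.

End Fill.

Theorem drawing_labelling (T : finType) (e : rel T) L v w :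
  discrete_drawing e L v w -> symmetric e -> irreflexive e -> (exists x : T, True) ->
  (forall x, exists y, e x y) ->
  exists M x0 lam, [/\ @labelling T M x0 lam,
    forall x, exists2 p, in_box M p & lam p = x & forall x y, e x y -> qedge lam x y].
Proof.
move=> dd es ei [z _] ea.
have [M M0 HM] := region_bounded dd ei.
pose reg := region e L w.
have rv := region_v dd es ei ea.
(* Adding [M] makes the abscissas natural numbers, so that a rightmost cell is given by a bounded
   maximum. *)
have ex : exists n, `[< exists x c, reg x c /\ c.1 + M = n%:Z >].
  have [h _] := HM _ _ (rv z); exists (absz ((v z).1 + M)%R); apply/asboolP.
  by exists z, (v z); split; [exact: rv|lia].
have bd n : `[< exists x c, reg x c /\ c.1 + M = n%:Z >] -> (n <= absz (M + M)%R)%N.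
  by move=> /asboolP [x [c [/HM [h _] h2]]]; lia.
case: (ex_maxnP ex bd) => n /asboolP [x0 [c0 [r0 n0]]] nmax.
have c0_max x c : reg x c -> c.1 <= c0.1.
  move=> rc; have [h _] := HM _ _ rc.
  have := nmax (absz (c.1 + M)%R); have H : `[< exists x c', reg x c' /\ c'.1 + M = (absz (c.1 + M)%R)%:Z >].
    by apply/asboolP; exists x, c; split=> //; lia.
  by move=> /(_ H); lia.
have disj := region_disjoint dd ei.
exists M, x0, (fill reg M x0); split.
- by apply: (fill_labelling disj (v := v) _ M0 HM r0 c0_max) => x c; exact: region_linked.
- move=> x; exists (v x); first by have := HM _ _ (rv x); rewrite /in_box; lia.
  exact: (fill_reg M disj).
- move=> x y exy; split; first by move=> E; rewrite E ei in exy.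
  have [h|h] := orientedVoriented es ei exy.
    have [p [q [A rp rq]]] := region_touch dd ei h.
    exists p, q; split; [|by apply: (fill_reg M disj)|by apply: (fill_reg M disj)].
    exact: adj4_adj6.
  have [p [q [A rp rq]]] := region_touch dd ei h.
  exists q, p; split; [|by apply: (fill_reg M disj)|by apply: (fill_reg M disj)].
  by apply: adj4_adj6; rewrite adj4_sym.
Qed.

End Regions.

(** * Sides of closed walks in the triangular lattice *)

Module LatticeSides.
Import all_algebra zify ring.
Import Order.TTheory GRing.Theory Num.Theory.
Local Open Scope ring_scope.
Import Lattice.

Section Steps.
Context (V : eqType).

Definition steps (c : V) (s : seq V) : seq (V * V) := zip (c :: s) s.

Definition uses (c : V) (s : seq V) (p q : V) : nat :=
  count (fun st => (st == (p, q)) || (st == (q, p))) (steps c s).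

Lemma uses_sym c s p q : uses c s p q = uses c s q p.
Proof. by apply: eq_count => st; rewrite orbC. Qed.

Lemma steps_cons c d s : steps c (d :: s) = (c, d) :: steps d s.
Proof. by []. Qed.

Lemma steps_cat c s t : steps c (s ++ t) = steps c s ++ steps (last c s) t.
Proof. by elim: s c => //= d s IH c; rewrite !steps_cons IH. Qed.

Lemma uses_cat c s t p q : uses c (s ++ t) p q = (uses c s p q + uses (last c s) t p q)%N.
Proof. by rewrite /uses steps_cat count_cat. Qed.

Lemma steps_path (r : rel V) c s st : path r c s -> st \in steps c s -> r st.1 st.2.
Proof.
elim: s c => //= d s IH c /andP[rd ps]; rewrite steps_cons inE => /orP[/eqP->|] //.
exact: IH.
Qed.

Lemma steps_mem c s st : st \in steps c s -> (st.1 \in c :: s) && (st.2 \in c :: s).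
Proof.
elim: s c => //= d s IH c; rewrite steps_cons inE => /orP[/eqP->|/IH/andP[h1 h2]].
  by rewrite /= !inE !eqxx orbT.
by rewrite !(in_cons c) h1 h2 !orbT.
Qed.

Lemma crossing_parity (R : pred V) c s :
  odd (count (fun st => R st.1 (+) R st.2) (steps c s)) = R c (+) R (last c s).
Proof.
elim: s c => [|d s IH] c; first by rewrite addbb.
rewrite steps_cons /= oddD IH.
by case: (R c); case: (R d); case: (R (last d s)).
Qed.

Lemma odd_count_addb (T : Type) (a b : pred T) s :
  odd (count a s) (+) odd (count b s) = odd (count (fun x => a x (+) b x) s).
Proof.
elim: s => //= x s IH; rewrite !oddD -IH.
by case: (a x); case: (b x); case: (odd (count a s)); case: (odd (count b s)).
Qed.

Lemma odd_count_eq_in (T : eqType) (a b : pred T) s :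
  {in s, a =1 b} -> odd (count a s) = odd (count b s).
Proof. by move=> /eq_in_count ->. Qed.

End Steps.

(** Rotation by sixty degrees in the coordinates of the triangular lattice: it permutes the six
    directions cyclically. *)
Definition rot (d : cell) : cell := (d.1 - d.2, d.1).
(* The apex of the triangle on the left of the dart [p q]. *)
Definition nu (p q : cell) : cell := p + rot (q - p).

(* A step crosses the leftward horizontal ray issued from the triangle
   (i, j), (i + 1, j), (i + 1, j + 1) ([low]) or (i, j), (i + 1, j + 1), (i, j + 1)
   ([high]); the parity of these crossings is the side of the triangle. *)
Definition low (i j : int) (st : cell * cell) : bool :=
  [&& st.1.2 == j, st.2.2 == j + 1 & st.1.1 <= i] ||
  [&& st.2.2 == j, st.1.2 == j + 1 & st.2.1 <= i].

Definition high (i j : int) (st : cell * cell) : bool :=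
  [&& st.1.2 == j, st.2.2 == j + 1 & st.2.1 <= i] ||
  [&& st.2.2 == j, st.1.2 == j + 1 & st.1.1 <= i].

Lemma adj6P p q : adj6 p q -> [\/ q = p + (1, 0), q = p + (1, 1), q = p + (0, 1) |
  [\/ p = q + (1, 0), p = q + (1, 1) | p = q + (0, 1)]].
Proof.
rewrite /adj6 => A; have -> : q = p + (q - p) by rewrite addrC subrK.
move: (q - p) A => d; rewrite !inE.
case/or4P=> [/eqP->|/eqP->|/eqP->|/or3P[]/eqP->].
- by constructor 1.
- by constructor 2.
- by constructor 3.
- by constructor 4; constructor 1; rewrite -addrA (_ : (-1, 0) + (1, 0) = 0) ?addr0.
- by constructor 4; constructor 2; rewrite -addrA (_ : (-1, -1) + (1, 1) = 0) ?addr0.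
- by constructor 4; constructor 3; rewrite -addrA (_ : (0, -1) + (0, 1) = 0) ?addr0.
Qed.

Lemma stepE (p q r t : cell) :
  ((p, q) == (r, t)) = [&& p.1 == r.1, p.2 == r.2, q.1 == t.1 & q.2 == t.2].
Proof. by rewrite xpair_eqE -!pair_eqE /pair_eq /= -!andbA. Qed.

Lemma low_high_diag i j p q : adj6 p q -> low i j (p, q) (+) high i j (p, q) =
  ((p, q) == ((i, j), (i + 1, j + 1))) || ((p, q) == ((i + 1, j + 1), (i, j))).
Proof.
rewrite /adj6 /low /high !stepE /=.
case: p q => a b [a' b']; rewrite !inE -!pair_eqE /pair_eq /=.
by case: addbP => h1; move: h1; lia.
Qed.

Lemma low_high_ver i j p q : adj6 p q -> low (i - 1) j (p, q) (+) high i j (p, q) =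
  ((p, q) == ((i, j), (i, j + 1))) || ((p, q) == ((i, j + 1), (i, j))).
Proof.
rewrite /adj6 /low /high !stepE /=.
case: p q => a b [a' b']; rewrite !inE -!pair_eqE /pair_eq /=.
by case: addbP => h1; move: h1; lia.
Qed.

Definition halfrow (i j : int) (p : cell) : bool := (p.2 == j) && (p.1 <= i).

(** The two leftward rays run just above and just below the half-row of cells that ends at (i, j). A
    step entering or leaving the half-row crosses exactly one of them, unless it uses the edge at
    the right end. On a closed walk the half-row terms cancel. *)
Lemma low_high_hor i j p q : adj6 p q -> low i j (p, q) (+) high i (j - 1) (p, q) =
  (halfrow i j p (+) halfrow i j q) (+)
  (((p, q) == ((i, j), (i + 1, j))) || ((p, q) == ((i + 1, j), (i, j)))).
Proof.
have D (A B : bool) : A = B -> A (+) B = false by move=> ->; rewrite addbb.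
case: p q => a b q /adj6P H; rewrite /low /high /halfrow !stepE /=.
have E : [\/ [/\ q.1 = a + 1 & q.2 = b], [/\ q.1 = a + 1 & q.2 = b + 1], [/\ q.1 = a & q.2 = b + 1] |
   [\/ [/\ q.1 = a - 1 & q.2 = b], [/\ q.1 = a - 1 & q.2 = b - 1] | [/\ q.1 = a & q.2 = b - 1]]].
  case: H => [->|->|->|[]] /=; [by constructor 1; rewrite addr0|by constructor 2|by constructor 3; rewrite addr0|..];
  case: q => x y [-> ->] /=; constructor 4; [constructor 1|constructor 2|constructor 3];
  by rewrite ?addr0 ?addrK.
case: q {H} E => x y /=.
case=> [|||[]] [-> ->]; do !case: addbP; lia.
Qed.

Section Sides.
Variables (c : cell) (s : seq cell).
Hypothesis ps : path adj6 c s.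
Hypothesis closed : last c s = c.

Let SA i j := odd (count (low i j) (steps c s)).
Let SB i j := odd (count (high i j) (steps c s)).

Lemma side_diag i j : SA i j (+) SB i j = odd (uses c s (i, j) (i + 1, j + 1)).
Proof.
rewrite /SA /SB odd_count_addb; apply: odd_count_eq_in => -[p q] /(steps_path ps).
exact: low_high_diag.
Qed.

Lemma side_ver i j : SA (i - 1) j (+) SB i j = odd (uses c s (i, j) (i, j + 1)).
Proof.
rewrite /SA /SB odd_count_addb; apply: odd_count_eq_in => -[p q] /(steps_path ps).
exact: low_high_ver.
Qed.

Lemma side_hor i j : SA i j (+) SB i (j - 1) = odd (uses c s (i, j) (i + 1, j)).
Proof.
have := crossing_parity (halfrow i j) c s; rewrite closed addbb => H.
rewrite -[RHS]addFb -H /SA /SB /uses !odd_count_addb; apply: odd_count_eq_in => -[p q] /(steps_path ps).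
exact: low_high_hor.
Qed.

(** The side of the triangle on the left of the dart from [p] in direction [d]. *)
Definition side_dir (p d : cell) : bool :=
  if d == (1, 0) then SA p.1 p.2 else
  if d == (1, 1) then SB p.1 p.2 else
  if d == (0, 1) then SA (p.1 - 1) p.2 else
  if d == (-1, 0) then SB (p.1 - 1) (p.2 - 1) else
  if d == (-1, -1) then SA (p.1 - 1) (p.2 - 1) else SB p.1 (p.2 - 1).

Definition dirs6 : seq cell := [:: (1, 0); (1, 1); (0, 1); (-1, 0); (-1, -1); (0, -1)].

Lemma side_dir_rot p d : d \in dirs6 -> side_dir p d = side_dir (p + d) (rot d - d).
Proof.
case: p => i j; rewrite /side_dir !inE.
by case/or4P=> [/eqP->|/eqP->|/eqP->|/or3P[]/eqP->]; rewrite /rot /= ?addr0 ?addrK.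
Qed.

Lemma side_dir_flip p d : d \in dirs6 ->
  side_dir p d (+) side_dir (p + d) (- d) = odd (uses c s p (p + d)).
Proof.
have W (x u : cell) : u \in take 3 dirs6 ->
    side_dir x u (+) side_dir (x + u) (- u) = odd (uses c s x (x + u)).
  case: x => i j; rewrite /side_dir !inE => /or3P[]/eqP->; rewrite /= ?addr0 ?addrK.
  - by rewrite side_hor -[(i, j) + (1, 0)]/(i + 1, j + 0) addr0.
  - by rewrite addbC side_diag.
  - by rewrite side_ver -[(i, j) + (0, 1)]/(i + 0, j + 1) addr0.
rewrite !inE => /or4P[/eqP->|/eqP->|/eqP->|H]; [exact: W|exact: W|exact: W|].
have {}H : - d \in take 3 dirs6 by case/or3P: H => /eqP->.
have := W (p + d) _ H; rewrite addrK opprK => K.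
by rewrite addbC K uses_sym.
Qed.

(** A parity form of the Jordan curve theorem: sides belong to triangles, and two adjacent triangles
    differ when the walk uses their common edge an odd number of times. *)
Lemma sides : exists S : cell -> cell -> bool, forall p q, adj6 p q ->
  S p q = S q (nu p q) /\ S p q (+) S q p = odd (uses c s p q).
Proof.
exists (fun p q => side_dir p (q - p)) => p q A.
have E : nu p q - q = rot (q - p) - (q - p) by rewrite /nu opprB addrA (addrC (rot _)).
have Eq : p + (q - p) = q by rewrite addrC subrK.
split; first by rewrite E (side_dir_rot p A) Eq.
by have := side_dir_flip p A; rewrite Eq opprB.
Qed.

End Sides.

Lemma rot_dirs6 d : d \in dirs6 -> rot d \in dirs6 /\ rot d - d \in dirs6.
Proof. by rewrite !inE => /or4P[/eqP->|/eqP->|/eqP->|/or3P[]/eqP->]. Qed.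

Lemma rot_rot d : rot (rot d - d) = - d.
Proof. by case: d => a b; rewrite /rot /=; congr pair => /=; ring. Qed.

Lemma adj6E p q : adj6 p q = (q - p \in dirs6).
Proof. by []. Qed.

Lemma nuB p q : nu p q - q = rot (q - p) - (q - p).
Proof. by rewrite /nu opprB addrA (addrC (rot _)). Qed.

Lemma adj6_nu p q : adj6 p q -> adj6 p (nu p q) /\ adj6 q (nu p q).
Proof.
rewrite !adj6E nuB => /rot_dirs6 [h1 h2]; split=> //.
by rewrite /nu addrAC subrr add0r.
Qed.

Lemma nu_nu p q : nu q (nu p q) = p.
Proof. by rewrite {1}/nu nuB rot_rot opprB addrC subrK. Qed.

Lemma rot_orbit d d' : d \in dirs6 -> d' \in dirs6 -> exists k, d' = iter k rot d.
Proof.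
have R a : a \in dirs6 -> exists2 k, (k < 6)%N & a = iter k rot (1, 0).
  rewrite !inE => /or4P[/eqP->|/eqP->|/eqP->|/or3P[]/eqP->];
  by [exists 0%N|exists 1%N|exists 2|exists 3|exists 4|exists 5].
move=> /R [k k6 ->] /R [l l6 ->]; exists (l + (6 - k))%N.
by rewrite -iterD -addnA subnK 1?ltnW // iterD.
Qed.

(* Away from a closed walk [c :: s], the side function is locally constant. *)
Section Constant.
Variables (c : cell) (s : seq cell) (S : cell -> cell -> bool).
Hypothesis SP : forall p q, adj6 p q ->
  S p q = S q (nu p q) /\ S p q (+) S q p = odd (uses c s p q).

Lemma uses_notin p q : p \notin c :: s -> uses c s p q = 0%N.
Proof.
move=> pC; apply/eqP; rewrite -leqn0 leqNgt -has_count; apply/hasPn => st /steps_mem /andP[h1 h2].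
by apply/norP; split; apply: contra pC => /eqP E; rewrite E in h1 h2.
Qed.

Lemma side_cycle p q : adj6 p q -> S (nu p q) p = S p q.
Proof.
move=> A; have [_ A2] := adj6_nu A.
by have [-> _] := SP A; have [-> _] := SP A2; rewrite nu_nu.
Qed.

Lemma side_turn w q : w \notin c :: s -> adj6 w q -> S w (nu w q) = S w q.
Proof.
move=> wC A; have [A1 _] := adj6_nu A.
have [_] := SP A1; rewrite uses_notin // side_cycle //.
by case: (S w _); case: (S w q).
Qed.

Lemma side_const w q q' : w \notin c :: s -> adj6 w q -> adj6 w q' -> S w q = S w q'.
Proof.
move=> wC A A'; have [k E] := rot_orbit A A'.
have -> : q' = w + iter k rot (q - w) by rewrite -E addrC subrK.
have : adj6 w (w + iter k rot (q - w)) /\ S w q = S w (w + iter k rot (q - w)); last by case.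
elim: k {E} => [|k [A2 ->]] /=; first by rewrite addrC subrK.
have := side_turn wC A2; rewrite /nu [_ + _ - w]addrAC subrr add0r => <-; split=> //.
by have [] := adj6_nu A2; rewrite /nu [_ + _ - w]addrAC subrr add0r.
Qed.

Lemma side_adj w w' q q' : w \notin c :: s -> w' \notin c :: s -> adj6 w w' ->
  adj6 w q -> adj6 w' q' -> S w q = S w' q'.
Proof.
move=> wC wC' A A1 A2; have A' : adj6 w' w by rewrite adj6C.
rewrite (side_const wC A1 A) -(side_const wC' A' A2).
by have [_] := SP A; rewrite uses_notin //; case: (S w _); case: (S w' _).
Qed.

Lemma side_path w t q q' : path adj6 w t -> all [predC c :: s] (w :: t) ->
  adj6 w q -> adj6 (last w t) q' -> S w q = S (last w t) q'.
Proof.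
elim: t w q => [|w' t IH] w q /=; first by move=> _ /andP[wC _]; exact: side_const.
move=> /andP[A pt] /andP[wC /= al] A1 A2.
have A' : adj6 w' w by rewrite adj6C.
rewrite -(IH w' w) //; apply: side_adj => //.
by case/andP: al.
Qed.
End Constant.

(** An orbit inside a finite list repeats, and injectivity carries the repetition back to the
    starting point. *)
Lemma iter_return (A : eqType) (f : A -> A) (D : seq A) (d : A) :
  (forall n, iter n f d \in D) ->
  (forall m n, f (iter m f d) = f (iter n f d) -> iter m f d = iter n f d) ->
  exists2 n, (0 < n)%N & iter n f d = d.
Proof.
move=> inD inj.
have : ~~ uniq (traject f d (size D).+1).
  apply/negP => U; have : ((size D).+1 <= size D)%N.
    rewrite -[X in (X <= _)%N](size_traject f d); apply: uniq_leq_size => //.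
    by move=> a /trajectP[i _ ->].
  by rewrite ltnn.
rewrite looping_uniq negbK => /loopingP H.
have /trajectP [i iD E] := H (size D).
exists (size D - i)%N; first by rewrite subn_gt0.
have : forall j, (j <= i)%N -> iter (size D - j) f d = iter (i - j) f d.
  elim=> [|j IH] ji; first by rewrite !subn0.
  have := IH (ltnW ji); rewrite -(subnSK ji) -(subnSK (ltn_trans ji iD)) /=.
  exact: inj.
by move=> /(_ i (leqnn i)); rewrite subnn.
Qed.

End LatticeSides.

(** * Faces, rotations and sides of the quotient graph *)

Module QuotientMap.
Import all_algebra boolp zify.
Import Order.TTheory GRing.Theory Num.Theory.
Local Open Scope ring_scope.
Import Lattice LatticeSides.

Section Quotient.
Context (T : finType) (M : int) (x0 : T) (lam : cell -> T).
Hypothesis lamP : labelling M x0 lam.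

Lemma fiber_walk p q : in_box M p -> in_box M q -> lam p = lam q ->
  exists s, [/\ path adj6 p s, last p s = q & {in p :: s, forall r, lam r = lam p}].
Proof.
move=> Bp Bq E; have [s [h1 h2 h3]] := lab_conn lamP Bp Bq E.
exists s; split=> //.
  by apply: sub_path h1; exact: adj4_adj6.
by move=> r; rewrite inE => /orP[/eqP->//|/(allP h3)/andP[_ /eqP]].
Qed.

Definition boxcells : seq cell :=
  [seq (i%:Z - M, j%:Z - M) | i <- iota 0 (absz (M + M)%R).+1, j <- iota 0 (absz (M + M)%R).+1].

Lemma mem_boxcells p : in_box M p -> p \in boxcells.
Proof.
case: p => a b; rewrite /in_box /= => B; apply/allpairsP.
exists (absz (a + M)%R, absz (b + M)%R).
by split; [rewrite mem_iota /=; lia|rewrite mem_iota /=; lia|congr pair => /=; lia].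
Qed.

Definition dart (x y : T) (d : cell * cell) := [&& adj6 d.1 d.2, lam d.1 == x & lam d.2 == y].

Definition rev_dart (d : cell * cell) := (d.2, d.1).

Lemma dart_rev x y d : dart x y d -> dart y x (rev_dart d).
Proof. by case/and3P=> h1 h2 h3; rewrite /dart /= adj6C h1 h2 h3. Qed.

Lemma dart_box x y d : x != y -> dart x y d -> in_box M d.1 /\ in_box M d.2.
Proof.
move=> N /and3P[A /eqP e1 /eqP e2].
split; first by apply: (edge_in_box lamP A); rewrite e1 e2; exact/eqP.
by rewrite adj6C in A; apply: (edge_in_box lamP A); rewrite e1 e2; apply/eqP; rewrite eq_sym.
Qed.

Definition apex (d : cell * cell) := nu d.1 d.2.

(* The next dart between the fibers of [x] and [y], through the left triangle. *)
Definition arc (x : T) (d : cell * cell) : cell * cell :=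
  if lam (apex d) == x then (apex d, d.2) else (d.1, apex d).

Definition inner (x y : T) (d : cell * cell) := lam (apex d) \in [:: x; y].

Lemma arc_dart x y d : dart x y d -> inner x y d -> dart x y (arc x d).
Proof.
case/and3P=> A e1 e2; have [A1 A2] := adj6_nu A.
rewrite /inner /arc /dart /apex !inE; case: ifP => /= h.
  by move=> _; rewrite adj6C A2 h e2.
by rewrite /= => h2; rewrite A1 e1 h2.
Qed.

Lemma apex_rev_arc x y d : x != y -> dart x y d -> inner x y d ->
  apex (rev_dart (arc x d)) = if lam (apex d) == x then d.1 else d.2.
Proof.
move=> N /and3P[A e1 e2]; rewrite /inner /arc /apex !inE; case: ifP => /= h _.
  by rewrite nu_nu.
by have := nu_nu d.2 (nu d.1 d.2); rewrite (nu_nu d.1 d.2).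
Qed.

Definition unarc (x : T) (d : cell * cell) :=
  let r := apex (rev_dart d) in if lam r == x then (r, d.2) else (d.1, r).

Lemma arcK x y d : x != y -> dart x y d -> inner x y d -> unarc x (arc x d) = d.
Proof.
move=> N D I; rewrite /unarc (apex_rev_arc N D I).
case/and3P: D => A /eqP e1 /eqP e2; rewrite /arc.
case: (lam (apex d) == x) => /=; first by rewrite e1 eqxx -surjective_pairing.
by rewrite e2 eq_sym (negPf N) -surjective_pairing.
Qed.

Lemma inner_rev_arc x y d : x != y -> dart x y d -> inner x y d ->
  inner x y (rev_dart (arc x d)).
Proof.
move=> N D I; rewrite /inner (apex_rev_arc N D I); case/and3P: D => _ /eqP e1 /eqP e2.
by case: ifP => _; rewrite ?e1 ?e2 !inE eqxx ?orbT.
Qed.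

Section Walk.
Variables (c : cell) (s : seq cell) (S : cell -> cell -> bool).
Hypothesis SP : forall p q, adj6 p q ->
  S p q = S q (nu p q) /\ S p q (+) S q p = odd (uses c s p q).

(** The old dart and the reverse of the new one have the same left triangle, so only the lattice
    edge of the new dart is crossed. *)
Lemma side_arc x y d : dart x y d -> inner x y d ->
  S (arc x d).1 (arc x d).2 = S d.1 d.2 (+) odd (uses c s (arc x d).1 (arc x d).2).
Proof.
move=> D I; have D' := arc_dart D I; case/and3P: (D) => A _ _; case/and3P: D' => A' _ _.
have [A1 A2] := adj6_nu A; have [_ <-] := SP A'.
rewrite addbC -addbA; suff -> : S (arc x d).2 (arc x d).1 = S d.1 d.2 by rewrite addbb addbF.
have [E1 _] := SP A; have [E2 _] := SP A2.
rewrite /arc /apex; case: ifP => _ /=; first by rewrite E1.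
by rewrite E1 E2 nu_nu.
Qed.

(* Following an arc that never crosses the walk. *)
Lemma side_arc_run x y d : x != y -> dart x y d -> ~~ inner x y (rev_dart d) ->
  exists d', [/\ dart x y d', ~~ inner x y d' &
    (forall f, dart x y f -> inner x y (rev_dart f) -> ~~ odd (uses c s f.1 f.2)) ->
    S d'.1 d'.2 = S d.1 d.2].
Proof.
move=> N D O.
(* An endless run would return to [d]; but every later dart has an inner reverse, and [d] has
   not. *)
have [n Hn] : exists n, ~~ inner x y (iter n (arc x) d).
  apply: contrapT => H.
  have I n : inner x y (iter n (arc x) d) by apply/negPn/negP => h; apply: H; exists n.
  have Dn n : dart x y (iter n (arc x) d).
    by elim: n => //= n IH; exact: arc_dart.
  have [||n n0 E] := @iter_return _ (arc x) [seq (p, q) | p <- boxcells, q <- boxcells] d.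
  - move=> n; have [b1 b2] := dart_box N (Dn n).
    by apply/allpairsP; exists (iter n (arc x) d); rewrite !mem_boxcells // -surjective_pairing.
  - by move=> m n /(congr1 (unarc x)); rewrite !(arcK N).
  - case: n n0 E => // n _ E; have := inner_rev_arc N (Dn n) (I n).
    by rewrite -[arc x _]/(iter n.+1 (arc x) d) E (negPf O).
have ex : exists n, ~~ inner x y (iter n (arc x) d) by exists n.
case: (ex_minnP ex) => {Hn}m Hm mmin.
have Im k : (k < m)%N -> inner x y (iter k (arc x) d).
  by move=> km; apply/negPn/negP => /mmin; rewrite leqNgt km.
have Dm k : (k <= m)%N -> dart x y (iter k (arc x) d).
  by elim: k => //= k IH km; apply: arc_dart; [apply: IH; exact: ltnW|exact: Im].
exists (iter m (arc x) d); split=> //; first exact: Dm.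
move=> H; have : forall k, (k <= m)%N -> S (iter k (arc x) d).1 (iter k (arc x) d).2 = S d.1 d.2.
  elim=> //= k IH km; rewrite (side_arc (Dm _ (ltnW km)) (Im _ km)) IH ?(ltnW km) //.
  rewrite (negPf (H _ _ _)) ?addbF //; first exact: (Dm k.+1).
  by apply: inner_rev_arc => //; [exact: Dm (ltnW km)|exact: Im].
exact.
Qed.

(* A closed chain of darts crosses the walk an even number of times. *)
Lemma side_arc_loop x y d : x != y -> dart x y d ->
  (forall f, dart x y f -> inner x y f) ->
  (forall f, dart x y f -> f != d -> ~~ odd (uses c s f.1 f.2)) ->
  ~~ odd (uses c s d.1 d.2).
Proof.
move=> N D I H.
have Dn n : dart x y (iter n (arc x) d).
  by elim: n => //= n IH; apply: arc_dart => //; exact: I.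
have [||n n0 E] := @iter_return _ (arc x) [seq (p, q) | p <- boxcells, q <- boxcells] d.
- move=> n; have [b1 b2] := dart_box N (Dn n).
  by apply/allpairsP; exists (iter n (arc x) d); rewrite !mem_boxcells // -surjective_pairing.
- by move=> m n /(congr1 (unarc x)); rewrite !(arcK N) //; apply: I.
have ex : exists n, (0 < n)%N && (iter n (arc x) d == d) by exists n; rewrite n0 E eqxx.
case: (ex_minnP ex) => m /andP[m0 /eqP Em] mmin.
have NE k : (0 < k < m)%N -> iter k (arc x) d != d.
  move=> /andP[k0 km]; apply: contraTneq km => Ek; rewrite -leqNgt; apply: mmin.
  by rewrite k0 Ek eqxx.
have K : forall k, (k < m)%N -> S (iter k (arc x) d).1 (iter k (arc x) d).2 = S d.1 d.2.
  elim=> // k IH km; rewrite iterS (side_arc (Dn _) (I _ (Dn _))) IH ?(ltnW km) //.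
  by rewrite (negPf (H _ (Dn k.+1) (NE _ _))) ?addbF.
have := side_arc (Dn m.-1) (I _ (Dn m.-1)).
rewrite -iterS prednK // Em K; last by rewrite prednK.
by case: (S d.1 d.2); case: (odd _).
Qed.
End Walk.
End Quotient.

(* A planar triangulation: [next x] is the rotation at [x], and every closed
   walk splits the faces into two sides ([side x y] is the side of the face to
   the left of the dart [x y]). *)
Record sphere_map (T : finType) (e : rel T) (next : T -> T -> T) : Prop := SphereMap {
  map_edge : forall x y, e x y -> e x (next x y);
  map_face : forall x y, e x y -> e y (next x y) /\ next y (next x y) = x;
  map_sides : forall c s, path e c s -> last c s = c ->
    exists side : T -> T -> bool, forall x y, e x y ->
      side x y = side y (next x y) /\ side x y (+) side y x = odd (uses c s x y) }.

Lemma steps_snd (V : eqType) (c : V) s st : st \in steps c s -> st.2 \in s.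
Proof.
elim: s c => //= d s IH c; rewrite steps_cons inE => /orP[/eqP->|/IH h].
  exact: mem_head.
by apply/orP; right.
Qed.

Section Quotient.
Context (T : finType) (M : int) (x0 : T) (lam : cell -> T) (e : rel T).
Hypothesis lamP : labelling M x0 lam.
Hypothesis eC : symmetric e.
Hypothesis eQ : forall x y, e x y <-> qedge lam x y.
Hypothesis conn2 : forall x y z z', e x y -> z \notin [:: x; y] -> z' \notin [:: x; y] ->
  exists s, [/\ path e z s, last z s = z' & all [predC [:: x; y]] (z :: s)].
Hypothesis deg2 : forall x y, e x y -> exists2 z, e x z & z != y.

Local Notation dart := (dart lam).
Local Notation inner := (inner lam).

Lemma edge_neq x y : e x y -> x != y.
Proof. by move=> /eQ [/eqP]. Qed.

Lemma edge_dart x y : e x y -> exists d, dart x y d.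
Proof. by move=> /eQ [_ [p [q [A h1 h2]]]]; exists (p, q); rewrite /dart A h1 h2 !eqxx. Qed.

Lemma fiber_uses p s a b : {in p :: s, forall r, lam r = lam p} -> lam a <> lam b ->
  uses p s a b = 0%N.
Proof.
move=> H N; apply/eqP; rewrite -leqn0 leqNgt -has_count; apply/hasPn => st /steps_mem /andP[h1 h2].
by apply/norP; split; apply/eqP => E; apply: N; rewrite E in h1 h2; rewrite (H _ h1) (H _ h2).
Qed.

Definition through (d : cell * cell) (a b : cell) := (d == (a, b)) || (d == (b, a)).

Lemma uses_cons (c d : cell) s a b : uses c (d :: s) a b = (through (c, d) a b + uses d s a b)%N.
Proof. by []. Qed.

(** Walks inside fibers are inserted between the chosen darts [g]; they never join different labels,
    so only the chosen darts count. *)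
Lemma lift (g : T -> T -> cell * cell) x t p q :
  (forall x y, e x y -> dart x y (g x y)) ->
  path e x t -> lam p = x -> in_box M p -> in_box M q -> lam q = last x t ->
  exists s, [/\ path adj6 p s, last p s = q, {in p :: s, forall r, lam r \in x :: t} &
    forall a b, lam a <> lam b ->
      uses p s a b = count (fun st => through (g st.1 st.2) a b) (steps x t)].
Proof.
move=> gP; elim: t x p => [|y t IH] x p /=.
  move=> _ Lp Bp Bq Lq; have [s [h1 h2 h3]] := fiber_walk lamP Bp Bq (etrans Lp (esym Lq)).
  by exists s; split=> // [r rs|a b N]; [rewrite inE (h3 r rs) Lp|rewrite (fiber_uses h3)].
case/andP=> exy pt Lp Bp Bq Lq.
have D := gP _ _ exy; have [Bu Bw] := dart_box lamP (edge_neq exy) D.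
case Eg: (g x y) D Bu Bw => [u w] /and3P[/= A /eqP Lu /eqP Lw] Bu Bw.
have [s1 [h1 h2 h3]] := fiber_walk lamP Bp Bu (etrans Lp (esym Lu)).
have [s2 [k1 k2 k3 k4]] := IH y w pt Lw Bw Bq Lq.
exists (s1 ++ w :: s2); split.
- by rewrite cat_path h1 /= h2 A k1.
- by rewrite last_cat /= k2.
- move=> r; rewrite -cat_cons mem_cat => /orP[/h3 ->|/k3 h]; first by rewrite Lp inE eqxx.
  by rewrite inE h orbT.
- move=> a b N; rewrite uses_cat h2 (fiber_uses h3) // add0n uses_cons (k4 _ _ N).
  by [].
Qed.

Lemma dart_choice : exists g : T -> T -> cell * cell, forall x y, e x y -> dart x y (g x y).
Proof.
have /choice [g gP] : forall xy : T * T, exists d, e xy.1 xy.2 -> dart xy.1 xy.2 d.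
  move=> [x y]; have [exy|_] := boolP (e x y); last by exists (0, 0).
  by have [d D] := edge_dart exy; exists d.
by exists (fun x y => g (x, y)) => x y; exact: (gP (x, y)).
Qed.

Lemma dart_uniq_label x y x' y' d : dart x y d -> dart x' y' d -> x = x' /\ y = y'.
Proof. by case/and3P=> _ /eqP<- /eqP<- /and3P[_ /eqP<- /eqP<-]. Qed.

Lemma through_dart x y d f : x != y -> dart x y d -> dart x y f -> through d f.1 f.2 = (d == f).
Proof.
move=> N D F; rewrite /through -surjective_pairing.
case: (d =P (f.2, f.1)) => [E|_]; rewrite ?orbF //.
have := dart_rev F; rewrite /rev_dart -E => /(dart_uniq_label D) [xy _].
by rewrite xy eqxx in N.
Qed.

Lemma through_rev d a b : through (rev_dart d) a b = through d a b.
Proof. by case: d => u w; rewrite /through /rev_dart /= !xpair_eqE; apply/orP/orP => -[]/andP[]->->; [right|left|right|left]. Qed.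

(** Otherwise the darts from [x] to [y] form closed chains. A walk from [y] to [x] that avoids both
    in between, closed by the dart [d], would cross the chain of [d] exactly once. *)
Lemma outer_dart x y : e x y -> exists2 d, dart x y d & ~~ inner x y d.
Proof.
move=> exy; apply: contrapT => H.
have N := edge_neq exy.
have I f : dart x y f -> inner x y f.
  by move=> D; apply/negPn/negP => h; apply: H; exists f.
have [d D] := edge_dart exy; have [Bp Bq] := dart_box lamP N D.
have [z exz zy] := deg2 exy; have eyx : e y x by rewrite eC.
have [z' eyz' zx'] := deg2 eyx.
have zn : z \notin [:: x; y] by rewrite !inE negb_or zy eq_sym (edge_neq exz).
have zn' : z' \notin [:: x; y] by rewrite !inE negb_or zx' eq_sym (edge_neq eyz').
have [s [s1 s2 s3]] := conn2 exy zn' zn.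
have [g gP] := dart_choice.
case/and3P: (D) => A /eqP Lp /eqP Lq.
have pw : path e y (rcons (z' :: s) x) by rewrite rcons_path /= eyz' s1 s2 eC exz.
have Lp' : lam d.1 = last y (rcons (z' :: s) x) by rewrite last_rcons.
have [t [t1 t2 _ t4]] := lift gP pw Lq Bq Bp Lp'.
have U f : dart x y f -> uses d.1 (d.2 :: t) f.1 f.2 = (d == f) :> nat.
  move=> F; rewrite uses_cons -surjective_pairing (through_dart N D F) t4; last first.
    by case/and3P: F => _ /eqP-> /eqP->; exact/eqP.
  rewrite (_ : count _ _ = 0%N) ?addn0 //; apply/eqP; rewrite -leqn0 leqNgt -has_count.
  apply/hasPn => st sst; have est := steps_path pw sst.
  have NN : ~ (st.1 = x /\ st.2 = y) /\ ~ (st.1 = y /\ st.2 = x).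
    have H' : (st.1 \notin [:: x; y]) || (st.2 \notin [:: x; y]).
      move: sst; rewrite -cats1 steps_cat mem_cat => /orP[/steps_snd h|].
        by rewrite (allP s3 _ h : st.2 \notin _) orbT.
      rewrite inE => /eqP -> /=; have := allP s3 _ (mem_last z' s) => /= h.
      by rewrite (h : last z' s \notin _).
    by split=> -[e1 e2]; move: H'; rewrite e1 e2 !inE !eqxx ?orbT.
  have Dg := gP _ _ est; apply/negP => /orP[/eqP E|/eqP E]; rewrite E in Dg.
    by rewrite -surjective_pairing in Dg; have [? ?] := dart_uniq_label Dg F; apply: NN.1.
  by have [? ?] := dart_uniq_label Dg (dart_rev F); apply: NN.2.
have pc : path adj6 d.1 (d.2 :: t) by rewrite /= A t1.
have [S SP] := sides pc t2.
have : ~~ odd (uses d.1 (d.2 :: t) d.1 d.2); last by rewrite U // eqxx.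
apply: (side_arc_loop lamP SP N D I) => f F fd.
by rewrite U // eq_sym (negPf fd).
Qed.

Lemma innerC x y d : inner x y d = inner y x d.
Proof. by rewrite /QuotientMap.inner !inE orbC. Qed.

(** Two outer darts, joined inside the fibers, make a closed walk. The chain from the reverse of
    [d1] ends at an outer dart [d]. The apexes of [d1] and [d] would lie on different sides of the
    walk, although they are connected in the graph without [x] and [y]. *)
Lemma outer_dart_uniq x y d1 d2 : e x y -> dart x y d1 -> dart x y d2 ->
  ~~ inner x y d1 -> ~~ inner x y d2 -> d1 = d2.
Proof.
move=> exy D1 D2 O1 O2; apply/eqP/negPn/negP => d12.
have N := edge_neq exy; have N' : y != x by rewrite eq_sym.
have [Bp1 Bq1] := dart_box lamP N D1; have [Bp2 Bq2] := dart_box lamP N D2.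
case/and3P: (D1) => A1 /eqP Lp1 /eqP Lq1; case/and3P: (D2) => A2 /eqP Lp2 /eqP Lq2.
have [s1 [h1 h2 h3]] := fiber_walk lamP Bp1 Bp2 (etrans Lp1 (esym Lp2)).
have [s2 [k1 k2 k3]] := fiber_walk lamP Bq2 Bq1 (etrans Lq2 (esym Lq1)).
pose s := s1 ++ d2.2 :: rcons s2 d1.1.
have ps : path adj6 d1.1 s.
  by rewrite cat_path h1 h2 /= A2 rcons_path k1 k2 adj6C A1.
have ls : last d1.1 s = d1.1 by rewrite last_cat /= last_rcons.
have sl r : r \in d1.1 :: s -> lam r \in [:: x; y].
  rewrite -cat_cons mem_cat => /orP[/h3 ->|]; first by rewrite Lp1 !inE eqxx.
  rewrite -rcons_cons mem_rcons inE => /orP[/eqP->|/k3 ->]; first by rewrite Lp1 !inE eqxx.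
  by rewrite Lq2 !inE eqxx orbT.
have U f : dart x y f -> uses d1.1 s f.1 f.2 = ((d2 == f) + (d1 == f))%N.
  move=> F; have NF : lam f.1 <> lam f.2 by case/and3P: F => _ /eqP-> /eqP->; exact/eqP.
  rewrite uses_cat (fiber_uses h3) // add0n h2 uses_cons -surjective_pairing (through_dart N D2 F).
  rewrite -cats1 uses_cat (fiber_uses k3) // k2 add0n uses_cons /=.
  by rewrite -(through_dart N D1 F) -(through_rev d1) /uses /= addn0.
have [S SP] := sides ps ls.
have [d [Dd Od Sd]] : exists d, [/\ dart y x d, ~~ inner y x d & S d.1 d.2 = S d1.2 d1.1].
  have [|d [Dd Od Sd]] := side_arc_run lamP SP N' (dart_rev D1); first by rewrite /rev_dart -surjective_pairing innerC.
  exists d; split=> //; apply: Sd => f F; rewrite innerC => If.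
  rewrite uses_sym -[f.2]/(rev_dart f).1 -[f.1]/(rev_dart f).2 U; last exact: dart_rev.
  case: eqP => [E|_]; first by rewrite -E (negPf O2) in If.
  by case: eqP => [E|_ //]; rewrite -E (negPf O1) in If.
have out r : lam r \notin [:: x; y] -> r \notin d1.1 :: s.
  by move=> h; apply: contra h => /sl.
have H1 : S d1.1 d1.2 = S (apex d1) d1.1 by rewrite (side_cycle SP A1).
case/and3P: (Dd) => Ad /eqP Lp /eqP Lq.
have Hd : S d.1 d.2 = S (apex d) d.1 by rewrite (side_cycle SP Ad).
have [Aa1 _] := adj6_nu A1; have [Aa _] := adj6_nu Ad.
have Od' : ~~ inner x y d by rewrite innerC.
have Ba1 : in_box M (apex d1).
  apply: (edge_in_box (q := d1.1) lamP); first by rewrite adj6C.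
  by move=> E; move: O1; rewrite /QuotientMap.inner E Lp1 !inE eqxx.
have Ba : in_box M (apex d).
  apply: (edge_in_box (q := d.1) lamP); first by rewrite adj6C.
  by move=> E; move: Od'; rewrite /QuotientMap.inner E Lp !inE eqxx orbT.
have [t [t1 t2 t3]] := conn2 exy O1 Od'.
have [g gP] := dart_choice.
have [w [w1 w2 w3 _]] := lift gP t1 (erefl _) Ba1 Ba (esym t2).
have al : all [predC d1.1 :: s] (apex d1 :: w).
  apply/allP => r /w3 h; apply: out.
  exact: (allP t3 _ h).
have := side_path SP w1 al; rewrite w2 => /(_ d1.1 d.1).
rewrite adj6C Aa1 adj6C Aa => /(_ isT isT); rewrite -H1 -Hd Sd => E.
have [_] := SP _ _ A1; rewrite E addbb U // eqxx.
by rewrite eq_sym (negPf d12).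
Qed.

(** Each directed edge has exactly one outer dart [E x y]; its left triangle carries three labels
    and is the face on that side. *)
Theorem quotient_map : exists next, sphere_map e next.
Proof.
have /choice [E0 E0P] : forall xy : T * T, exists d, e xy.1 xy.2 ->
    dart xy.1 xy.2 d /\ ~~ inner xy.1 xy.2 d.
  move=> [x y]; have [exy|_] := boolP (e x y); last by exists (0, 0).
  by have [d D O] := outer_dart exy; exists d.
pose E x y := E0 (x, y).
have ED x y : e x y -> dart x y (E x y) by move=> /(E0P (x, y)) [].
have EO x y : e x y -> ~~ inner x y (E x y) by move=> /(E0P (x, y)) [].
pose next x y := lam (apex (E x y)).
have face x y : e x y -> [/\ e x (next x y), e y (next x y) &
    E y (next x y) = ((E x y).2, apex (E x y))].
  move=> exy; case/and3P: (ED _ _ exy) => A /eqP L1 /eqP L2; have [A1 A2] := adj6_nu A.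
  have O : next x y \notin [:: x; y] := EO _ _ exy.
  have exz : e x (next x y).
    apply/eQ; split; last by exists (E x y).1, (apex (E x y)).
    by move=> xn; move: O; rewrite -xn inE eqxx.
  have eyz : e y (next x y).
    apply/eQ; split; last by exists (E x y).2, (apex (E x y)).
    by move=> xn; move: O; rewrite -xn !inE eqxx orbT.
  split=> //; apply: (outer_dart_uniq eyz); [exact: ED| |exact: EO|].
    by rewrite /QuotientMap.dart /= A2 L2 !eqxx.
  rewrite /QuotientMap.inner /apex /= nu_nu L1 !inE negb_or (edge_neq exy) /=.
  exact: edge_neq exz.
exists next; split.
- by move=> x y /face [].
- move=> x y exy; have [h1 h2 h3] := face _ _ exy; split=> //.
  by rewrite {1}/next h3 /apex /= nu_nu; case/and3P: (ED _ _ exy) => _ /eqP.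
move=> c s ps ls.
have [s0|s0] := eqVneq s [::].
  exists (fun _ _ => false) => x y exy; rewrite s0 /=; split=> //.
(* Both directions of an edge are lifted to the same lattice edge, which therefore inherits the
   count of the edge. *)
pose g x y := if (enum_rank x < enum_rank y)%N then E x y else rev_dart (E y x).
have gP x y : e x y -> dart x y (g x y).
  move=> exy; rewrite /g; case: ifP => _; first exact: ED.
  by apply: dart_rev; apply: ED; rewrite eC.
have [p [Bp Lp]] : exists p, in_box M p /\ lam p = c.
  case: (s) s0 ps => //= y s' _ /andP[exy _].
  have [d D] := edge_dart exy; exists d.1; have [B _] := dart_box lamP (edge_neq exy) D.
  by case/and3P: D => _ /eqP.
have [t [t1 t2 _ t4]] := lift gP ps Lp Bp Bp (etrans Lp (esym ls)).
have [S SP] := sides t1 t2.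
exists (fun x y => S (E x y).1 (E x y).2) => x y exy.
have [h1 h2 h3] := face _ _ exy; case/and3P: (ED _ _ exy) => A /eqP L1 /eqP L2.
split; first by rewrite h3 /=; have [] := SP _ _ A.
have W (x' y' : T) : e x' y' -> (enum_rank x' < enum_rank y')%N ->
    S (E x' y').1 (E x' y').2 (+) S (E y' x').1 (E y' x').2 = odd (uses c s x' y').
  move=> exy' rk; have N := edge_neq exy'; have N' : y' != x' by rewrite eq_sym.
  have eyx' : e y' x' by rewrite eC.
  have D := ED _ _ exy'; have O := EO _ _ exy'.
  have U f : dart x' y' f -> uses p t f.1 f.2 = if f == E x' y' then uses c s x' y' else 0%N.
    move=> F; rewrite t4; last by case/and3P: F => _ /eqP-> /eqP->; exact/eqP.
    have C st : st \in steps c s -> through (g st.1 st.2) f.1 f.2 =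
        (f == E x' y') && ((st == (x', y')) || (st == (y', x'))).
      move=> /(steps_path ps); case: st => u w /= euw.
      have G := gP _ _ euw.
      have [/eqP[-> ->]|n1] := boolP ((u, w) == (x', y')).
        by rewrite (through_dart N (gP _ _ exy') F) /g rk [E x' y' == f]eq_sym ?eqxx /= ?andbT.
      have [/eqP[-> ->]|n2] := boolP ((u, w) == (y', x')).
        rewrite /g ltnNge (ltnW rk) /= through_rev (through_dart N D F).
        by rewrite [E x' y' == f]eq_sym ?eqxx ?orbT /= ?andbT.
      rewrite andbF; apply/negP => /orP[/eqP Eq|/eqP Eq]; rewrite Eq in G.
        rewrite -surjective_pairing in G; have [e1 e2] := dart_uniq_label G F.
        by rewrite e1 e2 eqxx in n1.
      have [e1 e2] := dart_uniq_label G (dart_rev F).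
      by rewrite e1 e2 eqxx in n2.
    rewrite (eq_in_count C); case: ifP => _ //; exact: count_pred0.
  (* The chain leads from the reverse of [E x' y'] to [E y' x'], and the lifted walk uses none of
     the darts met on the way. *)
  have [|d [Dd Od Sd]] := side_arc_run lamP SP N' (dart_rev D).
    by rewrite /rev_dart -surjective_pairing innerC.
  rewrite (outer_dart_uniq eyx' Dd (ED _ _ eyx') Od (EO _ _ eyx')) in Sd.
  rewrite Sd; last first.
    move=> f F; rewrite innerC => If.
    rewrite uses_sym -[f.2]/(rev_dart f).1 -[f.1]/(rev_dart f).2 U; last exact: dart_rev.
    by case: eqP => // Ef; rewrite Ef (negPf O) in If.
  case/and3P: (D) => A' _ _; have [_] := SP _ _ A'.
  by rewrite U // eqxx.
case: (ltngtP (enum_rank x) (enum_rank y)) => h; first exact: W.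
  by rewrite addbC uses_sym; apply: W => //; rewrite eC.
by have := edge_neq exy; rewrite -(inj_eq enum_rank_inj) -val_eqE /= h eqxx.
Qed.
End Quotient.

End QuotientMap.

(** * Planarity of subgraphs *)

Module PlanarGraphs.
Import classical_sets.

Lemma pair_setP (T : Type) (x y u w : T) :
  [set x; y]%classic = [set u; w]%classic -> (x = u /\ y = w) \/ (x = w /\ y = u).
Proof.
move=> E; have xin : [set u; w]%classic x by rewrite -E; left.
have yin : [set u; w]%classic y by rewrite -E; right.
have uin : [set x; y]%classic u by rewrite E; left.
have win : [set x; y]%classic w by rewrite E; right.
case: xin => /= ex; case: yin => /= ey; subst; [|by left|by right|].
- by case: win => /= <-; left.
- by case: uin => /= <-; left.
Qed.

Lemma planar_sub (T T' : finType) (e : rel T) (e' : rel T') (f : T' -> T) :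
  injective f -> (forall x y, e' x y -> e (f x) (f y)) -> planar e -> planar e'.
Proof.
move=> fi sub [g [P [gi [arcP crossP]]]].
exists (g \o f), (fun x y => P (f x) (f y)); split; [|split].
- by move=> x y /gi /fi.
- move=> x y /sub /arcP [h1 h2 h3 h4 h5]; split=> // t z; exact: h5.
- move=> x y u w /sub exy /sub euw N s t sb tb E.
  have N' : [set f x; f y]%classic != [set f u; f w]%classic.
    apply: contra_neq N => H; have := pair_setP H.
    by move=> [[e1 e2]|[e1 e2]]; rewrite (fi _ _ e1) (fi _ _ e2) // classical_sets.setUC.
  have [z zin Ez] := crossP _ _ _ _ exy euw N' s t sb tb E.
  move: zin; rewrite !inE => /andP[/orP[]/eqP z1 /orP[]/eqP z2].
  + exists x; last by rewrite Ez z1.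
    by rewrite !inE eqxx /= -(inj_eq fi) -z1 z2 eqxx.
  + exists x; last by rewrite Ez z1.
    by rewrite !inE eqxx /= -!(inj_eq fi) -z1 z2 eqxx orbT.
  + exists y; last by rewrite Ez z1.
    by rewrite !inE eqxx orbT /= -(inj_eq fi) -z1 z2 eqxx.
  + exists y; last by rewrite Ez z1.
    by rewrite !inE eqxx orbT /= -!(inj_eq fi) -z1 z2 eqxx orbT.
Qed.

End PlanarGraphs.

(** * Colorings and connectivity of a minimal counterexample *)

Module Coloring.
Import all_fingroup boolp.
Import PlanarGraphs.

Section MinCounterexample.
Context (T : finType) (e : rel T).
Hypothesis eC : symmetric e.
Hypothesis eI : irreflexive e.
Hypothesis ePl : planar e.
Hypothesis eN : ~ colorable 4 e.
Hypothesis eMin : forall (T' : finType) (e' : rel T'), inN4 e' -> #|T| <= #|T'|.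

Definition colors_on (A : {set T}) (c : T -> 'I_4) :=
  forall x y, x \in A -> y \in A -> e x y -> c x != c y.

Definition restr (A : {set T}) : rel T := [rel x y | [&& e x y, x \in A & y \in A]].

Lemma restr_sym (A : {set T}) : connect_sym (restr A).
Proof. by apply: sym_connect_sym => x y; rewrite /restr /= eC; congr andb; rewrite andbC. Qed.

Lemma connect_restr_mem (A : {set T}) (x y : T) : x \in A -> connect (restr A) x y -> y \in A.
Proof.
move=> xA /connectP [s]; elim: s x xA => [|z s IH] x xA /=; first by move=> _ ->.
by move=> /andP[/and3P[_ _ zA] ps]; exact: IH.
Qed.

(** Minimality speaks of connected graphs, so it is applied to one component of the graph induced on
    [A]. *)
Lemma component_colors (A : {set T}) x : A != [set: T]%SET -> x \in A ->
  exists c, colors_on [set y | connect (restr A) x y]%SET c.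
Proof.
move=> pA xA; pose D := [set y | connect (restr A) x y]%SET.
pose T' : finType := {y : T | y \in D}; pose e' : rel T' := fun u w => e (val u) (val w).
have card : (#|T'| < #|T|)%N.
  rewrite card_sub; apply: leq_ltn_trans (_ : #|A| < _)%N.
    apply/subset_leq_card/subsetP => y; rewrite !inE; exact: connect_restr_mem.
  rewrite ltn_neqAle max_card andbT; apply: contra pA => /eqP h.
  by rewrite eqEcard subsetT cardsT h leqnn.
have : ~ inN4 e' by move=> /eMin; rewrite leqNgt card.
move=> N; have [c cP] : colorable 4 e'.
  apply: contrapT => nc; apply: N; split=> //.
  - by split=> [u w|u]; [exact: eC|exact: eI].
  - have conn u (w : T') : connect (restr A) (val u) (val w) -> connect e' u w.
      move=> /connectP [s]; elim: s u => [|z s IH] u /=.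
        by move=> _ /val_inj ->.
      move=> /andP[uz ps] lw.
      have zD : z \in D.
        have := valP u; rewrite !inE => h; apply: connect_trans h _; exact: connect1.
      apply: connect_trans (IH (Sub z zD) _ _); rewrite ?SubK //.
      by apply: connect1; rewrite /e' SubK; case/and3P: uz.
    move=> u w; apply: conn; have := valP u; have := valP w; rewrite !inE => h1 h2.
    by apply: connect_trans h1; rewrite restr_sym.
  - by apply: (planar_sub (f := val)) ePl => //; exact: val_inj.
exists (fun y => if insub y is Some u then c u else ord0) => y z yD zD eyz.
by rewrite !insubT; apply: cP; rewrite /e' !SubK.
Qed.

Lemma proper_colors (A : {set T}) : A != [set: T]%SET -> exists c, colors_on A c.
Proof.
move=> pA.
have /choice [C CP] : forall x, exists c, x \in A -> colors_on [set y | connect (restr A) x y]%SET c.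
  move=> x; have [xA|_] := boolP (x \in A); last by exists (fun=> ord0).
  by have [c H] := component_colors pA xA; exists c.
exists (fun y => C (root (restr A) y) y) => x y xA yA exy.
have cxy : connect (restr A) x y by apply: connect1; rewrite /restr /= exy xA yA.
have -> : root (restr A) y = root (restr A) x by apply/esym/(rootP (restr_sym A)).
have rx : connect (restr A) (root (restr A) x) x by rewrite restr_sym connect_root.
apply: CP => //.
- by apply: connect_restr_mem xA _; exact: connect_root.
- by rewrite inE.
- by rewrite inE; apply: connect_trans rx cxy.
Qed.

(** Used to make two colorings agree on a separating edge or vertex. *)
Lemma perm_pair (a b a' b' : 'I_4) : (a == b) = (a' == b') ->
  exists s : {perm 'I_4}, s a = a' /\ s b = b'.
Proof.
have [->|ab] := eqVneq a b; first by move=> /esym/eqP <-; exists (tperm b a'); rewrite tpermL.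
move=> /esym ab'; exists (tperm a a' * tperm (tperm a a' b) b')%g.
rewrite !permM !tpermL; split=> //; rewrite [LHS]tpermD ?(eq_sym b') ?ab' //.
by rewrite -{2}(tpermL a a') (inj_eq perm_inj) eq_sym.
Qed.

(** A vertex with no neighbor except possibly [y] can be colored last. *)
Lemma min_deg2 x y : exists2 z, e x z & z != y.
Proof.
apply: contrapT => H; apply: eN.
have [|c cP] := @proper_colors (~: [set x])%SET.
  by apply/eqP => /setP /(_ x); rewrite !inE eqxx.
have [k ky] : exists k : 'I_4, k != c y.
  by have [h|h] := boolP (ord0 != c y); [exists ord0|exists ord_max; move: h; rewrite negbK => /eqP <-].
exists (fun z => if z == x then k else c z) => u w euw.
have U z : e x z -> z = y by move=> exz; apply/eqP/negPn/negP => zy; apply: H; exists z.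
case: (eqVneq u x) (eqVneq w x) => [eu|nu] [ew|nw].
- by move: euw; rewrite eu ew eI.
- by rewrite (U w) // -eu.
- by rewrite (U u) 1?eq_sym // -ew eC.
- by apply: cP => //; rewrite !inE.
Qed.

(** If [x] and [y] separated the graph, the two parts, each with the clique included, could be
    colored and then glued by a permutation of the colors. The case [x = y] treats separating
    vertices. *)
Lemma clique_cut x y z z' : x = y \/ e x y -> z \notin [:: x; y] -> z' \notin [:: x; y] ->
  exists s, [/\ path e z s, last z s = z' & all [predC [:: x; y]] (z :: s)].
Proof.
move=> xy zn zn'; pose B := [set u | u \notin [:: x; y]]%SET.
have zB : z \in B by rewrite inE.
have [/connectP [s ps ls]|NC] := boolP (connect (restr B) z z').
  have H : path e z s /\ all [predC [:: x; y]] s.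
    elim: s z zB ps {zn ls} => //= u s IH w wB /andP[/and3P[ewu _ uB] ps].
    have [h1 h2] := IH u uB ps; rewrite ewu h1 h2; split=> //.
    by move: uB; rewrite inE => ->.
  by exists s; split; [exact: H.1| |rewrite /= zn; exact: H.2].
pose D := [set u | connect (restr B) z u]%SET.
have DB u : u \in D -> u \in B by rewrite inE; exact: connect_restr_mem.
have xB : x \notin B by rewrite !inE eqxx.
have yB : y \notin B by rewrite !inE eqxx orbT.
have [|c1 c1P] := @proper_colors (D :|: [set x; y])%SET.
  apply/eqP => /setP /(_ z'); rewrite !inE (negPf NC) /=.
  by move: zn'; rewrite !inE => /negPf ->.
have [|c2 c2P] := @proper_colors (~: D)%SET.
  by apply/eqP => /setP /(_ z); rewrite !inE connect0.
have [s [sx sy]] : exists s : {perm 'I_4}, s (c2 x) = c1 x /\ s (c2 y) = c1 y.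
  apply: perm_pair; case: xy => [->|exy]; first by rewrite !eqxx.
  have xD : x \notin D by apply: contra xB; exact: DB.
  have yD : y \notin D by apply: contra yB; exact: DB.
  rewrite (negPf (c2P x y _ _ exy)) ?in_setC // (negPf (c1P x y _ _ exy)) //.
    by rewrite !inE eqxx orbT.
  by rewrite !inE eqxx !orbT.
case: eN; exists (fun u => if u \in D then c1 u else s (c2 u)).
have cross u w : u \in D -> w \notin D -> e u w -> c1 u != s (c2 w).
  move=> uD wD euw.
  have wxy : w \in [:: x; y].
    apply/negPn/negP => wB; move/negP: wD; apply; rewrite inE.
    have := uD; rewrite inE => h; apply: connect_trans h _; apply: connect1.
    by rewrite /restr /= euw (DB _ uD) inE wB.
  have -> : s (c2 w) = c1 w by move: wxy; rewrite !inE => /orP[]/eqP->.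
  apply: c1P => //; rewrite inE; first by rewrite uD.
  by move: wxy; rewrite !inE => ->; rewrite orbT.
move=> u w euw; case: ifP => uD; case: ifP => wD.
- by apply: c1P => //; rewrite inE ?uD ?wD.
- by apply: cross => //; rewrite wD.
- by rewrite eq_sym; apply: cross => //; rewrite ?uD // eC.
- by rewrite (inj_eq perm_inj); apply: c2P => //; rewrite in_setC ?uD ?wD.
Qed.
End MinCounterexample.

End Coloring.

(** * The minimal counterexample as a triangulation *)

Module MinimalMap.
Import all_algebra boolp classical_sets.
Import Lattice Realization Discretization Regions LatticeSides QuotientMap PlanarGraphs Coloring.

Lemma qedge_sym (T : eqType) (lam : cell -> T) x y : qedge lam x y -> qedge lam y x.
Proof.
case=> N [p [q [A h1 h2]]]; split; first by move=> E; apply: N.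
by exists q, p; rewrite adj6C.
Qed.

Theorem min_counterexample_map (T : finType) (e : rel T) : in_eMPGN4 e ->
  exists next, sphere_map e next /\
    forall x z z', z != x -> z' != x ->
      exists s, [/\ path e z s, last z s = z' & x \notin z :: s].
Proof.
move=> [[[eC eI] _ ePl eN] [_ eMax] eMin].
have deg := min_deg2 eC eI ePl eN eMin.
have cut := clique_cut eC eI ePl eN eMin.
have edge_at x : exists y, e x y by have [y exy _] := deg x x; exists y.
have [z0 _] : exists x : T, True.
  by apply: contrapT => H; apply: eN; exists (fun=> ord0) => x; case: H; exists x.
have [f [P [fi [arcP crossP]]]] := ePl.
have [L [v [w dd]]] := discretize eI fi arcP crossP.
have [M [x0 [lam [lamP surj eQ]]]] := drawing_labelling dd eC eI (ex_intro _ z0 I) edge_at.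
have Qe x y : e x y <-> qedge lam x y.
  split; first exact: eQ.
  (* If touching labels were not adjacent, the graph with this edge added would still consist of
     adjacencies of labels, so [realize] would draw it, against maximality. *)
  move=> Q; apply: contrapT => /negP N; have xy : x != y by apply/eqP; case: Q.
  apply: (eMax x y xy N); apply: (realize lamP _ surj) => u t H.
  case/orP: H => [H|/eqP H]; first exact: eQ.
  by case: (pair_setP H) => -[-> ->] //; exact: qedge_sym.
have [|next nextP] := quotient_map lamP eC Qe _ (fun x y _ => deg x y).
  by move=> x y z z' exy; apply: cut; right.
exists next; split=> // x z z' zx zx'.
have [||s [s1 s2 s3]] := @cut x x z z' (or_introl erefl); rewrite ?inE ?orbb //.
exists s; split=> //; apply/negP => xs.
by have := allP s3 x xs; rewrite /= !inE eqxx.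
Qed.

End MinimalMap.

(** * Rotations, and noncrossing connections around a hub *)

Module Rotation.
Import zify.
Import LatticeSides QuotientMap.

Section Map.
Context (T : finType) (e : rel T).
Hypothesis eC : symmetric e.
Hypothesis eI : irreflexive e.

Lemma next_face next x y : sphere_map e next -> e x y ->
  next (next x y) x = y.
Proof.
move=> mapP exy; have [h1 h2] := map_face mapP exy.
by have [_] := map_face mapP h1; rewrite h2.
Qed.

(** A reflection reverses all rotations and exchanges the left and right sides of a dart. *)
Lemma mirror_map next : sphere_map e next -> sphere_map e (fun x y => next y x).
Proof.
move=> mapP; split.
- by move=> x y exy; have [|] := map_face mapP (x := y) (y := x); rewrite // eC.
- move=> x y; rewrite eC => eyx; split; first exact: map_edge mapP _ _ eyx.
  exact: next_face.
- move=> c s ps ls; have [S SP] := map_sides mapP ps ls.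
  exists (fun x y => S y x) => x y; rewrite eC => eyx.
  have [h1 h2] := SP _ _ eyx; split; last by rewrite h2 uses_sym.
  have [f1 f2] := map_face mapP eyx.
  by rewrite h1; have [-> _] := SP _ _ f1; rewrite f2.
Qed.

Context (next : T -> T -> T).
Hypothesis mapP : sphere_map e next.

Lemma next_inj x y y' : e x y -> e x y' -> next x y = next x y' -> y = y'.
Proof. by move=> h h' E; rewrite -(next_face mapP h) E (next_face mapP h'). Qed.

Lemma iter_next x y n : e x y -> e x (iter n (next x) y).
Proof. by move=> exy; elim: n => //= n; exact: (map_edge mapP). Qed.

Lemma return_next x y : e x y -> exists2 n, 0 < n & iter n (next x) y = y.
Proof.
move=> exy; apply: (@iter_return _ _ (enum T)) => [n|m n]; first by rewrite mem_enum.
by apply: next_inj; exact: iter_next.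
Qed.

Section Sides.
Variables (c : T) (s : seq T) (S : T -> T -> bool).
Hypothesis SP : forall x y, e x y ->
  S x y = S y (next x y) /\ S x y (+) S y x = odd (uses c s x y).

Lemma side_cyc x y : e x y -> S (next x y) x = S x y.
Proof.
move=> exy; have [f1 f2] := map_face mapP exy.
by have [-> _] := SP exy; have [-> _] := SP f1; rewrite f2.
Qed.

Lemma side_turn_l x y : e x y -> S x (next x y) = S x y (+) odd (uses c s x (next x y)).
Proof.
move=> exy; have [_ <-] := SP (map_edge mapP exy); rewrite (side_cyc exy).
by rewrite addbC -addbA addbb addbF.
Qed.

Lemma side_turn_r x y : e x y -> S (next x y) y = S x y (+) odd (uses c s (next x y) y).
Proof.
move=> exy; have [f1 _] := map_face mapP exy; rewrite eC in f1.
have [_ <-] := SP f1; have [<- _] := SP exy.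
by rewrite addbC -addbA addbb addbF.
Qed.

Lemma graph_uses_notin p q : p \notin c :: s -> uses c s p q = 0.
Proof.
move=> pC; apply/eqP; rewrite -leqn0 leqNgt -has_count; apply/hasPn => st /steps_mem /andP[h1 h2].
by apply/norP; split; apply: contra pC => /eqP E; rewrite E in h1 h2.
Qed.

Lemma side_sym x y : x \notin c :: s -> e x y -> S x y = S y x.
Proof.
move=> xC exy; have [_] := SP exy; rewrite graph_uses_notin //.
by case: (S x y); case: (S y x).
Qed.
End Sides.

Hypothesis conn : forall x z z', z != x -> z' != x ->
  exists s, [/\ path e z s, last z s = z' & x \notin z :: s].

(** If [z] were missing from the orbit of [y], take a closed walk from [x] through [z] and [y] that
    avoids [x] in between: a full turn about [x] along the orbit would cross it exactly once. *)
Lemma next_cycle x y z : e x y -> e x z -> exists k, z = iter k (next x) y.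
Proof.
move=> exy exz; have [<-|yz] := eqVneq y z; first by exists 0.
have [xy xz] : x != y /\ x != z.
  by split; [apply: contraTneq exy => <-|apply: contraTneq exz => <-]; rewrite eI.
have [||s [s1 s2 s3]] := @conn x z y; rewrite 1?eq_sym //.
have pc : path e x (z :: rcons s x) by rewrite /= exz rcons_path s1 s2 eC exy.
have lc : last x (z :: rcons s x) = x by rewrite /= last_rcons.
have [S SP] := map_sides mapP pc lc.
have U w : uses x (z :: rcons s x) x w = ((z == w) + (y == w))%N.
  have E0 : uses z s x w = 0 by exact: graph_uses_notin.
  rewrite -cats1 -cat_cons uses_cat.
  rewrite [uses x (z :: s) x w](_ : _ = ((z == w) + uses z s x w)%N); last first.
    rewrite /uses steps_cons /= !xpair_eqE eqxx /= (eq_sym z x) (negPf xz) andbF orbF //.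
  by rewrite E0 addn0 /= s2 /uses /= !xpair_eqE eqxx andbT (eq_sym y x) (negPf xy) /= addn0.
have [n n0 nE] := return_next exy.
have ex : exists n, (0 < n) && (iter n (next x) y == y) by exists n; rewrite n0 nE eqxx.
case: (ex_minnP ex) => {n n0 nE}n /andP[n0 /eqP nE] nmin.
have [/hasP[k _ /eqP->]|/hasPn H] := boolP (has (fun k => z == iter k (next x) y) (iota 0 n)).
  by exists k.
have K k : k < n -> S x (iter k (next x) y) = S x y.
  elim: k => //= k IH kn; rewrite (side_turn_l SP) ?IH ?(ltnW kn) //; last exact: iter_next.
  rewrite U (negPf (H k.+1 _)) ?mem_iota // add0n.
  case: eqP => [E|_]; rewrite ?addbF //.
  by have := nmin k.+1; rewrite /= -E eqxx leqNgt kn => /(_ isT).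
have := side_turn_l SP (iter_next n.-1 exy); rewrite -iterS prednK // nE K ?prednK //.
by rewrite U eqxx (eq_sym z) (negPf yz) /=; case: (S x y).
Qed.

Lemma next_traject x y : e x y -> let n := #|[set z | e x z]| in
  [/\ uniq (traject (next x) y n), traject (next x) y n =i [set z | e x z] &
      iter n (next x) y = y].
Proof.
move=> exy.
have [n n0 nE] := return_next exy.
have ex : exists n, (0 < n) && (iter n (next x) y == y) by exists n; rewrite n0 nE eqxx.
case: (ex_minnP ex) => {n n0 nE}n /andP[n0 /eqP nE] nmin.
have M : traject (next x) y n =i [set z | e x z].
  move=> z; rewrite inE; apply/trajectP/idP => [[i _ ->]|exz]; first exact: iter_next.
  have [k ->] := next_cycle exy exz; exists (k %% n); first by rewrite ltn_mod.
  rewrite {1}(divn_eq k n) addnC iterD; congr iter; elim: (k %/ n) => //= m IH.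
  by rewrite mulSn iterD IH.
have cancel i m : iter i (next x) y = iter (i + m) (next x) y -> iter m (next x) y = y.
  elim: i => //= i IH E; apply: IH; apply: next_inj E; exact: iter_next.
have U : uniq (traject (next x) y n).
  have W i j : i < j -> j < n -> iter i (next x) y = iter j (next x) y -> False.
    move=> ij jn; rewrite -(subnKC (ltnW ij)) => /cancel E.
    have := nmin (j - i); rewrite subn_gt0 ij E eqxx leqNgt => /(_ isT).
    by rewrite (leq_ltn_trans (leq_subr _ _) jn).
  apply/(uniqP y) => i j; rewrite !inE size_traject => h1 h2; rewrite !nth_traject // => E.
  by case: (ltngtP i j) => // h; [case: (W i j)|case: (W j i)].
have -> : #|[set z | e x z]| = n.
  by rewrite -(eq_card M) (card_uniqP U) size_traject.
by [].
Qed.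
End Map.

Lemma uses_step (V : eqType) (c d : V) s p q :
  uses c (d :: s) p q = (((c, d) == (p, q)) || ((c, d) == (q, p))) + uses d s p q.
Proof. by []. Qed.

Section Noncrossing.
Context (T : finType) (e : rel T) (next : T -> T -> T).
Hypothesis eC : symmetric e.
Hypothesis eI : irreflexive e.
Hypothesis mapP : sphere_map e next.
Hypothesis conn : forall x z z', z != x -> z' != x ->
  exists s, [/\ path e z s, last z s = z' & x \notin z :: s].

Lemma side_walk c s S z t h h' :
  (forall x y, e x y -> S x y = S y (next x y) /\ S x y (+) S y x = odd (uses c s x y)) ->
  path e z t -> {in z :: t, forall w, w \notin c :: s} -> e z h -> e (last z t) h' ->
  S z h = S (last z t) h'.
Proof.
move=> SP; have const w g g' : w \notin c :: s -> e w g -> e w g' -> S w g = S w g'.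
  move=> wC eg eg'; have [k ->] := next_cycle eC eI mapP conn eg eg'.
  elim: k => //= k ->; rewrite (side_turn_l mapP SP (iter_next mapP k eg)).
  by rewrite (graph_uses_notin _ wC) addbF.
elim: t z h => [|w t IH] z h /=; first by move=> _ zC; apply: const; exact: (zC z (mem_head _ _)).
move=> /andP[ezw pt] tC ezh ew; have zC := tC z (mem_head _ _).
have tC' : {in w :: t, forall u, u \notin c :: s}.
  by move=> u uw; apply: tC; rewrite inE uw orbT.
rewrite (const z h w) // (side_sym SP zC ezw); apply: IH => //.
by rewrite eC.
Qed.

(** The boundary of the hub is a sequence of darts from hub to ring, each obtained from the previous
    one by turning about its ring end or its hub end. *)
Variables (H : pred T) (D : seq (T * T)) (x0 : T).
Let r t := (nth (x0, x0) D t).2.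
Let h t := (nth (x0, x0) D t).1.
Hypothesis hubD : forall t, t < size D -> [/\ H (h t), ~~ H (r t) & e (h t) (r t)].
Hypothesis uniqD : uniq D.
Hypothesis turnD : forall t, t.+1 < size D ->
  (h t.+1 = next (h t) (r t) /\ r t.+1 = r t) \/ (h t.+1 = h t /\ r t.+1 = next (h t) (r t)).
Hypothesis hubC : forall u w, H u -> H w -> exists s, [/\ path e u s, last u s = w & all H s].

(* Closing a path in [K] through the hub gives a walk that separates the two
   ends of the path in [L]: it crosses the boundary [D] only at t1 and t3. *)
Lemma noncrossing t1 t2 t3 t4 (K L : pred T) sK sL :
  t1 < t2 -> t2 < t3 -> t3 < t4 -> t4 < size D ->
  path e (r t1) sK -> last (r t1) sK = r t3 ->
  path e (r t2) sL -> last (r t2) sL = r t4 ->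
  {in r t1 :: sK, forall z, K z && ~~ H z} -> {in r t2 :: sL, forall z, L z && ~~ H z} ->
  (forall z, K z -> L z -> False) -> False.
Proof.
move=> t12 t23 t34 t4D pK lK pL lL inK inL KL.
have [t1D t2D t3D] : [/\ t1 < size D, t2 < size D & t3 < size D] by split; move: t12 t23 t34 t4D; clear; lia.
have [H1 nH1 e1] := hubD t1D; have [H3 nH3 e3] := hubD t3D.
have [sH [pH lH inH]] := hubC H3 H1.
have inH' : {in h t3 :: sH, forall z, H z}.
  by move=> z; rewrite inE => /orP[/eqP->//|/(allP inH)].
pose s := sK ++ h t3 :: rcons sH (r t1).
have ps : path e (r t1) s by rewrite cat_path pK lK /= eC e3 rcons_path pH lH e1.
have ls : last (r t1) s = r t1 by rewrite last_cat /= last_rcons.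
have [S SP] := map_sides mapP ps ls.
have avoid : {in r t2 :: sL, forall w, w \notin r t1 :: s}.
  move=> w /inL /andP[Lw Hw]; apply/negP; rewrite -cat_cons mem_cat => /orP[/inK/andP[/KL H' _]|].
    exact: H'.
  rewrite -rcons_cons mem_rcons inE => /orP[/eqP E|/inH']; last exact/negP.
  by have /andP[/KL] := inK (r t1) (mem_head _ _); rewrite -E => /(_ Lw).
have uses0 (A : pred T) c s' u w : {in c :: s', forall z, A z} -> ~~ A u || ~~ A w -> uses c s' u w = 0%N.
  move=> inA N; apply/eqP; rewrite -leqn0 leqNgt -has_count; apply/hasPn => st /steps_mem /andP[/inA h1 /inA h2].
  by apply/norP; split; apply/eqP => E; move: N; rewrite E in h1 h2; rewrite h1 h2.
(* [sK] avoids the hub and [sH] stays in it, so among the darts of [D] the walk uses only those at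
   [t3] and [t1]. *)
have U t : t < size D -> uses (r t1) s (h t) (r t) = ((t == t3) + (t == t1))%N.
  move=> tD; have [Ht nHt et] := hubD tD.
  have eqD t' : t' < size D -> ((h t' == h t) && (r t' == r t)) = (t == t').
    move=> tD'.
    by rewrite [RHS]eq_sym -(nth_uniq (x0, x0) tD' tD uniqD) -pair_eqE.
  have neq z w : H z -> ~~ H w -> (z == w) = false by move=> hz; apply: contraNF => /eqP <-.
  rewrite uses_cat (uses0 (fun z => ~~ H z)) ?Ht //; last by move=> z /inK /andP[].
  rewrite add0n lK uses_step -cats1 uses_cat (uses0 H) ?nHt ?orbT // lH uses_step /= addn0 add0n.
  rewrite !xpair_eqE (andbC (r t3 == r t)) !eqD // (eq_sym (r t3)) (neq (h t) (r t3)) //=.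
  by rewrite (neq (h t1) (r t)) //= orbF.
have turn t : t.+1 < size D -> S (h t.+1) (r t.+1) = S (h t) (r t) (+) ((t.+1 == t3) (+) (t.+1 == t1)).
  move=> tD; have [_ _ et] := hubD (ltnW tD).
  have := U t.+1 tD; case: (turnD tD) => -[-> ->] Ut.
    by rewrite (side_turn_r eC mapP SP et) Ut oddD !oddb.
  by rewrite (side_turn_l mapP SP et) Ut oddD !oddb.
(* From [t2] on, the side changes only at [t3]. *)
have run m : t2 + m < size D -> S (h (t2 + m)) (r (t2 + m)) = S (h t2) (r t2) (+) (t3 <= t2 + m).
  elim: m => [|m IH] mD; first by rewrite addn0 leqNgt t23 addbF.
  rewrite addnS in mD *; rewrite (turn (t2 + m) mD) (IH (ltnW mD)) -addbA; congr (_ (+) _).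
  have -> : ((t2 + m).+1 == t1) = false by apply: gtn_eqF; move: t12; clear; lia.
  have -> : (t3 <= (t2 + m).+1) = (t3 <= t2 + m) || ((t2 + m).+1 == t3) by clear; lia.
  case: ((t2 + m).+1 =P t3) => [<-|_]; last by rewrite !addbF orbF.
  by rewrite ltnn addbF.
have [H2 nH2 e2] := hubD t2D; have [H4 nH4 e4] := hubD t4D.
have := run (t4 - t2) ; rewrite subnKC; last by move: t23 t34; clear; lia.
have [a2 a4] : r t2 \notin r t1 :: s /\ r t4 \notin r t1 :: s.
  by split; apply: avoid; rewrite ?mem_head // -lL mem_last.
have e2' : e (r t2) (h t2) by rewrite eC.
have e4' : e (r t4) (h t4) by rewrite eC.
rewrite -(side_sym SP a4 e4') -(side_sym SP a2 e2') (ltnW t34) => /(_ t4D).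
have := side_walk SP pL avoid e2'; rewrite lL => /(_ _ e4') <-.
by case: (S _ _).
Qed.

End Noncrossing.

End Rotation.

(** * The finite computation on ring colorings *)

Module Checker.
Import zify.

Definition col := (bool * bool)%type.
Definition cadd (x y : col) : col := (x.1 (+) y.1, x.2 (+) y.2).
Definition c0 : col := (false, false).
Definition cols : seq col := [:: c0; (false, true); (true, false); (true, true)].
Definition shifts : seq col := behead cols.

(** A set of color words stored as a complete quaternary tree: each level of [good] is tabulated
    once, and membership is a descent in the tree. *)
Inductive trie := Leaf of bool | Node of trie & trie & trie & trie.

Fixpoint tab (n : nat) (f : seq col -> bool) : trie :=
  if n is n'.+1 then
    let sub c := tab n' (fun l => f (c :: l)) in
    Node (sub c0) (sub (false, true)) (sub (true, false)) (sub (true, true))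
  else Leaf (f [::]).

Fixpoint lookup (t : trie) (l : seq col) : bool :=
  match t, l with
  | Leaf b, [::] => b
  | Node t0 t1 t2 t3, (x, y) :: l' =>
      lookup (if x then if y then t3 else t2 else if y then t1 else t0) l'
  | _, _ => false
  end.

Fixpoint trie_all (t : trie) : bool :=
  match t with
  | Leaf b => b
  | Node t0 t1 t2 t3 => [&& trie_all t0, trie_all t1, trie_all t2 & trie_all t3]
  end.

(* Lazy variants of [has] and [all]: call by value would evaluate both sides of
   the boolean connectives. *)
Fixpoint hasb (A : Type) (p : A -> bool) (s : seq A) : bool :=
  if s is x :: s' then if p x then true else hasb p s' else false.

Fixpoint allb (A : Type) (p : A -> bool) (s : seq A) : bool :=
  if s is x :: s' then if p x then allb p s' else false else true.

(** Translating all colors by one element is a symmetry; each class is represented by its word that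
    starts with [c0]. *)
Definition normal (k : seq col) : seq col := [seq cadd (head c0 k) x | x <- k].

Definition neqc (x y : col) : bool := (x.1 (+) y.1) || (x.2 (+) y.2).
Definition proper_ring (k : seq col) : bool := allb id (pairmap neqc (last c0 k) k).

Definition same_class (g x y : col) : bool := ~~ neqc x y || ~~ neqc (cadd x y) g.

(* Would a new element joining the block [r] cross one of the blocks of [l]? *)
Fixpoint crosses (l : seq nat) (r : nat) (before : seq nat) : bool :=
  if l is b :: l' then
    if eqn b r then
      if hasb (fun c => hasb (eqn c) before) (filter (fun c => ~~ eqn c r) l') then true
      else crosses l' r before
    else crosses l' r (b :: before)
  else false.

(* A partition of ring positions is the list sending each position to the first
   position of its block; [l] and [ks] are the blocks and colors seen so far.  A
   joined position must carry a color of the same [g]-class as its block, and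
   consecutive positions of the same [g]-class are in the same block. *)
Definition may_join (g : col) (ks : seq col) (l : seq nat) (x : col) (r : nat) : bool :=
  if (if eqn r (size l) then true else
      if eqn (nth 0 l r) r then same_class g x (nth c0 ks r) else false) then
  if (if neqc (cadd x (last x ks)) g then true else eqn r (last 0 l)) then
     ~~ crosses l r [::] else false else false.

Fixpoint partitions (g : col) (ks : seq col) (l : seq nat) (rest : seq col) : seq (seq nat) :=
  if rest is x :: rest' then
    flatten [seq partitions g (rcons ks x) (rcons l r) rest' |
              r <- iota 0 (size l).+1 & may_join g ks l x r]
  else [:: l].

Fixpoint sublists (s : seq nat) : seq (seq nat) :=
  if s is x :: s' then let r := sublists s' in r ++ [seq x :: t | t <- r] else [:: [::]].

Fixpoint blocks (i : nat) (P : seq nat) : seq nat :=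
  if P is r :: P' then if eqn i r then i :: blocks i.+1 P' else blocks i.+1 P' else [::].

Definition flip (g : col) (k : seq col) (P A : seq nat) : seq col :=
  [seq (if hasb (eqn xi.2) A then cadd xi.1 g else xi.1) | xi <- zip k P].

Definition closes (g : col) (k : seq col) (P : seq nat) : bool :=
  neqc (cadd (last c0 k) (head c0 k)) g || eqn (last 0 P) (head 0 P).

(* For every noncrossing way the [g]-chains may connect the ring, some set [A] of
   chains can be switched to reach a coloring of [G]. *)
Definition kempe (G : trie) (k : seq col) (g : col) : bool :=
  allb (fun P => if closes g k P then
     hasb (fun A => lookup G (normal (flip g k P A))) (sublists (blocks 0 P)) else true)
    (partitions g [::] [::] k).

(* The hub vertices a, v1, d, b, c are colored in this order, each away from its
   colored neighbors; the ring positions 0 to 6 are v2, p, q, y, v5, v4, v3, where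
   d, a, v2, p, q are the neighbors of v1 and b, a, v1, q, y, v5 those of d. *)
Definition extends (k : seq col) : bool :=
  if k is [:: k0; k1; k2; k3; k4; k5; k6] then
    let away x s := allb (neqc x) s in
    hasb (fun a => if away a [:: k0] then
      hasb (fun v => if away v [:: k0; k1; k2; a] then
        hasb (fun d => if away d [:: k2; k3; k4; a; v] then
          hasb (fun b => if away b [:: k4; k5; a; d] then
            hasb (fun c => away c [:: k5; k6; k0; a; b]) cols
          else false) cols else false) cols else false) cols else false) cols
  else false.

Definition candidate (k : seq col) : bool :=
  if neqc (head c0 k) c0 then false else proper_ring k.

(* The ring colorings, up to translation, from which at most [n] Kempe changes
   lead to a coloring that extends to the hub. *)
Fixpoint good (n : nat) : trie :=
  if n is n'.+1 then
    let G := good n' in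
    tab 7 (fun k => if candidate k then if lookup G k then true else hasb (kempe G k) shifts
                    else false)
  else tab 7 (fun k => if candidate k then extends k else false).

Definition all_good (n : nat) : bool :=
  let G := good n in trie_all (tab 7 (fun k => if candidate k then lookup G k else true)).

(** It concerns 546 colorings: a quarter of the 3^7 - 3 proper 4-colorings of a cycle of length
    7. *)
Lemma all_good5 : all_good 5.
Proof. by vm_compute. Qed.

Lemma hasbE (A : Type) (p : A -> bool) s : hasb p s = has p s.
Proof. by elim: s => //= x s ->; case: (p x). Qed.

Lemma allbE (A : Type) (p : A -> bool) s : allb p s = all p s.
Proof. by elim: s => //= x s ->; case: (p x). Qed.

Lemma eqnb (m n : nat) : eqn m n = (m == n).
Proof. by []. Qed.

Lemma neqcE x y : neqc x y = (x != y).
Proof. by case: x y => [[] []] [[] []]. Qed.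

Lemma caddA x y z : cadd x (cadd y z) = cadd (cadd x y) z.
Proof. by rewrite /cadd /= !addbA. Qed.

Lemma caddC x y : cadd x y = cadd y x.
Proof. by rewrite /cadd addbC (addbC x.2). Qed.

Lemma caddxx x : cadd x x = c0.
Proof. by rewrite /cadd !addbb. Qed.

Lemma cadd0 x : cadd x c0 = x.
Proof. by rewrite /cadd !addbF -surjective_pairing. Qed.

Lemma caddK x y : cadd (cadd x y) y = x.
Proof. by rewrite -caddA caddxx cadd0. Qed.

Lemma cadd_inj x : injective (cadd x).
Proof. by move=> y z E; rewrite -[y](caddK _ x) (caddC y) E (caddC x) caddK. Qed.

Lemma lookup_tab n f l : size l = n -> lookup (tab n f) l = f l.
Proof.
elim: n f l => [|n IH] f [|[x y] l] //= [/IH H].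
by case: x y => [] []; rewrite H.
Qed.

Lemma trie_all_tab n f l : size l = n -> trie_all (tab n f) -> f l.
Proof.
elim: n f l => [|n IH] f [|[x y] l] //= [/IH H] /and4P[h0 h1 h2 h3].
by case: x y => [] []; apply: (H (fun l => f (_ :: l))).
Qed.

(** Positions [a < b < c] and the new one alternate between two blocks; [before] holds the blocks
    already passed. *)
Lemma crossesP l r before : crosses l r before ->
  exists b c, [/\ b < c < size l, nth 0 l b = r, nth 0 l c <> r &
    nth 0 l c \in before \/ exists2 a, a < b & nth 0 l a = nth 0 l c].
Proof.
elim: l before => //= x l IH before.
rewrite eqnb hasbE; case: eqP => [->|xr].
  case: hasP => [[y yl]|_ /IH [b [c [h1 h2 h3 [h4|[a h4 h5]]]]]]; last 2 first.
  - by exists b.+1, c.+1; split=> //; left.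
  - by exists b.+1, c.+1; split=> //; right; exists a.+1.
  rewrite hasbE => /hasP[z zb /eqP yz] _; move: yl; rewrite mem_filter => /andP[yr /(nthP 0) [i il E]].
  exists 0, i.+1; split=> //=; first by rewrite E; apply/eqP.
  by left; rewrite E yz.
move=> /IH [b [c [h1 h2 h3 h4]]]; exists b.+1, c.+1; split=> //=.
case: h4 => [|[a h4 h5]]; last by right; exists a.+1.
rewrite inE => /orP[/eqP->|h4]; first by right; exists 0.
by left.
Qed.

Lemma partitions_cons g ks l x rest : partitions g ks l (x :: rest) =
  flatten [seq partitions g (rcons ks x) (rcons l r) rest |
            r <- iota 0 (size l).+1 & may_join g ks l x r].
Proof. by []. Qed.

Lemma partitionsP g k P : size P = size k ->
  (forall i, i < size k -> nth 0 P i <= i /\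
     may_join g (take i k) (take i P) (nth c0 k i) (nth 0 P i)) ->
  P \in partitions g [::] [::] k.
Proof.
move=> sP H.
have G n i : i + n = size k -> P \in partitions g (take i k) (take i P) (drop i k).
  elim: n i => [|n IH] i E.
    by rewrite addn0 in E; rewrite E drop_size -sP take_size inE.
  have ik : i < size k by lia.
  rewrite (drop_nth c0 ik) partitions_cons; have [h1 h2] := H i ik.
  apply/flattenP; exists (partitions g (rcons (take i k) (nth c0 k i))
     (rcons (take i P) (nth 0 P i)) (drop i.+1 k)).
    apply/mapP; exists (nth 0 P i) => //.
    by rewrite mem_filter h2 mem_iota size_takel ?sP ?(ltnW ik) //=.
  by rewrite -!take_nth ?sP //; apply: IH; lia.
by have := G (size k) 0 (add0n _); rewrite !take0 drop0.
Qed.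

Lemma all_goodP n k : all_good n -> size k = 7 -> candidate k -> lookup (good n) k.
Proof.
move=> H sk; have := @trie_all_tab 7 (fun k => if candidate k then lookup (good n) k else true) k sk H.
by case: (candidate k).
Qed.

End Checker.

(** * Kempe chains and their pattern on the ring *)

Module KempeChains.
Import zify.
Import Checker.

Lemma good0 : good 0 = tab 7 (fun k => if candidate k then extends k else false).
Proof. by []. Qed.

Lemma goodS n : good n.+1 = tab 7 (fun k => if candidate k then
  if lookup (good n) k then true else hasb (kempe (good n) k) shifts else false).
Proof. by []. Qed.

Section Kempe.
Context (T : finType) (e : rel T) (H : pred T) (r : seq T) (x0 : T).
Hypothesis eC : symmetric e.
Hypothesis size_r : size r = 7.
Hypothesis ringH : {in r, forall z, ~~ H z}.
Hypothesis ring_edge : forall i, i.+1 < 7 -> e (nth x0 r i) (nth x0 r i.+1).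
Hypothesis ring_close : e (last x0 r) (head x0 r).

Definition off_hub_coloring (c : T -> col) :=
  forall x y, ~~ H x -> ~~ H y -> e x y -> c x != c y.

Definition col_colorable := exists c : T -> col, forall x y, e x y -> c x != c y.

Hypothesis noncross : forall (f : rel T), symmetric f ->
  (forall x y, f x y -> [/\ e x y, ~~ H x & ~~ H y]) ->
  forall i j k l, i < j -> j < k -> k < l -> l < 7 ->
  connect f (nth x0 r i) (nth x0 r k) -> connect f (nth x0 r j) (nth x0 r l) ->
  connect f (nth x0 r i) (nth x0 r j).

Hypothesis extendsP : forall c, off_hub_coloring c -> extends [seq c z | z <- r] -> col_colorable.

Section Chain.
Variables (c : T -> col) (g : col).
Hypothesis cP : off_hub_coloring c.
Hypothesis g0 : g != c0.

Definition chain : rel T := [rel x y | [&& e x y, ~~ H x, ~~ H y & cadd (c x) (c y) == g]].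

Lemma chain_sym : symmetric chain.
Proof. by move=> x y; rewrite /chain /= eC (caddC (c x)) (andbCA (~~ H x)). Qed.

Lemma chain_connect_sym : connect_sym chain.
Proof. exact: sym_connect_sym chain_sym. Qed.

Lemma chain_class x y : connect chain x y -> same_class g (c x) (c y).
Proof.
rewrite /same_class !neqcE !negbK => /connectP[s ps ->] {y}.
elim: s x ps => [|y s IH] x /=; first by rewrite eqxx.
case/andP=> /and4P[_ _ _ /eqP E] /IH /orP[/eqP <-|/eqP E'].
  by rewrite E eqxx orbT.
by apply/orP; left; apply/eqP/(@cadd_inj (c y)); rewrite E' caddC E.
Qed.

(** A block is named by its first position on the ring, as in [partitions]. *)
Let rep (w : T) := find (fun z => connect chain z w) r.
Definition pattern : seq nat := [seq rep w | w <- r].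

Lemma rep_lt w : w \in r -> rep w < 7.
Proof. by move=> wr; rewrite -size_r -has_find; apply/hasP; exists w. Qed.

Lemma rep_connect w : w \in r -> connect chain (nth x0 r (rep w)) w.
Proof. by move=> wr; apply: (nth_find x0 (a := fun z => connect chain z w)); rewrite has_find size_r rep_lt. Qed.

Lemma eq_rep w w' : connect chain w w' -> rep w = rep w'.
Proof.
move=> C; apply: eq_find => z; apply/idP/idP => h; first exact: connect_trans h C.
by apply: connect_trans h _; rewrite chain_connect_sym.
Qed.

Lemma rep_le i : i < 7 -> rep (nth x0 r i) <= i.
Proof.
move=> i7; rewrite leqNgt; apply/negP => h.
by have := before_find x0 h; rewrite connect0.
Qed.

Lemma rep_eq w w' : w \in r -> w' \in r -> rep w = rep w' -> connect chain w w'.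
Proof.
move=> wr wr' E; have h := rep_connect wr; have h' := rep_connect wr'; rewrite -E in h'.
by apply: connect_trans h'; rewrite chain_connect_sym.
Qed.

Lemma nth_pattern i : i < 7 -> nth 0 pattern i = rep (nth x0 r i).
Proof. by move=> i7; rewrite (nth_map x0) ?size_r. Qed.

Lemma ring_mem i : i < 7 -> nth x0 r i \in r.
Proof. by move=> i7; rewrite mem_nth ?size_r. Qed.

Lemma pattern_partition : pattern \in partitions g [::] [::] [seq c z | z <- r].
Proof.
apply: partitionsP; first by rewrite !size_map.
move=> i; rewrite size_map size_r => i7; rewrite nth_pattern //; split; first exact: rep_le.
set p := rep _; have pi : p <= i := rep_le i7.
have p7 : p < 7 by lia.
have st : size (take i pattern) = i by rewrite size_takel // size_map size_r ltnW.
have cn j : j < 7 -> nth c0 [seq c z | z <- r] j = c (nth x0 r j).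
  by move=> j7; rewrite (nth_map x0) ?size_r.
have nthP j : j < i -> nth 0 (take i pattern) j = rep (nth x0 r j).
  by move=> ji; rewrite nth_take // nth_pattern //; lia.
have nthc j : j < i -> nth c0 (take i [seq c z | z <- r]) j = c (nth x0 r j).
  by move=> ji; rewrite nth_take // (nth_map x0) // size_r; lia.
have ci : nth c0 [seq c z | z <- r] i = c (nth x0 r i) by rewrite (nth_map x0) ?size_r.
have J1 : (p == i) || (nth 0 (take i pattern) p == p) &&
    same_class g (nth c0 [seq c z | z <- r] i) (nth c0 (take i [seq c z | z <- r]) p).
  case: eqVneq => //= pE; have pli : p < i by rewrite ltn_neqAle pE.
  have C := rep_connect (ring_mem i7).
  rewrite nthP // nthc // ci (eq_rep C) eqxx /=; apply: chain_class.
  by rewrite chain_connect_sym.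
have J2 : neqc (cadd (nth c0 [seq c z | z <- r] i) (last (nth c0 [seq c z | z <- r] i)
    (take i [seq c z | z <- r]))) g || (p == last 0 (take i pattern)).
  (* At the first position the default value of [last] makes the difference [c0], which is not
     [g]. *)
  case: (posnP i) => [i0|ip].
    by rewrite i0 take0 /= caddxx neqcE eq_sym g0.
  have i1 : i.-1 < i by lia.
  have -> : last (nth c0 [seq c z | z <- r] i) (take i [seq c z | z <- r]) = c (nth x0 r i.-1).
    rewrite (last_nth c0) size_takel ?size_map ?size_r 1?ltnW //.
    by rewrite -[X in nth _ (_ :: _) X](prednK ip) /= nthc.
  have -> : last 0 (take i pattern) = rep (nth x0 r i.-1).
    by rewrite (last_nth 0) st -[X in nth _ (_ :: _) X](prednK ip) /= nthP.
  rewrite ci neqcE; case: eqVneq => //= E; apply/eqP/eq_rep.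
  apply: connect1; rewrite /chain /= E eqxx !ringH ?ring_mem //; last by lia.
  by rewrite andbT eC; have := ring_edge (i := i.-1); rewrite prednK // => ->.
(* A crossing gives [a < b < d < i] with [a], [d] on one chain and [b], [i] on one chain; [noncross]
   merges the two. *)
have J3 : ~~ crosses (take i pattern) p [::].
  apply/negP => /crossesP [b [d [/andP[bd]]]]; rewrite st => di.
  rewrite !nthP ?(ltn_trans bd) // => Eb Ed [//|[a ab]].
  rewrite nthP; last by lia.
  move=> Ea; case: Ed; rewrite -Eb -Ea; apply: eq_rep.
  have [a7 b7 d7] : [/\ a < 7, b < 7 & d < 7] by split; lia.
  apply: (@noncross chain chain_sym _ a b d i) => //.
  - by move=> x y /and4P[].
  - by apply: rep_eq; rewrite ?ring_mem.
  - by apply: rep_eq; rewrite ?ring_mem.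
rewrite /may_join st !eqnb J3.
move: J1 J2; case: eqVneq => _ /=; first by move=> _; case: (neqc _ _) => //= ->.
by move=> /andP[-> ->]; case: (neqc _ _) => //= ->.
Qed.

Lemma pattern_closes : closes g [seq c z | z <- r] pattern.
Proof.
have rl : last x0 r \in r by rewrite -nth_last mem_nth ?size_r.
have rh : head x0 r \in r by rewrite -nth0 mem_nth ?size_r.
have -> : closes g [seq c z | z <- r] pattern =
    neqc (cadd (c (last x0 r)) (c (head x0 r))) g || (rep (last x0 r) == rep (head x0 r)).
  by rewrite /closes /pattern; case: (r) size_r => // x s _ /=; rewrite !last_map.
rewrite neqcE; case: eqVneq => //= E; apply/eqP/eq_rep/connect1.
by rewrite /chain /= ring_close !ringH //= E eqxx.
Qed.

(** [B] is a union of whole chains, so no off-hub edge of difference [g] leaves it and adding [g] on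
    it keeps the coloring proper; a translation then makes the first ring color [c0]. *)
Lemma switched (A : seq nat) : exists c', off_hub_coloring c' /\
  [seq c' z | z <- r] = normal (flip g [seq c z | z <- r] pattern A).
Proof.
pose B z := has (fun w => (rep w \in A) && connect chain w z) r.
pose c1 z := if B z then cadd (c z) g else c z.
have BE w : w \in r -> B w = (rep w \in A).
  move=> wr; apply/hasP/idP => [[w' w'r /andP[wA /eq_rep <-]]|h] //.
  by exists w => //; rewrite h connect0.
have ring1 : [seq c1 z | z <- r] = flip g [seq c z | z <- r] pattern A.
  rewrite /flip /pattern zip_map -map_comp; apply/eq_in_map => w wr /=.
  rewrite /c1 BE // hasbE; congr (if _ then _ else _).
  by apply/idP/hasP => [h|[n nA /eqP->]] //; exists (rep w) => //; apply/eqP.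
have c1P : off_hub_coloring c1.
  have X x y : ~~ H x -> ~~ H y -> e x y -> B x -> ~~ B y -> cadd (c x) g != c y.
    move=> hx hy exy Bx; apply: contra => /eqP E.
    case/hasP: Bx => w wr /andP[wA wx]; apply/hasP; exists w => //; rewrite wA.
    apply: connect_trans wx _; apply: connect1; rewrite /chain /= exy hx hy -E.
    by rewrite caddA caddxx caddC cadd0 eqxx.
  move=> x y hx hy exy; rewrite /c1; case: ifPn => Bx; case: ifPn => By.
  - by rewrite !(caddC _ g) (inj_eq (@cadd_inj g)); exact: cP.
  - exact: X.
  - by rewrite eq_sym; apply: X => //; rewrite eC.
  - exact: cP.
exists (fun z => cadd (head c0 [seq c1 z | z <- r]) (c1 z)); split.
  by move=> x y hx hy exy; rewrite (inj_eq (@cadd_inj _)); exact: c1P.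
by rewrite -ring1 /normal -map_comp.
Qed.

End Chain.

(** The pattern of the actual coloring is among the partitions examined by [kempe], which therefore
    supplies a switch leading to the previous level. *)
Lemma kempe_reduction n c : off_hub_coloring c -> lookup (good n) [seq c z | z <- r] -> col_colorable.
Proof.
have sr (c' : T -> col) : size [seq c' z | z <- r] = 7 by rewrite size_map.
elim: n c => [|n IH] c cP.
  rewrite good0 lookup_tab //; case: (candidate _) => //.
  exact: extendsP.
rewrite goodS lookup_tab //; case: (candidate _) => //.
case: ifP => [L _|_]; first exact: IH L.
rewrite hasbE => /hasP[g gs]; rewrite /kempe allbE => /allP.
have g0 : g != c0 by move: gs; rewrite !inE => /or3P[]/eqP->.
move=> /(_ _ (@pattern_partition c g g0)); rewrite pattern_closes // hasbE => /hasP[A _].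
have [c' [c'P <-]] := @switched c g cP A.
exact: IH.
Qed.

Lemma reducible c : off_hub_coloring c -> col_colorable.
Proof.
move=> cP; pose k := head c0 [seq c z | z <- r].
pose c' z := cadd k (c z).
have c'P : off_hub_coloring c'.
  by move=> x y hx hy exy; rewrite (inj_eq (@cadd_inj _)); exact: cP.
apply: (kempe_reduction c'P); apply: (all_goodP all_good5); first by rewrite size_map.
have r0 i : i < 7 -> ~~ H (nth x0 r i) by move=> i7; apply: ringH; rewrite mem_nth ?size_r.
have re i : i.+1 < 7 -> c' (nth x0 r i) != c' (nth x0 r i.+1).
  by move=> i7; apply: c'P; [apply: r0; lia|exact: r0|exact: ring_edge].
have rc : c' (last x0 r) != c' (head x0 r).
  by apply: c'P ring_close; rewrite ?(r0 0) // -?nth0 -?nth_last ?size_r r0.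
have h0 : c' (head x0 r) = c0.
  by rewrite /c' /k; case: (r) size_r => // x s _ /=; rewrite caddxx.
move: re rc h0; case: (r) size_r => [|r0' [|r1 [|r2 [|r3 [|r4 [|r5 [|r6 [|]]]]]]]] //= _ re rc h0.
rewrite /candidate /= neqcE h0 eqxx /= /proper_ring allbE /= !neqcE -h0.
by rewrite rc (re 0) // (re 1) // (re 2) // (re 3) // (re 4) // (re 5).
Qed.
End Kempe.

End KempeChains.

(** * The configuration, its ring and the extension of colorings *)

Module Hub.
Import zify.
Import QuotientMap Rotation Checker KempeChains.

Lemma connect_walk (T : finType) (e f : rel T) (H : pred T) x y : ~~ H x ->
  (forall x y, f x y -> [/\ e x y, ~~ H x & ~~ H y]) -> connect f x y ->
  exists s, [/\ path e x s, last x s = y & {in x :: s, forall z, connect f x z && ~~ H z}].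
Proof.
move=> Hx fe /connectP[s ps ->]; exists s; split=> //.
  by apply: sub_path ps => u w /fe[].
move=> z zs; rewrite (path_connect ps zs) /=.
elim: s x Hx ps zs => [|w s IH] x Hx /=; first by rewrite inE => _ /eqP->.
case/andP=> /fe[_ _ Hw] ps; rewrite inE => /orP[/eqP->//|]; exact: IH.
Qed.

Lemma extends_hub k0 k1 k2 k3 k4 k5 k6 : extends [:: k0; k1; k2; k3; k4; k5; k6] ->
  exists a v d b c, [/\ all (fun x => a != x) [:: k0], all (fun x => v != x) [:: k0; k1; k2; a],
    all (fun x => d != x) [:: k2; k3; k4; a; v], all (fun x => b != x) [:: k4; k5; a; d] &
    all (fun x => c != x) [:: k5; k6; k0; a; b]].
Proof.
have neqs x (s : seq col) : allb (neqc x) s = all (fun y => x != y) s.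
  by rewrite allbE; apply: eq_all => y; rewrite neqcE.
rewrite /extends hasbE => /hasP[a _]; rewrite neqs; case: ifP => // A1.
rewrite hasbE => /hasP[v _]; rewrite neqs; case: ifP => // A2.
rewrite hasbE => /hasP[d _]; rewrite neqs; case: ifP => // A3.
rewrite hasbE => /hasP[b _]; rewrite neqs; case: ifP => // A4.
rewrite hasbE => /hasP[c _]; rewrite neqs => A5.
by exists a, v, d, b, c.
Qed.

Section Configuration.
Context (T : finType) (e : rel T) (next : T -> T -> T).
Hypothesis eC : symmetric e.
Hypothesis eI : irreflexive e.
Hypothesis mapP : sphere_map e next.
Hypothesis conn : forall x z z', z != x -> z' != x ->
  exists s, [/\ path e z s, last z s = z' & x \notin z :: s].

(** Successive neighbors in a rotation are adjacent: the excluded adjacencies leave only [r] after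
    [q] and only [t] before [p], hence [s] between them. *)
Lemma rotation5 x p q r s t : uniq [:: p; q; r; s; t] ->
  (forall z, e x z = (z \in [:: p; q; r; s; t])) -> next x p = q ->
  ~~ e q s -> ~~ e q t -> ~~ e p r -> ~~ e p s ->
  [/\ next x q = r, next x r = s, next x s = t & next x t = p].
Proof.
move=> U N xp qs qt pr ps.
have exp : e x p by rewrite N !inE eqxx.
have [] := next_traject eC eI mapP conn exp.
have -> : #|[set z | e x z]| = 5.
  rewrite cardsE -[5]/(size [:: p; q; r; s; t]) -(card_uniqP U).
  by apply: eq_card => z; rewrite -N.
rewrite /= xp => U' M E.
have xq : e x q by rewrite N !inE eqxx orbT.
have [eqr _] := map_face mapP xq; have x4 := iter_next mapP 4 exp.
move: U' E; set x2 := next x q in eqr *; set x3 := next x x2; set x4' := next x x3 => U' E.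
rewrite /= xp -/x2 -/x3 -/x4' in x4.
have [ep _] := map_face mapP x4; rewrite E eC in ep.
have x2N : e x x2 by exact: (map_edge mapP xq).
have x3N : e x x3 by exact: (map_edge mapP x2N).
have Ur : x2 = r.
  move: x2N; rewrite N !inE => /or4P[/eqP h|/eqP h|/eqP //|/orP[/eqP h|/eqP h]].
  - by rewrite h /= !inE eqxx ?orbT in U'.
  - by rewrite h /= !inE eqxx ?orbT ?andbF in U'.
  - by rewrite h (negPf qs) in eqr.
  - by rewrite h (negPf qt) in eqr.
have Ut : x4' = t.
  move: x4; rewrite N !inE => /or4P[/eqP h|/eqP h|/eqP h|/orP[/eqP h|/eqP //]].
  - by rewrite h /= !inE eqxx ?orbT in U'.
  - by rewrite h /= !inE eqxx ?orbT ?andbF in U'.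
  - by rewrite h (negPf pr) in ep.
  - by rewrite h (negPf ps) in ep.
have Us : x3 = s.
  rewrite Ur Ut in U'; move: x3N U'; rewrite N !inE => /or4P[/eqP->|/eqP->|/eqP->|/orP[/eqP->//|/eqP->]] /=;
    by rewrite eqxx ?orbT /= ?andbF.
split=> //; [by rewrite -Ur|by rewrite -Us|by rewrite -Ut].
Qed.

Context (a b c d v1 v2 v3 v4 v5 : T).
Hypothesis uniqV : uniq [:: a; b; c; d; v1; v2; v3; v4; v5].
Hypothesis Na : forall z, e a z = (z \in [:: b; c; d; v1; v2]).
Hypothesis Nb : forall z, e b z = (z \in [:: a; c; d; v4; v5]).
Hypothesis Nc : forall z, e c z = (z \in [:: a; b; v2; v3; v4]).
Hypothesis deg_v1 : #|[set z | e v1 z]| = 5.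
Hypothesis deg_d : #|[set z | e d z]| = 6.
Hypothesis next_ab : next a b = c.

Ltac distinct :=
  rewrite ?(Na, Nb, Nc) /= ?inE ?negb_or ?andbT; repeat (apply/andP; split);
  first [assumption | by rewrite eq_sym].

Lemma around_triangle :
  [/\ next a c = v2, next a v2 = v1, next a v1 = d & next a d = b] /\
  [/\ next b a = d, next b d = v5, next b v5 = v4 & next b v4 = c] /\
  [/\ next c b = v4, next c v4 = v3, next c v3 = v2 & next c v2 = a].
Proof.
have eab : e a b by rewrite Na mem_head.
have [ebc next_bc] := map_face mapP eab; rewrite next_ab in ebc next_bc.
have [_ next_ca] := map_face mapP ebc; rewrite next_bc in next_ca.
have := uniqV; rewrite /= !inE !negb_or -!andbA.
(* Nine distinct vertices give 36 inequalities. *)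
do 35?[case/andP=> ?]; rewrite ?andbT => ?.
split; [|split]; apply: rotation5 => //; try by distinct.
all: move=> z; rewrite ?(Na, Nb, Nc) !inE.
all: by do 5![case: (z =P _) => _].
Qed.

Definition hub : pred T := [pred z | z \in [:: a; b; c; d; v1]].

Lemma hub_reducible k : off_hub_coloring e hub k -> col_colorable e.
Proof.
have [[a_c a_v2 a_v1 a_d] [[b_a b_d b_v5 b_v4] [c_b c_v4 c_v3 c_v2]]] := around_triangle.
have ead : e a d by rewrite Na !inE eqxx !orbT.
have eav1 : e a v1 by rewrite Na !inE eqxx !orbT.
have eav2 : e a v2 by rewrite Na !inE eqxx !orbT.
have ebd : e b d by rewrite Nb !inE eqxx !orbT.
have ebv5 : e b v5 by rewrite Nb !inE eqxx !orbT.
have ebv4 : e b v4 by rewrite Nb !inE eqxx !orbT.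
have ecv4 : e c v4 by rewrite Nc !inE eqxx !orbT.
have ecv3 : e c v3 by rewrite Nc !inE eqxx !orbT.
have ecv2 : e c v2 by rewrite Nc !inE eqxx !orbT.
have [] := map_face mapP eav1; rewrite a_v1 => ev1d v1_d.
have [_ d_a] := map_face mapP ev1d; rewrite v1_d in d_a.
have [] := map_face mapP eav2; rewrite a_v2 => ev2v1 v2_v1.
have [_ v1_a] := map_face mapP ev2v1; rewrite v2_v1 in v1_a.
have [] := map_face mapP ead; rewrite a_d => edb d_b.
have [] := map_face mapP ebd; rewrite b_d => edv5 d_v5.
have [] := map_face mapP ebv5; rewrite b_v5 => ev5v4 _.
have [] := map_face mapP ecv4; rewrite c_v4 => ev4v3 _.
have [] := map_face mapP ecv3; rewrite c_v3 => ev3v2 _.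
(* The known faces give the part [d], [a], [v2] of the rotation at [v1]; degree 5 leaves the two
   neighbors [p] and [q]. *)
have [] := next_traject eC eI mapP conn ev1d; rewrite deg_v1 /= v1_d v1_a.
set p := next v1 v2; set q := next v1 p => Uv1 Mv1 v1_q.
have [] := next_traject eC eI mapP conn edb; rewrite deg_d /= d_b d_a.
have ev1p : e v1 p by apply: (map_edge mapP); rewrite eC.
have ev1q : e v1 q by exact: (map_edge mapP ev1p).
have [ev2p _] : e v2 p /\ next v2 p = v1 by apply: (map_face mapP); rewrite eC.
have [epq _] := map_face mapP ev1p; rewrite -/q in epq.
have [] := map_face mapP ev1q; rewrite v1_q => eqd q_d.
have [_ d_v1] := map_face mapP eqd; rewrite q_d in d_v1; rewrite d_v1.
have edq : e d q by rewrite eC.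
set y := next d q => Ud Md; have edy : e d y by exact: (map_edge mapP edq).
have [eqy _] := map_face mapP edq; rewrite -/y in eqy.
have edw := map_edge mapP edy.
(* By degree 6 the neighbor of [d] after [y] is followed by [b], as is [v5]. *)
rewrite -d_v5 => /(next_inj mapP edw edv5) d_y.
have [eyv5 _] := map_face mapP edy; rewrite d_y in eyv5.
rewrite d_y in Ud.
have := uniqV; rewrite /= !inE !negb_or -!andbA.
do 35?[case/andP=> ?]; rewrite ?andbT => ?.
have nbv1 : ~~ e b v1 by distinct.
have ncv1 : ~~ e c v1 by distinct.
have ncd : ~~ e c d by distinct.
have irr z w : e z w -> z != w by move=> h; apply: contraTneq h => ->; rewrite eI.
have nadj u z w : ~~ e u w -> e w z -> z != u by move=> n h; apply: contraNneq n => <-; rewrite eC.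
(* Neighbors of [v1] differ from [b] and [c], and [y], a neighbor of [d], differs from [c]. With the
   distinctness inside the rotations at [v1] and [d], this puts [p], [q] and [y] outside the hub. *)
have [pb pc qb qc yc] : [/\ p != b, p != c, q != b, q != c & y != c].
  by split; [apply: nadj nbv1 _|apply: nadj ncv1 _|apply: nadj nbv1 _|apply: nadj ncv1 _|apply: nadj ncd _].
have [pv1 qv1 yd] : [/\ p != v1, q != v1 & y != d] by split; rewrite eq_sym; exact: irr.
move: Uv1; rewrite !inE !negb_or ?andbT -!andbA; do 9![case/andP=> ?]=> ?.
move: Ud; rewrite !inE !negb_or ?andbT -!andbA; do 14![case/andP=> ?]=> ?.
pose r := [:: v2; p; q; y; v5; v4; v3].
(* The darts from the hub to the ring, in the order of a walk around the hub. *)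
pose D := [:: (a, v2); (v1, v2); (v1, p); (v1, q); (d, q); (d, y); (d, v5); (b, v5); (b, v4);
  (c, v4); (c, v3); (c, v2)].
have ringH : {in r, forall z, ~~ hub z}.
  by apply/allP; rewrite /hub; distinct.
have hubD t : t < size D -> [/\ hub (nth (a, a) D t).1, ~~ hub (nth (a, a) D t).2 &
    e (nth (a, a) D t).1 (nth (a, a) D t).2].
  move=> tD; have : nth (a, a) D t \in D by exact: mem_nth.
  move: (nth _ _ _) => x {tD} xD; split.
  - by apply: (allP (a := fun x => hub x.1) _ x xD); rewrite /hub /= !inE !eqxx ?orbT.
  - by apply: (allP (a := fun x => ~~ hub x.2) _ x xD); rewrite /= !ringH // !inE !eqxx ?orbT.
  - by apply: (allP (a := fun x => e x.1 x.2) _ x xD); rewrite /= !(eC v1 v2) ev2v1 ?andbT; do ?[apply/andP; split].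
have uniqD : uniq D.
  rewrite /D /= !inE !xpair_eqE !eqxx /= !negb_or !negb_and ?andbT; repeat (apply/andP; split);
  first [done | assumption | by rewrite eq_sym | apply/orP; left; first [assumption | by rewrite eq_sym]].
have turnD t : t.+1 < size D ->
  ((nth (a, a) D t.+1).1 = next (nth (a, a) D t).1 (nth (a, a) D t).2 /\
     (nth (a, a) D t.+1).2 = (nth (a, a) D t).2) \/
  ((nth (a, a) D t.+1).1 = (nth (a, a) D t).1 /\
     (nth (a, a) D t.+1).2 = next (nth (a, a) D t).1 (nth (a, a) D t).2).
  by do 11![case: t => [|t] /=; first by move=> _; first [by left | by right]].
have to_hub z : hub z -> exists s, [/\ path e a s, last a s = z & all hub s].
  move=> hz; have [->|za] := eqVneq z a; first by exists [::].
  exists [:: z]; rewrite /= hz; split=> //; rewrite andbT.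
  by move: hz; rewrite /hub /= Na !inE (negPf za) /= => /or4P[]/eqP->; rewrite !eqxx ?orbT.
have hubC u w : hub u -> hub w -> exists s, [/\ path e u s, last u s = w & all hub s].
  move=> hu /to_hub [s [s1 s2 s3]]; have [->|ua] := eqVneq u a; first by exists s.
  exists (a :: s); split=> //=; last by rewrite s3 /hub /= mem_head.
  rewrite s1 andbT eC.
  by move: hu; rewrite /hub /= Na !inE (negPf ua) /= => /or4P[]/eqP->; rewrite !eqxx ?orbT.
(* The first dart of [D] at each ring position. *)
pose t i := nth 0 [:: 0; 2; 3; 5; 6; 8; 10] i.
have tE i : i < 7 -> nth a r i = (nth (a, a) D (t i)).2.
  by do 7![case: i => [|i] //].
have tD i : i < 7 -> t i < size D by do 7![case: i => [|i] //].
have t_lt i j : i < j -> j < 7 -> t i < t j.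
  move=> ij j7; apply: (sorted_ltn_nth ltn_trans 0 (s := [:: 0; 2; 3; 5; 6; 8; 10])) => //.
  exact: ltn_trans ij j7.
apply: (@reducible _ e hub r a) => //.
- by move=> i; do 6![case: i => [|i] //=]; rewrite eC.
- move=> f fC fe i j l m ij jl lm m7 Cil Cjm; apply/negPn/negP => Nij.
  have [i7 j7 l7] : [/\ i < 7, j < 7 & l < 7] by split; move: ij jl lm m7; clear; lia.
  have nh n : n < 7 -> ~~ hub (nth a r n) by move=> n7; apply/ringH/mem_nth.
  have [sK [K1 K2 K3]] := connect_walk (nh i i7) fe Cil.
  have [sL [L1 L2 L3]] := connect_walk (nh j j7) fe Cjm.
  rewrite !tE // in K1 K2 K3 L1 L2 L3 Nij.
  apply: (noncrossing eC eI mapP conn hubD uniqD turnD hubC (t_lt _ _ ij j7) (t_lt _ _ jl l7)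
    (t_lt _ _ lm m7) (tD _ m7) K1 K2 L1 L2 K3 L3).
  move=> z Kz Lz; case/negP: Nij; apply: connect_trans Kz _.
  by rewrite (sym_connect_sym fC).
- move=> c1 c1P /extends_hub [ka [kv [kd [kb [kc []]]]]]; rewrite /= !andbT.
  move=> A1 /and4P[A2 A3 A4 A5] /and5P[A6 A7 A8 A9 A10] /and4P[A11 A12 A13 A14].
  move=> /and5P[A15 A16 A17 A18 A19].
  pose c2 z := if z == a then ka else if z == b then kb else if z == c then kc else
    if z == d then kd else if z == v1 then kv else c1 z.
  have c2_off z : ~~ hub z -> c2 z = c1 z.
    by rewrite /hub /c2 /= !inE !negb_or => /and5P[/negPf-> /negPf-> /negPf-> /negPf-> /negPf->].
  have [c2_v2 c2_p c2_q c2_y] : [/\ c2 v2 = c1 v2, c2 p = c1 p, c2 q = c1 q & c2 y = c1 y].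
    by split; apply/c2_off/ringH; rewrite !inE eqxx ?orbT.
  have [c2_v3 c2_v4 c2_v5] : [/\ c2 v3 = c1 v3, c2 v4 = c1 v4 & c2 v5 = c1 v5].
    by split; apply/c2_off/ringH; rewrite !inE eqxx ?orbT.
  have [c2_a c2_b c2_c c2_d c2_v1] : [/\ c2 a = ka, c2 b = kb, c2 c = kc, c2 d = kd & c2 v1 = kv].
    by rewrite /c2; split; rewrite ?eqxx /= ?ifN // eq_sym.
  have at_a z : e a z -> c2 a != c2 z.
    by rewrite Na !inE => /or4P[|||/orP[]]/eqP->;
      rewrite ?(c2_a, c2_b, c2_c, c2_d, c2_v1, c2_v2); first [assumption | by rewrite eq_sym].
  have at_b z : e b z -> c2 b != c2 z.
    by rewrite Nb !inE => /or4P[|||/orP[]]/eqP->;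
      rewrite ?(c2_a, c2_b, c2_c, c2_d, c2_v4, c2_v5); first [assumption | by rewrite eq_sym].
  have at_c z : e c z -> c2 c != c2 z.
    by rewrite Nc !inE => /or4P[|||/orP[]]/eqP->;
      rewrite ?(c2_a, c2_b, c2_c, c2_v2, c2_v3, c2_v4); first [assumption | by rewrite eq_sym].
  have at_d z : e d z -> c2 d != c2 z.
    have := Md z; rewrite [in RHS]inE => <-; rewrite d_y !inE => /or4P[|||/or3P[]]/eqP->;
      rewrite ?(c2_a, c2_b, c2_d, c2_v1, c2_q, c2_y, c2_v5); first [assumption | by rewrite eq_sym].
  have at_v1 z : e v1 z -> c2 v1 != c2 z.
    have := Mv1 z; rewrite [in RHS]inE => <-; rewrite !inE => /or4P[|||/orP[]]/eqP->;
      rewrite ?(c2_a, c2_d, c2_v1, c2_v2, c2_p, c2_q); first [assumption | by rewrite eq_sym].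
  have at_hub x z : hub x -> e x z -> c2 x != c2 z.
    rewrite /hub /= !inE => /or4P[|||/orP[]]/eqP->; [exact: at_a|exact: at_b|exact: at_c|exact: at_d|exact: at_v1].
  exists c2 => x z exz; have [hx|hx] := boolP (hub x); first exact: at_hub.
  have [hz|hz] := boolP (hub z); first by rewrite eq_sym; apply: at_hub; rewrite // eC.
  by rewrite !c2_off // c1P.
Qed.
End Configuration.

End Hub.

(** * Colors as pairs of bits, and the two orientations of the configuration *)

Import QuotientMap Coloring MinimalMap Rotation Checker KempeChains Hub.

Definition col_of_ord (i : 'I_4) : col := (odd i, 1 < i).
Definition ord_of_col (x : col) : 'I_4 := inord (x.1 + 2 * x.2).

Lemma col_of_ord_inj : injective col_of_ord.
Proof.
by case=> [[|[|[|[|]]]]] // i; case=> [[|[|[|[|]]]]] // j //= _; apply/val_inj.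
Qed.

Lemma ord_of_col_inj : injective ord_of_col.
Proof.
move=> [x1 x2] [y1 y2] /(congr1 val); rewrite /= !inordK; last 2 first.
- by case: y1 y2 => [] [].
- by case: x1 x2 => [] [].
by case: x1 x2 y1 y2 => [] [] [] [].
Qed.

Unset Implicit Arguments.

Theorem theorem3p6 (T : finType) (e : rel T)
  (a b c d v1 v2 v3 v4 v5 : T) :
  in_eMPGN4 e ->
  uniq [:: a; b; c; d; v1; v2; v3; v4; v5] ->
  e a b -> e b c -> e a c ->
  deg e a = 5 -> deg e b = 5 -> deg e c = 5 ->
  neighbours e a = [set b; c; d; v1; v2] ->
  neighbours e b = [set a; c; d; v4; v5] ->
  neighbours e c = [set a; b; v2; v3; v4] ->
  ~ (deg e v1 = 5 /\ deg e d = 6).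
Proof.
move=> EP uniqV eab ebc eac da _ _ NA NB NC [dv1 dd].
have [next [mapP conn]] := min_counterexample_map EP.
have [[[eC eI] _ ePl eN] _ eMin] := EP.
have Na z : e a z = (z \in [:: b; c; d; v1; v2]).
  by have := in_set (e a) z; rewrite -[finset _]/(neighbours e a) NA !inE -!orbA => <-.
have Nb z : e b z = (z \in [:: a; c; d; v4; v5]).
  by have := in_set (e b) z; rewrite -[finset _]/(neighbours e b) NB !inE -!orbA => <-.
have Nc z : e c z = (z \in [:: a; b; v2; v3; v4]).
  by have := in_set (e c) z; rewrite -[finset _]/(neighbours e c) NC !inE -!orbA => <-.
have [k kP] : exists k, colors_on e (~: [set x in [:: a; b; c; d; v1]]) k.
  apply: (proper_colors eC eI ePl eMin).
  by apply/negP => /eqP/setP/(_ a); rewrite !inE eqxx.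
have off : off_hub_coloring e (hub a b c d v1) (col_of_ord \o k).
  move=> x y hx hy exy; rewrite (inj_eq col_of_ord_inj); by apply: kP; rewrite // in_setC in_set.
suff [k' k'P] : col_colorable e.
  by apply: eN; exists (ord_of_col \o k') => x y /k'P; rewrite (inj_eq ord_of_col_inj).
(* The common neighbors of [a] and [b] are [c] and [d]. If [d] were the third vertex of both faces
   at this edge, the rotation at [a] would return to [b] after two steps instead of five. *)
have nextC : next a b = c \/ next b a = c.
  have eba : e b a by rewrite eC.
  have [ebx b_x] := map_face mapP eab; have eax := map_edge mapP eab.
  have [eay a_y] := map_face mapP eba; have eby := map_edge mapP eba.
  have common z : e a z -> e b z -> z = c \/ z = d.
    rewrite Na Nb !inE; have := uniqV; rewrite /= !inE !negb_or -!andbA.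
    do 35?[case/andP=> ?]; rewrite ?andbT => ?.
    case/or4P=> [|||/orP[]] /eqP->; auto => h; exfalso; move: h; apply/negP;
      rewrite !negb_or; repeat (apply/andP; split); first [assumption | by rewrite eq_sym].
  have [|E1] := common _ eax ebx; first by left.
  have [|E2] := common _ eay eby; first by right.
  have [] := next_traject eC eI mapP conn eab; rewrite -[#|_|]/(deg e a) da /=.
  by rewrite E1 -E2 a_y E2 /= !inE eqxx ?orbT ?andbF.
case: nextC => next_ab.
  exact: (hub_reducible eC eI mapP conn uniqV Na Nb Nc dv1 dd next_ab off).
exact: (hub_reducible eC eI (mirror_map eC mapP) conn uniqV Na Nb Nc dv1 dd next_ab off).
Qed.
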